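(* The map $$F:\bigl(\mathcal P_{\mathrm{ac}}(B)\cap L^\infty(B),\|\cdot\|_{L^\infty(B)}\bigr)\times\mathcal P(Y)\to\mathbb R,\qquad F(\bar p,\nu):=F_\nu(\bar p)=\mathcal T_c(\mu_{\bar p},\nu),$$ is continuous, where $\mathcal P(Y)$ is equipped with the weak topology. In particular, suppose that $\nu_n\rightharpoonup\nu$ in $\mathcal P(Y)$, and for each $n\in\mathbb N$ let $\bar p_n$ (respectively $\bar p$) be the unique minimiser of $F_{\nu_n}$ (respectively $F_\nu$) over $\mathcal P_{\mathrm{ac}}(B)$. Then: (i) $F_{\nu_n}$ $\Gamma$-converges to $F_\nu$ on $\bigl(\mathcal P_{\mathrm{ac}}(B)\cap L^\infty(B),\|\cdot\|_{L^\infty(B)}\bigr)$; (ii) $\bar p_n\to\bar p$ in $\mathcal C(B)$; (iii) $\mu_{\bar p_n}\to\mu_{\bar p}$ strongly in $L^1(X)$. Moreover, if $\gamma_n$ (respectively $\gamma$) is an optimal transport plan from $\mu_{\bar p_n}$ to $\nu_n$ (respectively from $\mu_{\bar p}$ to $\nu$) for each $n\in\mathbb N$, then up to a subsequence $\gamma_n\rightharpoonup\gamma$ in $\mathcal P(X\times Y)$.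
   Context: Setting. Let $d\ge 2$, let $B\subset\mathbb R^{d-1}$ be compact with non-empty interior, let $X:=B\times[0,+\infty)$ with points written $x=(s,p)$, and let $Y\subset\mathbb R^d$ be non-empty and compact. The cost $c:X\times Y\to[0,+\infty)$ satisfies: (A) $c$ is locally Lipschitz; (B) for all $s\in B$ and $y\in Y$ the function $c((s,\cdot),y):[0,+\infty)\to[0,+\infty)$ is strictly increasing and unbounded; (C) the set of functions $\{c((\cdot,p),y):B\to[0,+\infty)\mid p\in[0,+\infty),\,y\in Y\}$ is equicontinuous. Notation. $\mathcal C(B)$ is the space of continuous real functions on $B$ with the uniform norm; $\mathcal P(A)$ is the set of Borel probability measures on $A$ and $\rightharpoonup$ denotes weak convergence of probability measures (tested against bounded continuous functions); $\mathcal P_{\mathrm{ac}}(B)$ is the set of elements of $\mathcal P(B)$ absolutely continuous with respect to Lebesgue measure $\mathcal L^{d-1}$, identified with their densities (as elements of $L^1(B)$). For $\bar p\in\mathcal P_{\mathrm{ac}}(B)$ let $X_{\bar p}:=\{(s,p)\in X: p\le\bar p(s)\}$ and $\mu_{\bar p}:=\mathcal L^d|_{X_{\bar p}}$ (restriction of Lebesgue measure, identified with its density $\mathbf 1_{X_{\bar p}}$), a probability measure on $X$. For $\mu\in\mathcal P(X)$, $\nu\in\mathcal P(Y)$, $\mathcal T_c(\mu,\nu):=\inf_{\gamma\in\Gamma(\mu,\nu)}\int_{X\times Y}c\,\mathrm d\gamma$, where $\Gamma(\mu,\nu)$ is the set of probability measures on $X\times Y$ with marginals $\mu,\nu$; an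 optimal transport plan from $\mu$ to $\nu$ is an element of $\Gamma(\mu,\nu)$ attaining the infimum. $F_\nu(\bar p):=\mathcal T_c(\mu_{\bar p},\nu)$ for $\bar p\in\mathcal P_{\mathrm{ac}}(B)$. For every $\nu\in\mathcal P(Y)$ the functional $F_\nu$ has a unique minimiser over $\mathcal P_{\mathrm{ac}}(B)$, and it has a continuous density; convergence of minimisers in $\mathcal C(B)$ refers to these continuous densities. $\Gamma$-convergence of functionals $F_n$ to $F_\infty$ on a metric space $M$: for every $m\in M$, $\liminf_n F_n(m_n)\ge F_\infty(m)$ whenever $m_n\to m$, and there is a sequence $m_n\to m$ with $\limsup_nF_n(m_n)\le F_\infty(m)$.
   Formalization: Optimal plans need not be unique, so a subsequence of γ_n is shown to converge to some optimal plan γ, not to one fixed beforehand. As B may have null parts, continuous densities need not be unique; (ii) says some continuous densities of the minimisers converge uniformly on B. *)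

(* Defs.v *)
From HB Require Import structures.
From mathcomp Require Import all_boot all_order all_algebra.
From mathcomp Require Import all_classical all_reals all_analysis.
From mathcomp Require Import measurable_realfun ess_sup_inf.

Set Implicit Arguments.
Unset Strict Implicit.
Unset Printing Implicit Defensive.

Import Order.TTheory GRing.Theory Num.Theory.
Import numFieldNormedType.Exports.

Local Open Scope classical_set_scope.
Local Open Scope ring_scope.

HB.instance Definition _ (T U : ptopologicalType) := Pointed.on (T * U)%type.

Notation borel T := (g_sigma_algebraType (@open T)).

Section borel_facts.
Context {T : ptopologicalType}.

Lemma open_borel (A : set T) : open A -> measurable (A : set (borel T)).
Proof. by move=> oA; exact: sub_sigma_algebra. Qed.

Lemma closed_borel (A : set T) : closed A -> measurable (A : set (borel T)).
Proof. by move=> /closed_openC/open_borel/measurableC; rewrite setCK. Qed.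

Lemma continuous_borel (U : ptopologicalType) (f : T -> U) :
  continuous f -> measurable_fun [set: borel T] (f : borel T -> borel U).
Proof.
move=> /continuousP cf.
have := @measurability _ _ (borel T) (borel U) setT f open erefl; apply.
by move=> _ [A oA <-]; rewrite setTI; apply: open_borel; exact: cf.
Qed.

Lemma continuous_borelR (R : realType) (f : T -> R) :
  continuous f -> measurable_fun [set: borel T] (f : borel T -> R).
Proof.
move=> /continuousP cf.
apply: (measurability _ (RGenOpens.measurableE R)) => //.
move=> _ [_ [a [b ->] <-]]; rewrite setTI; apply: open_borel; apply: cf.
exact: interval_open.
Qed.

End borel_facts.

Section lebesgue.
Context {R : realType}.

Lemma open_measurable_rVR n (A : set ('rV[R]_n * R)) :
  open A -> measurable (A : set (borel 'rV[R]_n * measurableTypeR R)).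
Proof.
move=> oA.
pose U (i : 'rV[rat]_n * rat * nat) : set ('rV[R]_n * R) :=
  ball (map_mx ratr i.1.1 : 'rV[R]_n) i.2.+1%:R^-1 `*`
  ball (ratr i.1.2 : R) i.2.+1%:R^-1.
pose V i := if `[< U i `<=` A >] then U i else set0.
have -> : A = \bigcup_i V i.
  apply/seteqP; split => [x Ax|x [i _]]; last first.
    by rewrite /V; case: asboolP => // UA /UA.
  have /nbhs_ballP[e /= e0 xeA] : nbhs x A by exact: open_nbhs_nbhs.
  have [k /= ke] : exists k : nat, k.+1%:R^-1 < e / 2.
    have [N _ NN] := near_infty_natSinv_lt (PosNum (divr_gt0 e0 (ltr0n _ 2))).
    by exists N; apply: NN => /=.
  have k0 : 0 < k.+1%:R^-1 :> R by rewrite invr_gt0.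
  have approx (r : R) : exists q : rat, ball (ratr q : R) k.+1%:R^-1 r.
    have /rat_in_itvoo[q] : r - k.+1%:R^-1 < r + k.+1%:R^-1.
      by rewrite ltrBlDr -addrA ltrDl addr_gt0.
    rewrite in_itv/= => /andP[q1 q2]; exists q.
    by rewrite /ball/= ltr_distlC ltrBlDr q2/= -ltrBlDr.
  have [q1 hq1] : exists q : 'rV[rat]_n,
      ball (map_mx ratr q : 'rV[R]_n) k.+1%:R^-1 x.1.
    have /choice[f hf] (j : 'I_n) := approx (x.1 0 j).
    exists (\row_j f j); split => // i j; rewrite !mxE [i]ord1; exact: hf.
  have [q2 hq2] := approx x.2.
  exists (q1, q2, k) => //; rewrite /V; case: asboolP => [_|]; first by split.
  case=> y [/= y1 y2]; apply: xeA.
  have kke : k.+1%:R^-1 + k.+1%:R^-1 <= e :> R.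
    by rewrite [leRHS]splitr lerD// ltW.
  split; apply: (le_ball kke).
    by apply: ball_triangle y1; exact: ball_sym.
  by apply: ball_triangle y2; exact: ball_sym.
apply: countable_bigcupT_measurable => [|i]; first exact: countableP.
rewrite /V; case: asboolP => // _; apply: measurableX.
  by apply: open_borel; exact: ball_open.
by apply: open_measurable; exact: ball_open.
Qed.

Lemma measurable_fun_rVR n :
  measurable_fun [set: borel 'rV[R]_n * measurableTypeR R]
    (idfun : _ -> borel ('rV[R]_n * R)%type).
Proof.
refine (@measurability _ _ (borel 'rV[R]_n * measurableTypeR R)%type
  (borel ('rV[R]_n * R)%type) setT idfun (@open ('rV[R]_n * R)%type) erefl _).
by move=> _ [A oA <-]; rewrite setTI; exact: open_measurable_rVR.
Qed.

Lemma measurable_rVR n (A : set ('rV[R]_n * R)) :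
  measurable (A : set (borel 'rV[R]_n * measurableTypeR R)) ->
  measurable (A : set (borel ('rV[R]_n * R)%type)).
Proof.
have m : measurable_fun [set: borel ('rV[R]_n * R)%type]
    (idfun : _ -> borel 'rV[R]_n * measurableTypeR R)%type.
  apply/(@measurable_fun_pairP _ _ _ (borel ('rV[R]_n * R)%type)); split.
    by apply: (@continuous_borel _ _ fst) => z; exact: cvg_fst.
  by apply: (@continuous_borelR _ _ snd) => z; exact: cvg_snd.
by move=> mA; rewrite -[A]setTI; exact: m.
Qed.

Section image.
Context d (T : measurableType d) (U : ptopologicalType).
Variables (m : {measure set T -> \bar R}) (f : T -> borel U).
Hypothesis mf : measurable_fun [set: T] f.

Definition image_measure : set (borel U) -> \bar R := pushforward m f.

Let image0 : image_measure set0 = 0%E. Proof. exact: measure0. Qed.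
Let image_ge0 A : (0 <= image_measure A)%E. Proof. exact: measure_ge0. Qed.
Let image_sigma_additive : semi_sigma_additive image_measure.
Proof. exact: (@measure_semi_sigma_additive _ _ _ (pushforward m f)). Qed.

HB.instance Definition _ := isMeasure.Build _ _ _ image_measure
  image0 image_ge0 image_sigma_additive.

Definition image : {measure set (borel U) -> \bar R} := image_measure.
End image.


Definition prod_lebesgue n (m : {measure set (borel 'rV[R]_n) -> \bar R}) :
    {measure set (borel ('rV[R]_n * R)%type) -> \bar R} :=
  @image _ _ ('rV[R]_n * R)%type (m \x @lebesgue_measure R)%E idfun
    (@measurable_fun_rVR n).

Definition consrV n (z : 'rV[R]_n * R) : 'rV[R]_n.+1 :=
  row_mx (const_mx z.2 : 'rV[R]_1) z.1.

Lemma consrV_continuous n : continuous (@consrV n).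
Proof.
move=> z; apply/cvg_ballP => e e0.
have : nbhs z (ball z e) by exact: nbhsx_ballx.
apply: filterS => w [[_ z1] z2]; split => // i j.
rewrite /consrV !mxE; case: splitP => k _; first by rewrite !mxE.
by rewrite ord1; exact: z1.
Qed.

(* n-dimensional Lebesgue measure, as an iterated product transported to row
   vectors; lebesgue_rV_box below is its characteristic property. *)
Fixpoint lebesgue_rV n : {measure set (borel 'rV[R]_n) -> \bar R} :=
  if n is m.+1 then
    @image _ _ 'rV[R]_m.+1 (prod_lebesgue (lebesgue_rV m)) (@consrV m)
      (continuous_borel (@consrV_continuous m))
  else @dirac _ (borel 'rV[R]_0) (0 : 'rV[R]_0) R.

(* Lebesgue measure on R^(n+1), seen as R^n x R. *)
Definition lebesgue_rVR n := prod_lebesgue (lebesgue_rV n).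

Lemma lebesgue_rV_box n (A : 'I_n -> set R) :
  (forall i, measurable (A i)) ->
  lebesgue_rV n [set v | forall i, A i (v 0 i)] =
  (\prod_(i < n) lebesgue_measure (A i))%E.
Proof.
elim: n A => [|n IH] A mA; first by rewrite big_ord0 /= diracE mem_set// => -[].
rewrite big_ord_recl /= muleC.
rewrite /image_measure /prod_lebesgue/= /pushforward/= /image /image_measure.
rewrite /pushforward.
have -> : idfun @^-1` (@consrV n @^-1` [set v | forall i, A i (v 0 i)]) =
    [set v : 'rV[R]_n | forall i, A (lift ord0 i) (v 0 i)] `*` A ord0
    :> set ('rV_n * R).
  apply/seteqP; split => -[v x] /=.
    move=> H; split => [i|] /=.
      have := H (lift ord0 i); rewrite /consrV mxE; case: splitP => j /=.
        by rewrite [j]ord1.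
      by move=> [ij]; have -> : i = j by exact: val_inj.
    by have := H ord0; rewrite /consrV mxE; case: splitP => j //=; rewrite mxE.
  move=> [H1 H2] i /=; rewrite /consrV mxE; case: splitP => j /= ij.
    rewrite mxE.
    by have -> : i = ord0 by apply: val_inj => /=; rewrite [LHS]ij [j]ord1.
  by have -> : i = lift ord0 j by exact: val_inj.
rewrite product_measure1E//; first by congr (_ * _)%E; exact: IH.
  have -> : [set v : 'rV[R]_n | forall i, A (lift ord0 i) (v 0 i)] =
      \bigcap_(i in [set: 'I_n])
        (fun v : 'rV[R]_n => v 0 i) @^-1` A (lift ord0 i).
    by apply/seteqP; split => v /= H i; [move=> _|]; exact: H.
  apply: fin_bigcap_measurable => // i _; rewrite -[X in measurable X]setTI.
  exact: (continuous_borelR (@coord_continuous _ _ _ 0 (i : 'I_n))).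
exact: mA.
Qed.

End lebesgue.

Section weak_convergence.
Context {T : ptopologicalType} (R : realType).

(* Borel probability measures on A, encoded as those on the ambient space that
   give mass 1 to A. *)
Record prob_on (A : set T) := ProbOn {
  prob_on_measure :> probability (borel T) R ;
  prob_on1 : prob_on_measure A = 1%E }.

HB.instance Definition _ A := gen_eqMixin (prob_on A).
HB.instance Definition _ A := gen_choiceMixin (prob_on A).

Definition Cb (A : set T) := {f : T -> R | {within A, continuous f} /\
  exists M, forall x, A x -> `|f x| <= M}.

Definition Cb_eval A (m : prob_on A) : {ptws Cb A -> R} :=
  fun f => \int[m]_(x in A) sval f x.

(* The topology of weak convergence: the coarsest one making
   m |-> \int_A f dm continuous for every bounded continuous f on A. *)
HB.instance Definition _ A :=
  Topological.copy (prob_on A) (initial_topology (@Cb_eval A)).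

Lemma prob_on_cvgP A (m_ : nat -> prob_on A) (m : prob_on A) :
  m_ @ \oo --> m <-> forall f : Cb A,
    \int[m_ n]_(x in A) sval f x @[n --> \oo] --> \int[m]_(x in A) sval f x.
Proof.
split => [mm f|mm].
  have /cvg_sup/(_ f) H : (@Cb_eval A \o m_) @ \oo --> Cb_eval m.
    apply: cvg_comp; first exact: mm.
    exact: (@initial_continuous _ _ (@Cb_eval A)).
  move=> U /nbhs_ballP[e /= e0 eU].
  pose V := [set g : Cb A -> R | ball (\int[m]_(x in A) sval f x) e (g f)].
  have [N _ NN] : (@Cb_eval A \o m_) x @[x --> \oo] V.
    apply: H; exists V; split => //=; last exact: ballxx.
    by exists (ball (\int[m]_(x in A) sval f x) e) => //; exact: ball_open.
  by exists N => // n /NN; exact: eU.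
move=> U [V [[W oW <-] Wm] WU].
have H : (@Cb_eval A \o m_) @ \oo --> Cb_eval m.
  apply/cvg_sup => f U' [V' [[W' oW' <-] W'm] WU'].
  have : nbhs (\int[m]_(x in A) sval f x) W' by exact: open_nbhs_nbhs.
  by move=> /(mm f)[N _ NN]; exists N => // n /NN; exact: WU'.
have : nbhs (Cb_eval m) W by exact: open_nbhs_nbhs.
by move=> /H[N _ NN]; exists N => // n /NN; exact: WU.
Qed.

End weak_convergence.

Section transport.
Context {T1 T2 : ptopologicalType} {R : realType}.
Context (A1 : set T1) (A2 : set T2) (c : T1 -> T2 -> R).
Local Open Scope ereal_scope.

Definition couplings (mu : prob_on R A1) (nu : prob_on R A2) :
    set (prob_on R (A1 `*` A2)) :=
  [set g : prob_on R (A1 `*` A2) |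
    (forall U : set (borel T1), measurable U -> g (fst @^-1` U) = mu U) /\
    (forall V : set (borel T2), measurable V -> g (snd @^-1` V) = nu V)].

Definition transport_cost (g : prob_on R (A1 `*` A2)) : \bar R :=
  \int[g]_(z in A1 `*` A2) (c z.1 z.2)%:E.

Definition Tc mu nu : \bar R :=
  ereal_inf [set transport_cost g | g in couplings mu nu].

Definition optimal_plan mu nu g :=
  couplings mu nu g /\ transport_cost g = Tc mu nu.

End transport.

Section densities.
Context {R : realType} {n : nat}.
Local Notation leb := (@lebesgue_rV R n).
Implicit Types (B : set 'rV[R]_n) (q r : 'rV[R]_n -> R).

(* An absolutely continuous probability measure on B is given by a
   representative of its density; values outside B are irrelevant. *)
Record Pac B := MkPac {
  density :> 'rV[R]_n -> R ;
  density_measurable : measurable_fun (B : set (borel 'rV[R]_n)) density ;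
  density_ge0 : {ae leb, forall s, B s -> 0 <= density s} ;
  density1 : (\int[leb]_(s in B) (density s)%:E = 1)%E }.

(* q is extended by 0 outside B, which does not change the essential supremum
   of |q| when B has positive measure. *)
Definition Linf_norm B q : \bar R := 'N[leb]_+oo[EFin \o (q \_ B)]%E.

Record PacLinf B := MkPacLinf {
  PacLinf_Pac :> Pac B ;
  PacLinf_lty : (Linf_norm B PacLinf_Pac < +oo)%E }.

HB.instance Definition _ B := gen_eqMixin (PacLinf B).
HB.instance Definition _ B := gen_choiceMixin (PacLinf B).

Lemma Linf_normE B q : (Linf_norm B q = if 0 < leb [set: _]
  then ess_sup leb (fun s => `| (q \_ B) s |%:E) else 0)%E.
Proof. by rewrite /Linf_norm unlock. Qed.

Lemma Linf_norm0 B : Linf_norm B (cst 0) = 0%E.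
Proof.
rewrite /Linf_norm (_ : _ \o _ = cst 0%E) ?Lnorm0//.
by apply/funext => s /=; rewrite patchE; case: ifP.
Qed.

Lemma Linf_normN B q : Linf_norm B (\- q) = Linf_norm B q.
Proof.
rewrite !Linf_normE; case: ifPn => // _; congr ess_sup; apply/funext => s.
by rewrite !patchE; case: ifP => // _ /=; rewrite normrN.
Qed.

Lemma Linf_normD B q r :
  (Linf_norm B (q \+ r)%R <= Linf_norm B q + Linf_norm B r)%E.
Proof.
rewrite !Linf_normE; case: ifPn => _; last by rewrite adde0.
apply: le_trans (ess_supD _ _ _); apply: le_ess_sup; apply: nearW => s /=.
rewrite -EFinD lee_fin !patchE; case: ifP => _; last by rewrite normr0 addr0.
exact: ler_normD.
Qed.

(* The L^oo distance is only a pseudometric on PacLinf, because densities that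
   are equal almost everywhere on B are not identified. *)
Section Linf_pseudometric.
Variable B : set 'rV[R]_n.
Local Notation M := (PacLinf B).

Let ball (u : M) (e : R) : set M :=
  [set v : M | (Linf_norm B (u \- v)%R < e%:E)%E].
Let ent : set_system (M * M) := entourage_ ball.
Let nbhs (u : M) : set_system M := nbhs_ ent u.
Let nbhsE : nbhs = nbhs_ ent. Proof. by []. Qed.

HB.instance Definition _ := hasNbhs.Build M nbhs.

Let ball_center (u : M) (e : R) : 0 < e -> ball u e u.
Proof.
move=> e0; rewrite /ball/= (_ : _ \- _ = cst 0) ?Linf_norm0//.
by apply/funext => s /=; rewrite subrr.
Qed.

Let ball_sym (u v : M) (e : R) : ball u e v -> ball v e u.
Proof.
rewrite /ball/= -Linf_normN (_ : \- _ = v \- u)//.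
by apply/funext => s /=; rewrite opprB.
Qed.

Let ball_triangle (u v w : M) (e1 e2 : R) :
  ball u e1 v -> ball v e2 w -> ball u (e1 + e2) w.
Proof.
rewrite /ball/= => uv vw; rewrite EFinD.
apply: le_lt_trans (lteD uv vw).
rewrite (_ : u \- w = (u \- v) \+ (v \- w)) ?Linf_normD//.
by apply/funext => s /=; rewrite addrA subrK.
Qed.

Let entourageE : ent = entourage_ ball. Proof. by []. Qed.

HB.instance Definition _ := @Nbhs_isPseudoMetric.Build R M
  ent nbhsE ball ball_center ball_sym ball_triangle entourageE.

End Linf_pseudometric.

Definition cylinder B : set ('rV[R]_n * R) := [set x | B x.1 /\ 0 <= x.2].

Definition subgraph B q : set ('rV[R]_n * R) :=
  cylinder B `&` [set x | x.2 <= q x.1].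

Lemma subgraph_measurable B q : compact B ->
  measurable_fun (B : set (borel 'rV[R]_n)) q ->
  measurable (subgraph B q : set (borel 'rV[R]_n * measurableTypeR R)).
Proof.
move=> cB mq.
have mB : measurable (B : set (borel 'rV[R]_n)).
  by apply: closed_borel; apply: compact_closed => //; exact: norm_hausdorff.
have mqB : measurable_fun [set: borel 'rV[R]_n] (q \_ B).
  by apply/(@measurable_restrictT _ _ (borel 'rV[R]_n) _ B q mB).
have -> : subgraph B q = (B `*` `[0, +oo[) `&` [set x | x.2 <= (q \_ B) x.1].
  apply/seteqP; split => -[s p] /=.
    move=> [[/= Bs p0] pq]; split; first by split => //=; rewrite in_itv/= p0.
    by rewrite patchE mem_set.
  move=> [[/= Bs]]; rewrite in_itv/= andbT => p0.
  by rewrite patchE mem_set.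
apply: measurableI; first exact: measurableX.
rewrite -[X in measurable X]setTI.
have := @measurable_fun_le _ (borel 'rV[R]_n * measurableTypeR R)%type R setT
  snd (fun x => (q \_ B) x.1) measurableT.
apply; first exact: measurable_snd.
exact: (measurableT_comp mqB measurable_fst).
Qed.

End densities.

Section cylinder_measure.
Context {R : realType} {n : nat} (B : set 'rV[R]_n) (cB : compact B).
Variable p : Pac B.

Let mS : measurable (subgraph B p : set (borel ('rV[R]_n * R)%type)).
Proof.
by apply: measurable_rVR; apply: subgraph_measurable (density_measurable p).
Qed.

Definition mu_pac_fun : set (borel ('rV[R]_n * R)%type) -> \bar R :=
  mrestr (@lebesgue_rVR R n) mS.

HB.instance Definition _ := Measure.on mu_pac_fun.

Let mu_pac_fun_subgraph (A : set (borel ('rV[R]_n * R)%type)) :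
  subgraph B p `<=` A -> mu_pac_fun A = 1%E.
Proof.
move=> SA; rewrite /mu_pac_fun /mrestr setIC setIidl//.
rewrite -(density1 p) [RHS]integral_mkcond.
rewrite /lebesgue_rVR /prod_lebesgue /image /image_measure /pushforward/=.
rewrite /product_measure1.
have mB : measurable (B : set (borel 'rV[R]_n)).
  by apply: closed_borel; apply: compact_closed => //; exact: norm_hausdorff.
have mp := density_measurable p.
apply: ae_eq_integral => //=.
- apply: measurable_fun_xsection; exact: subgraph_measurable.
- apply/(measurable_restrictT _ mB); exact/measurable_EFinP.
have aeF := ae_filter_ringOfSetsType (@lebesgue_rV R n).
apply: (@filterS _ _ aeF) (density_ge0 p) => s ps _.
rewrite patchE.
change (lebesgue_measure (xsection (subgraph B p) s) =
  if s \in B then (p s)%:E else 0%E).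
case: ifPn => [/set_mem Bs|/negP Bs].
  have -> : xsection (subgraph B p) s = `[0, p s]%classic.
    apply/seteqP; split => r /=; rewrite in_itv/= /xsection/= inE.
      by move=> [[/= _ r0] /= rp]; apply/andP.
    by move=> /andP[r0 rp].
  rewrite lebesgue_measure_itv/= lte_fin sube0.
  by have := ps Bs; rewrite le_eqVlt => /predU1P[<-|->//]; rewrite ltxx.
have -> : xsection (subgraph B p) s = set0.
  apply/seteqP; split => r //; rewrite /xsection/= inE => -[[/= Bs' _] _].
  by apply: Bs; exact: mem_set.
exact: measure0.
Qed.

Let mu_pac_setT : mu_pac_fun setT = 1%E.
Proof. exact: mu_pac_fun_subgraph. Qed.

HB.instance Definition _ :=
  Measure_isProbability.Build _ _ _ mu_pac_fun mu_pac_setT.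

Let mu_pac_cylinder : mu_pac_fun (cylinder B) = 1%E.
Proof. by apply: mu_pac_fun_subgraph => x []. Qed.

Definition mu_pac : prob_on R (cylinder B) := ProbOn mu_pac_cylinder.

End cylinder_measure.

Section functional.
Context {R : realType} {n : nat} {T : ptopologicalType}.
Context (B : set 'rV[R]_n) (Y : set T) (c : 'rV[R]_n * R -> T -> R).

Definition transport_functional (cB : compact B) (nu : prob_on R Y)
    (p : Pac B) : \bar R :=
  Tc c (mu_pac cB p) nu.

Definition is_minimiser (F : Pac B -> \bar R) (p : Pac B) :=
  forall q, (F p <= F q)%E.

Definition continuous_density (p : Pac B) (q : 'rV[R]_n -> R) :=
  {within B, continuous q} /\
  {ae @lebesgue_rV R n, forall s, B s -> q s = p s}.

End functional.

Definition Gamma_cvg (R : realType) (M : pseudoMetricType R)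
    (F_ : nat -> M -> \bar R) (F : M -> \bar R) :=
  forall m : M,
    (forall m_ : nat -> M, m_ @ \oo --> m ->
      (F m <= limn_einf (fun n => F_ n (m_ n)))%E) /\
    (exists2 m_ : nat -> M, m_ @ \oo --> m &
      (limn_esup (fun n => F_ n (m_ n)) <= F m)%E).

(* Main.v *)
Require Import Defs.
From HB Require Import structures.
From mathcomp Require Import all_boot all_order all_algebra.
From mathcomp Require Import all_classical all_reals all_analysis.
From mathcomp Require Import measurable_realfun ess_sup_inf ring lra.

Set Implicit Arguments.
Unset Strict Implicit.
Unset Printing Implicit Defensive.

Import Order.TTheory GRing.Theory Num.Theory.
Import numFieldNormedType.Exports.

Local Open Scope classical_set_scope.
Local Open Scope ring_scope.

(** Everything rests on comparing transport costs by explicit couplings: a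
    measure whose two projections have the right laws bounds the infimum from
    above (Tc_le_law).

    Continuity.  Let nu and nu' give nearly the same integrals to a partition
    of unity of Y with small supports.  They are then coupled by an explicit
    kernel that moves almost all the mass by a small distance, and composing a
    transport plan with this kernel changes its cost by little, uniformly over
    the source measures carried by a slab B x [0, M] (Tc_near).  In the source,
    two densities are compared by resampling the mass of the difference of
    their subgraphs, so F nu is Lipschitz for the L^1 distance of densities
    bounded by M (Tc_move, functional_lipschitz).  Joint continuity
    follows, and with it Gamma-convergence, with constant recovery sequences.

    Regularity.  If a minimiser p were at least b + t on a set of positive
    measure and at most a - t on another one, while the cost at height a is
    smaller than the cost at height b by a fixed amount, then moving a little
    mass from the first set to the second would lower the functional; so one
    of the two sets is null (minimiser_swap).  For distant heights this bounds
    p, and for nearby base points it gives p a modulus of continuity outside a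
    null set.  Both are independent of nu (minimiser_regular).

    Stability.  Folding the subgraphs of p and q along the height of their
    mean sends the average of the two measures to the measure of the mean
    density and only lowers heights, which saves an amount of cost controlled
    by the L^1 distance of p and q (midpoint_le).  Hence minimisers for nu and
    nu' are L^1-close when F nu and F nu' are uniformly close (L1_stability).
    As minimisers share a modulus of continuity, L^1 convergence is uniform
    convergence on a set of full measure (uniform_of_L1), and an extension
    operator that does not increase uniform distances (modulus_extension)
    transfers it to continuous densities on the whole of B.

    Optimal plans.  All the plans live on one compact set, so a subsequence
    converges weakly (weak_compactness).  The marginals pass to the limit
    because continuous functions determine a measure (marginal_limit).  On the
    compact set the cost is continuous and bounded, hence costs
    converge; since the minimal values converge too (minimum_cvg), the limit
    plan is optimal.

    Two conventions are used throughout.  The cost is extended by 0 outside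
    the product of the two domains (cost_ext), and dense sequences witness
    separability, thanks to which Borel rectangles generate the Borel sets of
    a product. *)

(** * Borel measures, dense sequences and products *)

Section probability_of_measure.
Context d (T : measurableType d) (R : realType).
Variables (m : {measure set T -> \bar R}) (m1 : m setT = 1%E).

Definition prob_of_fun : set T -> \bar R := m.

HB.instance Definition _ := Measure.on prob_of_fun.

Let prob_of_setT : prob_of_fun setT = 1%E. Proof. exact: m1. Qed.

HB.instance Definition _ :=
  Measure_isProbability.Build _ _ _ prob_of_fun prob_of_setT.

(** Turns a measure of total mass 1, known only through an equation, into an
    element of the type of probabilities. *)
Definition prob_of : probability T R := prob_of_fun.

End probability_of_measure.

Section separable.
Context {R : realType}.

Definition dense_seq (T : normedModType R) (D : nat -> T) :=
  forall x e, 0 < e -> exists n, ball x e (D n).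

Lemma dense_seq_prod (T U : normedModType R) (D : nat -> T) (E : nat -> U) :
  dense_seq D -> dense_seq E -> exists F : nat -> (T * U)%type, dense_seq F.
Proof.
move=> DT EU.
exists (fun n => let i := odflt (0%N, 0%N) (unpickle n) in (D i.1, E i.2)).
move=> [x y] e e0; have [i hi] := DT x e e0; have [j hj] := EU y e e0.
by exists (pickle (i, j)); rewrite pickleK.
Qed.

Lemma dense_seq_R : exists D : nat -> R, dense_seq (D : nat -> R^o).
Proof.
exists (fun n => ratr (odflt 0 (unpickle n))) => x e e0.
have /rat_in_itvoo[q] : x - e < x + e.
  by rewrite ltrBlDr -addrA ltrDl addr_gt0.
rewrite in_itv/= => /andP[q1 q2]; exists (pickle q); rewrite pickleK /=.
by rewrite /ball/= ltr_distlC q1.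
Qed.

Lemma dense_seq_rV n : exists D : nat -> 'rV[R]_n, dense_seq D.
Proof.
exists (fun k => map_mx ratr (odflt 0 (unpickle k) : 'rV[rat]_n)) => x e e0.
have approx (r : R) : exists q : rat, ball r e (ratr q).
  have /rat_in_itvoo[q] : r - e < r + e.
    by rewrite ltrBlDr -addrA ltrDl addr_gt0.
  rewrite in_itv/= => /andP[q1 q2]; exists q.
  by rewrite /ball/= ltr_distlC q1.
have /choice[f hf] (j : 'I_n) := approx (x 0 j).
exists (pickle (\row_j f j)); rewrite pickleK/=; split => // i j.
by rewrite !mxE [i]ord1; exact: hf.
Qed.

Lemma open_bigcup_ball (T : normedModType R) (D : nat -> T) (A : set T) :
  dense_seq D -> open A ->
  A = \bigcup_(i in [set i : nat * nat | ball (D i.1) i.2.+1%:R^-1 `<=` A])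
        ball (D i.1) i.2.+1%:R^-1.
Proof.
move=> dD oA; apply/seteqP; split => [x Ax|x [i /= + xi]]; last exact.
have /nbhs_ballP[e /= e0 xeA] : nbhs x A by exact: open_nbhs_nbhs.
have [k ke] : exists k : nat, k.+1%:R^-1 < e / 2.
  have [N _ NN] := near_infty_natSinv_lt (PosNum (divr_gt0 e0 (ltr0n _ 2))).
  by exists N; apply: NN => /=.
have k0 : 0 < k.+1%:R^-1 :> R by rewrite invr_gt0.
have [n hn] := dD x _ k0.
exists (n, k) => /=; last exact: ball_sym.
move=> y yk; apply: xeA.
have kke : k.+1%:R^-1 + k.+1%:R^-1 <= e :> R.
  by rewrite [leRHS]splitr lerD// ltW.
by apply: (le_ball kke); apply: ball_triangle yk.
Qed.

End separable.

Section borel_product.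
Context {R : realType} {T U : normedModType R}.
Variables (D : nat -> T) (E : nat -> U).
Hypotheses (dD : dense_seq D) (dE : dense_seq E).

(** By separability an open set of the product is a countable union of
    products of balls. *)
Lemma open_measurable_prod (A : set (T * U)) :
  open A -> measurable (A : set (borel T * borel U)).
Proof.
move=> oA.
pose F (i : nat * nat * nat) : set (T * U) :=
  ball (D i.1.1) i.2.+1%:R^-1 `*` ball (E i.1.2) i.2.+1%:R^-1.
pose V i := if `[< F i `<=` A >] then F i else set0.
have -> : A = \bigcup_i V i.
  apply/seteqP; split => [x Ax|x [i _]]; last first.
    by rewrite /V; case: asboolP => // FA /FA.
  have /nbhs_ballP[e /= e0 xeA] : nbhs x A by exact: open_nbhs_nbhs.
  have [k ke] : exists k : nat, k.+1%:R^-1 < e / 2.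
    have [N _ NN] := near_infty_natSinv_lt (PosNum (divr_gt0 e0 (ltr0n _ 2))).
    by exists N; apply: NN => /=.
  have k0 : 0 < k.+1%:R^-1 :> R by rewrite invr_gt0.
  have [n hn] := dD x.1 k0; have [m hm] := dE x.2 k0.
  exists (n, m, k) => //; rewrite /V; case: asboolP => [_|]; first by split; apply: ball_sym.
  case=> y [/= y1 y2]; apply: xeA.
  have kke : k.+1%:R^-1 + k.+1%:R^-1 <= e :> R.
    by rewrite [leRHS]splitr lerD// ltW.
  split; apply: (le_ball kke).
    by apply: ball_triangle y1.
  by apply: ball_triangle y2.
apply: countable_bigcupT_measurable => [|i]; first exact: countableP.
rewrite /V; case: asboolP => // _; apply: measurableX;
  by apply: open_borel; exact: ball_open.
Qed.

Lemma measurable_pair_borel d (Z : measurableType d) (f : Z -> T) (g : Z -> U) :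
  measurable_fun [set: Z] (f : Z -> borel T) ->
  measurable_fun [set: Z] (g : Z -> borel U) ->
  measurable_fun [set: Z] ((fun z => (f z, g z)) : Z -> borel (T * U)%type).
Proof.
move=> mf mg.
have mfg : measurable_fun setT ((fun z => (f z, g z)) : Z -> (borel T * borel U)%type).
  exact: measurable_fun_pair.
apply: (@measurability _ _ Z (borel (T * U)%type) setT _ open erefl).
move=> _ [A oA <-]; apply: (mfg measurableT).
exact: open_measurable_prod.
Qed.

End borel_product.

Section law.
Context d d' (Z : measurableType d) (T : measurableType d') (R : realType).
Variables (rho : {measure set Z -> \bar R}) (m : {measure set T -> \bar R}).
Variables (f : Z -> T) (mf : measurable_fun [set: Z] f).
Hypothesis rhom : forall U, measurable U -> rho (f @^-1` U) = m U.

Lemma ge0_integral_law (h : T -> \bar R) :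
  measurable_fun [set: T] h -> (forall x, 0 <= h x)%E ->
  (\int[m]_x h x = \int[rho]_z h (f z))%E.
Proof.
move=> mh h0.
rewrite (eq_measure_integral (pushforward rho f)); last first.
  by move=> A mA _; rewrite -rhom.
by rewrite ge0_integral_pushforward.
Qed.

End law.

(** * Couplings given by laws *)
Section transport_law.
Context {R : realType} {T1 T2 : normedModType R}.
Variables (D1 : nat -> T1) (D2 : nat -> T2).
Hypotheses (dD1 : dense_seq D1) (dD2 : dense_seq D2).
Context (A1 : set T1) (A2 : set T2) (c : T1 -> T2 -> R).
Hypotheses (cA1 : closed A1) (cA2 : closed A2).
Hypothesis c_ge0 : forall x y, A1 x -> A2 y -> 0 <= c x y.

Definition cost_ext (z : T1 * T2) : \bar R :=
  ((fun z => (c z.1 z.2)%:E) \_ (A1 `*` A2)) z.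

Hypothesis mc : measurable_fun [set: borel (T1 * T2)%type] cost_ext.
Local Open Scope ereal_scope.

Lemma cost_ext_ge0 z : 0 <= cost_ext z.
Proof.
rewrite /cost_ext patchE; case: ifPn => // /set_mem[? ?].
by rewrite lee_fin c_ge0.
Qed.

Lemma cost_extE x y : A1 x -> A2 y -> cost_ext (x, y) = (c x y)%:E.
Proof. by move=> ? ?; rewrite /cost_ext patchE mem_set. Qed.

Lemma closed_setX : closed (A1 `*` A2).
Proof.
have -> : A1 `*` A2 = (fst @^-1` A1 `&` snd @^-1` A2) :> set (T1 * T2).
  by [].
apply: closedI.
  by apply: preimage_closed => // z _; exact: cvg_fst.
by apply: preimage_closed => // z _; exact: cvg_snd.
Qed.

Lemma transport_costE (g : prob_on R (A1 `*` A2)) :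
  transport_cost c g = \int[g]_z cost_ext z.
Proof. by rewrite /transport_cost integral_mkcond. Qed.

Lemma le_Tc (mu : prob_on R A1) (nu : prob_on R A2) (a : \bar R) (b : R) :
  (forall g, couplings mu nu g -> a <= transport_cost c g + b%:E) ->
  a <= Tc c mu nu + b%:E.
Proof.
move=> H; rewrite -leeBlDr//; apply: le_ereal_inf_tmp => _ [g gmn <-].
by rewrite leeBlDr//; exact: H.
Qed.

Lemma Tc_ge0 (mu : prob_on R A1) (nu : prob_on R A2) : 0 <= Tc c mu nu.
Proof.
apply: le_ereal_inf_tmp => _ [g gmn <-]; rewrite transport_costE.
by apply: integral_ge0 => z _; exact: cost_ext_ge0.
Qed.

Section law.
Context d (Z : measurableType d) (rho : {measure set Z -> \bar R}).
Variables (f : Z -> borel T1) (g : Z -> borel T2).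
Hypotheses (mf : measurable_fun [set: Z] f) (mg : measurable_fun [set: Z] g).
Variables (mu : prob_on R A1) (nu : prob_on R A2).
Hypothesis rhomu : forall U : set (borel T1), measurable U ->
  rho (f @^-1` U) = mu U.
Hypothesis rhonu : forall V : set (borel T2), measurable V ->
  rho (g @^-1` V) = nu V.

Let fg : Z -> borel (T1 * T2)%type := fun z => (f z, g z).
Let mfg : measurable_fun [set: Z] fg.
Proof. exact: (measurable_pair_borel dD1 dD2). Qed.

Let rhoT : rho setT = 1.
Proof. by rewrite -(preimage_setT f) rhomu// probability_setT. Qed.

Let img1 : Defs.image rho mfg [set: T1 * T2] = 1.
Proof. exact: rhoT. Qed.

Let imgA : prob_of img1 (A1 `*` A2) = 1.
Proof.
have m1 : measurable (f @^-1` A1).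
  by rewrite -[X in measurable X]setTI; apply: mf => //; exact: closed_borel.
have m2 : measurable (g @^-1` A2).
  by rewrite -[X in measurable X]setTI; apply: mg => //; exact: closed_borel.
rewrite -[LHS]/(rho (f @^-1` A1 `&` g @^-1` A2)).
have h1 : rho (f @^-1` A1) = 1.
  by rewrite rhomu ?prob_on1//; exact: closed_borel.
have h2 : rho (~` (g @^-1` A2)) = 0.
  rewrite preimage_setC rhonu; last by apply: measurableC; exact: closed_borel.
  by rewrite probability_setC ?prob_on1 ?subee//; exact: closed_borel.
rewrite -h1 [RHS](measureDI rho m1 m2) -[LHS]add0e; congr (_ + _)%E.
apply/esym/eqP; rewrite eq_le measure_ge0 andbT -h2 le_measure ?inE//.
- exact: measurableD.
- exact: measurableC.
Qed.

Lemma law_coupling : exists2 h : prob_on R (A1 `*` A2), couplings mu nu h &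
  forall F : T1 * T2 -> \bar R,
    measurable_fun [set: borel (T1 * T2)%type] F -> (forall z, 0 <= F z) ->
    \int[h]_z F z = \int[rho]_z F (f z, g z).
Proof.
exists (ProbOn imgA); first by split => U mU; [exact: rhomu|exact: rhonu].
move=> F mF F0.
rewrite (@ge0_integral_law _ _ Z (borel (T1 * T2)%type) R rho (ProbOn imgA) fg)//.
Qed.

(** The source of all upper bounds on the transport cost: to bound it, it is
    enough to exhibit two maps on some measure space with the right laws. *)
Lemma Tc_le_law : Tc c mu nu <= \int[rho]_z cost_ext (f z, g z).
Proof.
have [h hmn hF] := law_coupling.
apply: ereal_inf_lbound; exists h => //.
rewrite transport_costE hF//.
exact: cost_ext_ge0.
Qed.

End law.

End transport_law.

(** * The cost on compact slabs *)
Lemma continuous_pair (S T U : topologicalType) (f : S -> T) (g : S -> U) :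
  continuous f -> continuous g -> continuous (fun z => (f z, g z)).
Proof. by move=> cf cg z; apply: cvg_pair; [exact: cf|exact: cg]. Qed.

Section cost_on_compacts.
Context {R : realType} {T U : normedModType R}.
Context (B : set T) (cB : compact B) (Y : set U) (cY : compact Y).
Context (c : T * R -> U -> R).
Let W : set (T * R * U) := [set z | (B z.1.1 /\ 0 <= z.1.2) /\ Y z.2].

Hypothesis c_cont : forall z e, W z -> 0 < e ->
  \forall w \near z, W w -> `|c w.1 w.2 - c z.1 z.2| < e.
Hypothesis c_incr : forall s y, B s -> Y y ->
  forall p p' : R, 0 <= p -> p < p' -> c (s, p) y < c (s, p') y.
Hypothesis c_unbounded : forall s y, B s -> Y y ->
  forall M : R, exists2 p : R, 0 <= p & M < c (s, p) y.

Let slab (M : R) : set (T * R * U) := (B `*` `[0, M]) `*` Y.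

Let slab_compact M : compact (slab M).
Proof.
apply: compact_setX => //; apply: compact_setX => //.
exact: segment_compact.
Qed.

Let slabW M z : slab M z -> W z.
Proof.
by move=> [[/= Bs]]; rewrite in_itv/= => /andP[p0 _] Yy.
Qed.

Lemma cost_bounded (M : R) : exists2 C, 0 <= C &
  forall s r y, B s -> 0 <= r <= M -> Y y -> c (s, r) y <= C.
Proof.
have /compact_near_coveringP/near_covering_withinP H := @slab_compact M.
have : \forall C \near +oo, slab M `<=` (fun z => c z.1 z.2 <= C).
  apply: (H R (+oo) (fun C z => c z.1 z.2 <= C)) => z zM.
  have h1 := c_cont (slabW zM) ltr01.
  near=> w C; have hC : c z.1 z.2 + 1 <= C.
    by near: C; apply: nbhs_pinfty_ge; exact: num_real.
  move=> wM; have : `|c w.1 w.2 - c z.1 z.2| < 1 by apply: (near h1 w) => //; exact: slabW wM.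
  rewrite ltr_norml => /andP[_]; rewrite ltrBlDl => /ltW/le_trans; apply.
  exact: hC.
move=> near_C; near (pinfty_nbhs R) => C.
have C0 : 0 <= C by near: C; apply: nbhs_pinfty_ge; exact: num_real.
have hC : slab M `<=` (fun z => c z.1 z.2 <= C) by near: C.
exists C => // s r y Bs r0M Yy; apply: (hC (s, r, y)).
by split => //; split => //=; rewrite in_itv.
Unshelve. all: by end_near. Qed.

(** Strict monotonicity becomes quantitative by compactness of the slab: the
    increment over a step of size eta is a positive continuous function. *)
Lemma cost_increment (M eta : R) : 0 < eta -> exists2 k, 0 < k &
  forall s r y, B s -> 0 <= r <= M -> Y y ->
    forall r', r + eta <= r' -> c (s, r) y + k <= c (s, r') y.
Proof.
move=> eta0.
have /compact_near_coveringP/near_covering_withinP H := @slab_compact M.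
pose sh (z : T * R * U) := (z.1.1, z.1.2 + eta, z.2).
have Wsh z : W z -> W (sh z).
  by move=> [[? ?] ?]; split => //; split => //=; rewrite addr_ge0// ltW.
have csh : continuous sh.
  apply: (@continuous_pair _ _ _ (fun z : T * R * U => (z.1.1, z.1.2 + eta)) snd).
    apply: (@continuous_pair _ _ _ (fun z : T * R * U => z.1.1) (fun z => z.1.2 + eta)).
      by move=> z; apply: (@continuous_comp _ _ _ fst fst); exact: cvg_fst.
    move=> z; apply: cvgD; last exact: cvg_cst.
    by apply: (@continuous_comp _ _ _ fst snd); [exact: cvg_fst|exact: cvg_snd].
  by move=> z; exact: cvg_snd.
pose P k (z : T * R * U) := c z.1 z.2 + k <= c (sh z).1 (sh z).2.
have : \forall k \near 0^'+, slab M `<=` P k.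
  apply: H => z zM; have Wz := slabW zM.
  pose g := c (sh z).1 (sh z).2 - c z.1 z.2.
  have g0 : 0 < g.
    rewrite subr_gt0; case: z zM Wz {g} => [[s r] y] _ [[/= Bs r0] Yy].
    by apply: c_incr => //; rewrite ltrDl.
  have g3 : 0 < g / 3 by rewrite divr_gt0.
  have h1 := c_cont Wz g3.
  have h2 : \forall w \near z, W (sh w) ->
      `|c (sh w).1 (sh w).2 - c (sh z).1 (sh z).2| < g / 3.
    exact: (csh z _ (c_cont (Wsh _ Wz) g3)).
  near=> w k; have kg : k < g / 3 by near: k; exact: nbhs_right_lt.
  move=> wM; have Ww := slabW wM.
  have : `|c w.1 w.2 - c z.1 z.2| < g / 3 by exact: (near h1 w).
  have : `|c (sh w).1 (sh w).2 - c (sh z).1 (sh z).2| < g / 3.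
    by apply: (near h2 w) => //; exact: Wsh.
  move: kg; rewrite /P /g !ltr_norml.
  move: (c w.1 w.2) (c z.1 z.2) (c (sh w).1 (sh w).2) (c (sh z).1 (sh z).2).
  by move=> a b a1 b1 k3 /andP[? ?] /andP[? ?] /=; lra.
move=> near_k; near (0:R)^'+ => k.
have k0 : 0 < k by near: k; exact: nbhs_right_gt.
have Pk : slab M `<=` P k by near: k.
exists k => // s r y Bs r0M Yy r'.
have := Pk (s, r, y); rewrite /P/= => h rr'.
have {}h : c (s, r) y + k <= c (s, r + eta) y.
  by apply: h; split => //; split => //=; rewrite in_itv.
apply: (le_trans h); move: rr'; rewrite le_eqVlt => /predU1P[->//|rr'].
apply/ltW/c_incr => //; apply: addr_ge0; last exact: ltW.
by case/andP: r0M.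
Unshelve. all: by end_near. Qed.

Lemma cost_unif_continuous (M e : R) : 0 < e -> exists2 del, 0 < del &
  forall z z', slab M z -> slab M z' -> ball z del z' ->
    c z'.1 z'.2 <= c z.1 z.2 + e.
Proof.
move=> e0.
have /compact_near_coveringP/near_covering_withinP H := @slab_compact M.
pose P del (z : T * R * U) := forall z', slab M z' -> ball z del z' ->
  c z'.1 z'.2 <= c z.1 z.2 + e.
have : \forall del \near (0:R)^'+, slab M `<=` P del.
  apply: H => z zM.
  have e2 : 0 < e / 2 by rewrite divr_gt0.
  have /nbhs_ballP[r /= r0 hr] := c_cont (slabW zM) e2.
  have r2 : 0 < r / 2 by rewrite divr_gt0.
  near=> w del; have delr : del <= r / 2 by near: del; exact: nbhs_right_le.
  move=> wM z' z'M wz'.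
  have zw : ball z (r / 2) w by near: w; exact: nbhsx_ballx.
  have h1 : `|c w.1 w.2 - c z.1 z.2| < e / 2.
    apply: hr (slabW wM); apply: le_ball zw.
    by move: r0; lra.
  have h2 : `|c z'.1 z'.2 - c z.1 z.2| < e / 2.
    apply: hr (slabW z'M); rewrite [r]splitr; apply: ball_triangle zw _.
    exact: le_ball wz'.
  move: h1 h2; rewrite !ltr_norml => /andP[? ?] /andP[? ?]; lra.
move=> near_d; near (0:R)^'+ => del.
have del0 : 0 < del by near: del; exact: nbhs_right_gt.
have Pdel : slab M `<=` P del by near: del.
by exists del => // z z' zM z'M zz'; exact: Pdel zM z' z'M zz'.
Unshelve. all: by end_near. Qed.

(** The height at which the cost exceeds K is locally bounded in (s, y), by
    continuity at one height and monotonicity above it. *)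
Lemma cost_coercive (K : R) : exists2 M, 0 <= M &
  forall s y r, B s -> Y y -> M <= r -> K <= c (s, r) y.
Proof.
have /compact_near_coveringP/near_covering_withinP H :
    compact (B `*` Y : set (T * U)) by exact: compact_setX.
pose P M (z : T * U) := forall r, M <= r -> K <= c (z.1, r) z.2.
have : \forall M \near +oo, B `*` Y `<=` P M.
  apply: H => -[s y] [/= Bs Yy].
  have [p p0 Kp] := c_unbounded Bs Yy K.
  have Wp : W (s, p, y) by [].
  have g0 : 0 < c (s, p) y - K by rewrite subr_gt0.
  have h1 := c_cont Wp g0.
  have cpair : continuous (fun z : T * U => (z.1, p, z.2)).
    apply: (@continuous_pair _ _ _ (fun z : T * U => (z.1, p)) snd).
      apply: (@continuous_pair _ _ _ (fun z : T * U => z.1) (fun=> p)) => z.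
        exact: cvg_fst.
      exact: cvg_cst.
    by move=> z; exact: cvg_snd.
  have h2 : \forall w \near (s, y), W (w.1, p, w.2) ->
      `|c (w.1, p) w.2 - c (s, p) y| < c (s, p) y - K.
    exact: (cpair (s, y) _ h1).
  near=> w M; have pM : p < M.
    by near: M; apply: nbhs_pinfty_gt; exact: num_real.
  move=> -[Bw Yw] r Mr.
  have : `|c (w.1, p) w.2 - c (s, p) y| < c (s, p) y - K.
    by apply: (near h2 w).
  rewrite ltr_norml => /andP[+ _]; rewrite opprB ltrBrDr subrK => /ltW/le_trans.
  apply; have : p < r by exact: lt_le_trans Mr.
  by move=> pr; apply/ltW/c_incr.
move=> near_M; near (pinfty_nbhs R) => M.
have M0 : 0 <= M by near: M; apply: nbhs_pinfty_ge; exact: num_real.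
have PM : B `*` Y `<=` P M by near: M.
by exists M => // s y r Bs Yy Mr; exact: (PM (s, y)).
Unshelve. all: by end_near. Qed.

End cost_on_compacts.

(** * Moving mass in the first marginal *)
Section resample.
Context {R : realType} {T1 T2 : normedModType R}.
Variables (D1 : nat -> T1) (D2 : nat -> T2).
Hypotheses (dD1 : dense_seq D1) (dD2 : dense_seq D2).
Context (A1 : set T1) (A2 : set T2) (c : T1 -> T2 -> R).
Hypotheses (cA1 : closed A1) (cA2 : closed A2).
Hypothesis c_ge0 : forall x y, A1 x -> A2 y -> 0 <= c x y.
Hypothesis mc : measurable_fun [set: borel (T1 * T2)%type] (cost_ext A1 A2 c).
Local Open Scope ereal_scope.

Lemma Tc_ext (mu mu' : prob_on R A1) (nu : prob_on R A2) :
  (forall U : set (borel T1), measurable U -> mu U = mu' U) ->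
  Tc c mu nu = Tc c mu' nu.
Proof.
move=> mumu'; rewrite /Tc; congr ereal_inf; congr image.
by apply/seteqP; split => g [g1 g2]; split => // U mU; rewrite g1// mumu'.
Qed.

Variables (mu mu' : prob_on R A1) (nu : prob_on R A2).
Variables (A S S' : set (borel T1)) (u : probability (borel T1) R).
Hypotheses (mA : measurable A) (mS : measurable S) (mS' : measurable S').
Hypotheses (muS : mu S = 1) (uS' : u S' = 1) (SA1 : S `<=` A1)
  (S'A1 : S' `<=` A1).
Hypothesis mu'E : forall V : set (borel T1), measurable V ->
  mu' V = mu (V `\` A) + mu A * u V.
Variables (a b : R).
Hypotheses (a0 : (0 <= a)%R) (b0 : (0 <= b)%R).
Hypothesis cab : forall x x' y, S x -> A x -> S' x' -> A2 y ->
  (c x' y + a <= c x y + b)%R.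

(** Take a plan for mu and an independent sample of the law u; replace the
    source point by the sample whenever it lies in A.  The new source has law
    mu', the target point is kept, and the cost changes by at most b - a on
    the event A. *)
Lemma Tc_resample : Tc c mu' nu + a%:E * mu A <= Tc c mu nu + b%:E * mu A.
Proof.
have muAfin : mu A \is a fin_num by exact: fin_num_measure.
have -> : b%:E * mu A = (b * fine (mu A))%:E by rewrite EFinM fineK.
apply: le_Tc => g gmn; have [g1 g2] := gmn.
rewrite EFinM fineK//.
pose Z := (borel (T1 * T2)%type * borel T1)%type.
pose rho : {measure set Z -> \bar R} := (g \x u)%E.
have rhoE P Q : measurable P -> measurable Q -> rho (P `*` Q) = g P * u Q.
  by move=> mP mQ; exact: product_measure1E.
have mfst' : measurable_fun [set: borel (T1 * T2)%type] (fst : _ -> borel T1).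
  by apply: (@continuous_borel _ _ fst) => z; exact: cvg_fst.
have msnd' : measurable_fun [set: borel (T1 * T2)%type] (snd : _ -> borel T2).
  by apply: (@continuous_borel _ _ snd) => z; exact: cvg_snd.
have mfst : measurable_fun [set: Z] (fun z : Z => z.1.1 : borel T1).
  exact: (measurableT_comp mfst' measurable_fst).
have msnd : measurable_fun [set: Z] (fun z : Z => z.1.2 : borel T2).
  exact: (measurableT_comp msnd' measurable_fst).
have pre1 (V : set (borel T1)) : measurable V ->
    measurable (fst @^-1` V : set (borel (T1 * T2)%type)).
  by move=> mV; rewrite -[X in measurable X]setTI; exact: mfst'.
have pre2 (V : set (borel T2)) : measurable V ->
    measurable (snd @^-1` V : set (borel (T1 * T2)%type)).
  by move=> mV; rewrite -[X in measurable X]setTI; exact: msnd'.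
pose f (z : Z) : borel T1 := if z.1.1 \in A then z.2 else z.1.1.
have mf : measurable_fun setT f.
  apply: measurable_fun_ifT => //.
  apply: (measurable_fun_bool true).
  rewrite (_ : _ @^-1` _ = (fun z : Z => z.1.1) @^-1` A).
    by apply: mfst.
  by apply/seteqP; split => z /=; [move/set_mem|move/mem_set].
have rhomu' (V : set (borel T1)) : measurable V -> rho (f @^-1` V) = mu' V.
  move=> mV.
  have -> : f @^-1` V = ((fst @^-1` (V `\` A)) `*` setT) `|`
                        ((fst @^-1` A) `*` V) :> set Z.
    apply/seteqP; split => -[[x y] x'] /=; rewrite /f/=.
      by case: ifPn => [/set_mem Ax|/negP Ax] Vx; [right|left] => //; split => //; split => // /mem_set.
    move=> [[[Vx Ax] _]|[Ax Vx]]; first by case: ifPn => // /set_mem.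
    by rewrite mem_set.
  have mVA : measurable (V `\` A) by exact: measurableD.
  have dj : ((fst @^-1` (V `\` A)) `*` setT) `&` ((fst @^-1` A) `*` V) = set0 :> set Z.
    by apply/seteqP; split => -[[x y] x'] // [[[_ ?] _] []].
  have -> : rho ((fst @^-1` (V `\` A)) `*` setT `|` (fst @^-1` A) `*` V) =
      rho ((fst @^-1` (V `\` A)) `*` setT) + rho ((fst @^-1` A) `*` V).
    by apply: measureU => //; apply: measurableX => //; exact: pre1.
  rewrite !rhoE//; [|exact: pre1..].
  by rewrite !g1// probability_setT mule1 mu'E.
have rhonu (V : set (borel T2)) : measurable V -> rho ((fun z : Z => z.1.2) @^-1` V) = nu V.
  move=> mV.
  have -> : (fun z : Z => z.1.2) @^-1` V = (snd @^-1` V) `*` setT :> set Z.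
    by apply/seteqP; split => z //= [].
  rewrite rhoE ?g2 ?probability_setT ?mule1//.
  exact: pre2.
have h1 := Tc_le_law dD1 dD2 cA1 cA2 c_ge0 mc mf msnd rhomu' rhonu.
have g1A : rho ((fun z : Z => z.1.1) @^-1` A) = mu A.
  have -> : (fun z : Z => z.1.1) @^-1` A = (fst @^-1` A) `*` setT :> set Z.
    by apply/seteqP; split => z //= [].
  by rewrite rhoE ?g1 ?probability_setT ?mule1//; exact: pre1.
have mA' : measurable ((fun z : Z => z.1.1) @^-1` A).
  by rewrite -[X in measurable X]setTI; exact: mfst.
have intA (k : R) : (0 <= k)%R ->
    \int[rho]_z (k * \1_((fun z : Z => z.1.1) @^-1` A) z)%:E = k%:E * mu A.
  move=> k0; under eq_integral do rewrite EFinM.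
  rewrite ge0_integralZl//; last by apply/measurable_EFinP; exact: measurable_indic.
  by rewrite integral_indic// setIT g1A.
have mct : measurable_fun [set: Z] (fun z : Z => cost_ext A1 A2 c (f z, z.1.2)).
  by apply: (measurableT_comp mc); exact: (measurable_pair_borel dD1 dD2).
have mct' : measurable_fun [set: Z] (fun z : Z => cost_ext A1 A2 c z.1).
  exact: (measurableT_comp mc measurable_fst).
have mk (k : R) : measurable_fun [set: Z]
   (fun z => (k * \1_((fun z : Z => z.1.1) @^-1` A) z)%:E).
  by apply/measurable_EFinP; apply: measurable_funM => //; exact: measurable_indic.
have k_ge0 (k : R) (z : Z) : (0 <= k)%R ->
    0 <= (k * \1_((fun z : Z => z.1.1) @^-1` A) z)%:E.
  by move=> k0; rewrite lee_fin mulr_ge0.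
have costE : transport_cost c g = \int[rho]_z cost_ext A1 A2 c z.1.
  rewrite transport_costE (@ge0_integral_law _ _ Z (borel (T1 * T2)%type) R rho g fst)//.
    move=> U mU; have -> : fst @^-1` U = U `*` setT :> set Z.
      by apply/seteqP; split => z //= [].
    by rewrite rhoE ?probability_setT ?mule1.
  exact: cost_ext_ge0.
rewrite costE; apply: (le_trans (leeD h1 (lexx _))).
have splitint (F : Z -> \bar R) (k : R) : measurable_fun setT F ->
    (forall z, 0 <= F z) -> (0 <= k)%R -> \int[rho]_z F z + k%:E * mu A =
    \int[rho]_z (F z + (k * \1_((fun z : Z => z.1.1) @^-1` A) z)%:E).
  by move=> mF F0 k0; rewrite -intA// ge0_integralD// => z _; exact: k_ge0.
rewrite !splitint//; [|by move=> z; exact: cost_ext_ge0..].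
apply: ae_ge0_le_integral => //.
- by move=> z _; rewrite adde_ge0// ?k_ge0//; exact: cost_ext_ge0.
- exact: emeasurable_funD.
- by move=> z _; rewrite adde_ge0// ?k_ge0//; exact: cost_ext_ge0.
- exact: emeasurable_funD.
have mA2 : measurable (A2 : set (borel T2)) by exact: closed_borel.
pose N : set Z := (fst @^-1` (~` S)) `*` setT `|` (snd @^-1` (~` A2)) `*` setT `|`
  setT `*` (~` S').
exists N; split.
- apply: measurableU; first apply: measurableU; apply: measurableX => //.
  + by apply: pre1; exact: measurableC.
  + by apply: pre2; exact: measurableC.
  + exact: measurableC.
- have m1 : measurable ((fst @^-1` (~` S)) `*` setT : set Z).
    by apply: measurableX => //; apply: pre1; exact: measurableC.
  have m2 : measurable ((snd @^-1` (~` A2)) `*` setT : set Z).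
    by apply: measurableX => //; apply: pre2; exact: measurableC.
  have m3 : measurable (setT `*` (~` S') : set Z).
    by apply: measurableX => //; exact: measurableC.
  have z1 : rho ((fst @^-1` (~` S)) `*` setT) = 0.
    rewrite rhoE//; last by apply: pre1; exact: measurableC.
    rewrite g1; last exact: measurableC.
    by rewrite probability_setC// muS subee// mul0e.
  have z2 : rho ((snd @^-1` (~` A2)) `*` setT) = 0.
    rewrite rhoE//; last by apply: pre2; exact: measurableC.
    rewrite g2; last exact: measurableC.
    by rewrite probability_setC// prob_on1 subee// mul0e.
  have z3 : rho (setT `*` (~` S')) = 0.
    rewrite rhoE//; last exact: measurableC.
    by rewrite probability_setC// uS' subee// mule0.
  rewrite -z1 -(measureU0 m1 m2 z2) -(measureU0 _ m3 z3)//.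
  exact: measurableU.
move=> [[x y] x'] H; apply: contrapT => notN; apply: H => _.
have Sx : S x by apply: contrapT => h; apply: notN; left; left; split.
have Yy : A2 y by apply: contrapT => h; apply: notN; left; right; split.
have S'x' : S' x' by apply: contrapT => h; apply: notN; right; split.
rewrite /f/= indicE/=; have -> : ((x, y, x') \in (fun z : Z => z.1.1) @^-1` A) = (x \in A) by [].
case: ifPn => [/set_mem Ax|Ax]; last by rewrite !mulr0 !adde0.
rewrite !mulr1 !cost_extE//; [|(by apply: SA1) || (by apply: S'A1)..].
by rewrite -!EFinD lee_fin; exact: cab.
Qed.

End resample.

(** * Continuity in the second marginal *)
Section density_measure.
Context d (T : measurableType d) (R : realType) (m : {measure set T -> \bar R}).
Variables (k : T -> \bar R) (mk : measurable_fun [set: T] k).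
Hypothesis k0 : forall x, (0 <= k x)%E.

Definition density_fun (A : set T) : \bar R := (\int[m]_(x in A) k x)%E.

Let density0 : density_fun set0 = 0%E. Proof. exact: integral_set0. Qed.
Let density_ge0 A : (0 <= density_fun A)%E.
Proof. by apply: integral_ge0 => x _; exact: k0. Qed.
Let density_sigma : semi_sigma_additive density_fun.
Proof. exact: semi_sigma_additive_nng_induced. Qed.

HB.instance Definition _ := isMeasure.Build _ _ _ density_fun
  density0 density_ge0 density_sigma.

Definition density_measure : {measure set T -> \bar R} := density_fun.

Lemma density_measureE A : measurable A ->
  density_measure A = (\int[m]_x (k x * (\1_A x)%:E))%E.
Proof.
move=> mA; rewrite -[LHS]/(\int[m]_(x in A) k x)%E integral_mkcond.
apply: eq_integral => x _; rewrite patchE indicE.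
by case: ifPn => _; rewrite ?mule1 ?mule0.
Qed.

End density_measure.

Section kernel_coupling.
Context {R : realType} {T1 T2 : normedModType R}.
Variables (D1 : nat -> T1) (D2 : nat -> T2).
Hypotheses (dD1 : dense_seq D1) (dD2 : dense_seq D2).
Context (A1 : set T1) (A2 : set T2) (c : T1 -> T2 -> R).
Hypotheses (cA1 : closed A1) (cA2 : closed A2).
Hypothesis c_ge0 : forall x y, A1 x -> A2 y -> 0 <= c x y.
Hypothesis mc : measurable_fun [set: borel (T1 * T2)%type] (cost_ext A1 A2 c).
Local Open Scope ereal_scope.

Variables (mu : prob_on R A1) (nu nu' : prob_on R A2).
Variables (S : set (borel T1)) (mS : measurable S).
Hypotheses (muS : mu S = 1) (SA1 : S `<=` A1).
Variables (k : (borel T2 * borel T2)%type -> R).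
Hypotheses (mk : measurable_fun [set: (borel T2 * borel T2)%type] k)
  (k0 : forall z, (0 <= k z)%R).
Hypothesis k1 : forall y, \int[nu']_y' (k (y, y'))%:E = 1.
Hypothesis k2 : forall y', \int[nu]_y (k (y, y'))%:E = 1.
Variables (N : set (borel T2 * borel T2)%type) (mN : measurable N).
Variables (w C r : R).
Hypotheses (w0 : (0 <= w)%R) (C0 : (0 <= C)%R).
Hypothesis cN : forall x y y', S x -> A2 y -> A2 y' -> N (y, y') ->
  (c x y' <= c x y + w)%R.
Hypothesis cC : forall x y, S x -> A2 y -> (c x y <= C)%R.
Hypothesis kN :
  \int[nu]_y \int[nu']_y' (k (y, y') * \1_(~` N) (y, y'))%:E <= r%:E.

(** A kernel k with both marginal integrals equal to 1 is the density of a
    coupling of nu and nu' with respect to their product.  Gluing it to a plan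
    from mu to nu, along the common coordinate y, amounts to taking the density
    k (y, y') with respect to the plan times nu'. *)
Lemma Tc_kernel : Tc c mu nu' <= Tc c mu nu + (w + C * r)%:E.
Proof.
apply: le_Tc => g gmn; have [g1 g2] := gmn.
pose XY := borel (T1 * T2)%type.
pose Z := (XY * borel T2)%type.
have mfst' : measurable_fun [set: XY] (fst : _ -> borel T1).
  by apply: (@continuous_borel _ _ fst) => z; exact: cvg_fst.
have msnd' : measurable_fun [set: XY] (snd : _ -> borel T2).
  by apply: (@continuous_borel _ _ snd) => z; exact: cvg_snd.
have mfst : measurable_fun [set: Z] (fun z : Z => z.1.1 : borel T1).
  exact: (measurableT_comp mfst' measurable_fst).
have msnd : measurable_fun [set: Z] (fun z : Z => z.1.2 : borel T2).
  exact: (measurableT_comp msnd' measurable_fst).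
have m2 : measurable_fun [set: Z] (fun z : Z => (z.1.2, z.2) : (borel T2 * borel T2)%type).
  by apply: measurable_fun_pair.
pose kk (z : Z) := (k (z.1.2, z.2))%:E.
have mkk : measurable_fun [set: Z] kk.
  by apply/measurable_EFinP; exact: (measurableT_comp mk m2).
have kk0 z : 0 <= kk z by rewrite lee_fin.
(* The glued measure on triples ((x, y), y'). *)
pose th := density_measure (g \x nu')%E mkk kk0.
have mk_y y' : measurable_fun [set: borel T2] (fun y => (k (y, y'))%:E).
  by apply/measurable_EFinP; apply: (measurableT_comp mk); exact: measurable_fun_pair.
have mth (h : Z -> R) : measurable_fun setT h -> measurable_fun [set: Z] (fun z => (kk z * (h z)%:E)).
  by move=> mh; apply: emeasurable_funM => //; apply/measurable_EFinP.
have thfst (E : set XY) : measurable E -> th (fst @^-1` E) = g E.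
  move=> mE; rewrite density_measureE; last first.
    by rewrite -[X in measurable X]setTI; exact: measurable_fst.
  rewrite fubini_tonelli1; last 2 first.
    - by apply: mth; apply: measurable_indic; rewrite -[X in measurable X]setTI; exact: measurable_fst.
    - by move=> z; rewrite mule_ge0.
  transitivity (\int[g]_z (\1_E z)%:E); last by rewrite integral_indic// setIT.
  apply: eq_integral => -[x y] _.
  rewrite /fubini_F/=.
  transitivity (\int[nu']_y' ((\1_E (x, y))%:E * (k (y, y'))%:E)).
    by apply: eq_integral => y' _; rewrite muleC.
  rewrite ge0_integralZl//.
  - by rewrite k1 mule1.
  - apply/measurable_EFinP; apply: (measurableT_comp mk).
    exact: measurable_fun_pair.
  - by move=> y' _; rewrite lee_fin.
have thsnd (V : set (borel T2)) : measurable V -> th (snd @^-1` V) = nu' V.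
  move=> mV; rewrite density_measureE; last first.
    by rewrite -[X in measurable X]setTI; exact: measurable_snd.
  have mf : measurable_fun [set: Z] (fun z => (kk z * (\1_(snd @^-1` V) z)%:E)).
    by apply: mth; apply: measurable_indic; rewrite -[X in measurable X]setTI; exact: measurable_snd.
  have f0 z : 0 <= kk z * (\1_(snd @^-1` V) z)%:E by rewrite mule_ge0.
  rewrite fubini_tonelli1// fubini_tonelli//.
  transitivity (\int[nu']_z (\1_V z)%:E); last by rewrite integral_indic// setIT.
  apply: eq_integral => y' _.
  rewrite /fubini_G/=.
  transitivity (\int[g]_z ((\1_V y')%:E * (k (z.2, y'))%:E)).
    by apply: eq_integral => z _; rewrite muleC.
  rewrite ge0_integralZl//.
  - rewrite -(@ge0_integral_law _ _ XY (borel T2) R g nu snd msnd' g2 (fun y => (k (y, y'))%:E)).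
    + by rewrite k2 mule1.
    + exact: mk_y.
    + by move=> y; rewrite lee_fin.
  - exact: (measurableT_comp (mk_y y') msnd').
  - by move=> z _; rewrite lee_fin.
have thmu (U : set (borel T1)) : measurable U -> th ((fun z : Z => z.1.1) @^-1` U) = mu U.
  move=> mU; rewrite -g1// -thfst//.
  by rewrite -[X in measurable X]setTI; exact: mfst'.
apply: (le_trans (Tc_le_law dD1 dD2 cA1 cA2 c_ge0 mc mfst measurable_snd thmu thsnd)).
pose N' : set Z := (fun z : Z => (z.1.2, z.2)) @^-1` (~` N).
have mN' : measurable N'.
  by rewrite -[X in measurable X]setTI; apply: m2 => //; exact: measurableC.
have thN' : th N' <= r%:E.
  rewrite density_measureE//; apply: le_trans kN.
  rewrite fubini_tonelli1; last 2 first.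
    - by apply: mth; exact: measurable_indic.
    - by move=> z; rewrite mule_ge0.
  have mH : measurable_fun [set: (borel T2 * borel T2)%type]
      (fun z => (k z * \1_(~` N) z)%:E).
    apply/measurable_EFinP; apply: measurable_funM => //.
    by apply: measurable_indic; exact: measurableC.
  have H0 z : 0 <= (k z * \1_(~` N) z)%:E by rewrite lee_fin mulr_ge0.
  rewrite (@ge0_integral_law _ _ XY (borel T2) R g nu snd msnd' g2
    (fun y => \int[nu']_y' (k (y, y') * \1_(~` N) (y, y'))%:E)).
  - rewrite le_eqVlt; apply/orP; left; apply/eqP.
    apply: eq_integral => -[x y] _; apply: eq_integral => y' _.
    by rewrite /kk/= EFinM.
  - exact: (measurable_fun_fubini_tonelli_F _ mH H0).
  - by move=> y; apply: integral_ge0.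
have costE : transport_cost c g = \int[th]_z cost_ext A1 A2 c z.1.
  rewrite transport_costE (@ge0_integral_law _ _ Z XY R th g fst)//.
  exact: cost_ext_ge0.
have thT : th setT = 1.
  by rewrite -(preimage_setT (@snd XY (borel T2))) thsnd// probability_setT.
apply: (@le_trans _ _ (\int[th]_z (cost_ext A1 A2 c z.1 + (w + C * \1_N' z)%:E))).
  apply: ae_ge0_le_integral => //.
  - by move=> z _; exact: cost_ext_ge0.
  - by apply: (measurableT_comp mc); exact: (measurable_pair_borel dD1 dD2).
  - move=> z _; apply: adde_ge0; first exact: cost_ext_ge0.
    by rewrite lee_fin addr_ge0// mulr_ge0.
  - apply: emeasurable_funD; first exact: (measurableT_comp mc measurable_fst).
    apply/measurable_EFinP; apply: measurable_funD => //.
    by apply: measurable_funM => //; exact: measurable_indic.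
  have mA2 : measurable (A2 : set (borel T2)) by exact: closed_borel.
  have p1 : measurable (fst @^-1` (~` S) : set XY).
    by rewrite -[X in measurable X]setTI; apply: mfst' => //; exact: measurableC.
  have p2 : measurable (snd @^-1` (~` A2) : set XY).
    by rewrite -[X in measurable X]setTI; apply: msnd' => //; exact: measurableC.
  pose E1 : set Z := fst @^-1` (fst @^-1` (~` S)).
  pose E2 : set Z := fst @^-1` (snd @^-1` (~` A2)).
  pose E3 : set Z := snd @^-1` (~` A2).
  have mE1 : measurable E1.
    by rewrite -[X in measurable X]setTI; exact: measurable_fst.
  have mE2 : measurable E2.
    by rewrite -[X in measurable X]setTI; exact: measurable_fst.
  have mE3 : measurable E3.
    by rewrite -[X in measurable X]setTI; apply: measurable_snd => //; exact: measurableC.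
  have z1 : th E1 = 0.
    rewrite thfst// g1; last exact: measurableC.
    by rewrite probability_setC// muS subee.
  have z2 : th E2 = 0.
    rewrite thfst// g2; last exact: measurableC.
    by rewrite probability_setC// prob_on1 subee.
  have z3 : th E3 = 0.
    rewrite thsnd; last exact: measurableC.
    by rewrite probability_setC// prob_on1 subee.
  exists (E1 `|` E2 `|` E3); split.
  - by apply: measurableU => //; exact: measurableU.
  - rewrite -z1 -(measureU0 mE1 mE2 z2) -(measureU0 _ mE3 z3)//.
    exact: measurableU.
  move=> [[x y] y'] H; apply: contrapT => notE; apply: H => _.
  have Sx : S x by apply: contrapT => h; apply: notE; left; left.
  have Yy : A2 y by apply: contrapT => h; apply: notE; left; right.
  have Yy' : A2 y' by apply: contrapT => h; apply: notE; right.
  rewrite !cost_extE//; try exact: SA1.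
  rewrite -EFinD lee_fin indicE; case: (boolP (_ \in N')) => [_|/negP h] /=.
    rewrite mulr1; apply: (le_trans (cC Sx Yy')).
    by rewrite addrA lerDr addr_ge0// c_ge0//; exact: SA1.
  rewrite mulr0 addr0; apply: cN => //.
  by apply: contrapT => h'; apply: h; exact: mem_set.
rewrite ge0_integralD//; last 4 first.
- by move=> z _; exact: cost_ext_ge0.
- exact: (measurableT_comp mc measurable_fst).
- by move=> z _; rewrite lee_fin addr_ge0// mulr_ge0.
- apply/measurable_EFinP; apply: measurable_funD => //.
  by apply: measurable_funM => //; exact: measurable_indic.
rewrite costE leeD2l//.
under eq_integral do rewrite EFinD EFinM.
rewrite ge0_integralD//; last 2 first.
- by move=> z _; rewrite mule_ge0.
- apply: emeasurable_funM => //; apply/measurable_EFinP; exact: measurable_indic.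
rewrite integral_cst// thT mule1 ge0_integralZl//; last first.
  by apply/measurable_EFinP; exact: measurable_indic.
rewrite integral_indic// setIT [leRHS]EFinD [in leRHS]EFinM.
by apply: leeD2l; apply: lee_wpmul2l.
Qed.

End kernel_coupling.

Section bounded_expectation.
Context d (T : measurableType d) (R : realType) (P : probability T R).
Implicit Types f g : T -> R.

Definition bounded_mfun f :=
  measurable_fun setT f /\ exists M, forall x, `|f x| <= M.

Lemma bounded_mfun_integrable f : bounded_mfun f ->
  P.-integrable setT (EFin \o f).
Proof.
move=> [mf [M hM]]; apply: measurable_bounded_integrable => //.
  by apply: (le_lt_trans (probability_le1 P measurableT)); rewrite ltry.
exists M; split; first exact: num_real.
by move=> x Mx y _; exact: le_trans (hM y) (ltW Mx).
Qed.

Lemma bounded_mfunE f : bounded_mfun f ->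
  (\int[P]_x (f x)%:E = (\int[P]_x f x)%R%:E)%E.
Proof.
by move=> /bounded_mfun_integrable bf; rewrite fineK//; exact: integrable_fin_num.
Qed.

Lemma bounded_mfun_cst k : bounded_mfun (cst k).
Proof. by split => //; exists `|k|. Qed.

Lemma bounded_mfunD f g : bounded_mfun f -> bounded_mfun g ->
  bounded_mfun (fun x => f x + g x).
Proof.
move=> [mf [M hM]] [mg [L hL]]; split; first exact: measurable_funD.
by exists (M + L) => x; apply: (le_trans (ler_normD _ _)); apply: lerD.
Qed.

Lemma bounded_mfunM f g : bounded_mfun f -> bounded_mfun g ->
  bounded_mfun (fun x => f x * g x).
Proof.
move=> [mf [M hM]] [mg [L hL]]; split; first exact: measurable_funM.
by exists (M * L) => x; rewrite normrM; apply: ler_pM.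
Qed.

Lemma bounded_mfunZ k f : bounded_mfun f -> bounded_mfun (fun x => k * f x).
Proof. by apply: bounded_mfunM; exact: bounded_mfun_cst. Qed.

Lemma bounded_mfun_sum n (f : 'I_n -> T -> R) : (forall i, bounded_mfun (f i)) ->
  bounded_mfun (fun x => \sum_(i < n) f i x).
Proof.
elim: n f => [|n IH] f bf.
  under [X in bounded_mfun X]funext do rewrite big_ord0.
  exact: bounded_mfun_cst.
under [X in bounded_mfun X]funext do rewrite big_ord_recl.
by apply: bounded_mfunD => //; apply: IH.
Qed.

Lemma expectD f g : bounded_mfun f -> bounded_mfun g ->
  \int[P]_x (f x + g x) = \int[P]_x f x + \int[P]_x g x.
Proof.
move=> /bounded_mfun_integrable bf /bounded_mfun_integrable bg.
exact: RintegralD.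
Qed.

Lemma expectZ k f : bounded_mfun f ->
  \int[P]_x (k * f x) = k * \int[P]_x f x.
Proof. by move=> /bounded_mfun_integrable bf; exact: RintegralZl. Qed.

Lemma expect_cst k : \int[P]_x (cst k x) = k.
Proof.
rewrite Rintegral_cst//; transitivity (k * fine 1%E); last by rewrite mulr1.
by congr (k * fine _); exact: probability_setT.
Qed.

Lemma expect_sum n (f : 'I_n -> T -> R) : (forall i, bounded_mfun (f i)) ->
  \int[P]_x (\sum_(i < n) f i x) = \sum_(i < n) \int[P]_x f i x.
Proof.
elim: n f => [|n IH] f bf.
  rewrite big_ord0; under eq_Rintegral do rewrite big_ord0.
  exact: (expect_cst 0).
under eq_Rintegral do rewrite big_ord_recl.
rewrite big_ord_recl expectD//; last exact: bounded_mfun_sum.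
by rewrite IH.
Qed.

End bounded_expectation.

Section partition_perturbation.
Context {R : realType} {T1 T2 : normedModType R}.
Variables (D1 : nat -> T1) (D2 : nat -> T2).
Hypotheses (dD1 : dense_seq D1) (dD2 : dense_seq D2).
Context (A1 : set T1) (A2 : set T2) (c : T1 -> T2 -> R).
Hypotheses (cA1 : closed A1) (cA2 : closed A2).
Hypothesis c_ge0 : forall x y, A1 x -> A2 y -> 0 <= c x y.
Hypothesis mc : measurable_fun [set: borel (T1 * T2)%type] (cost_ext A1 A2 c).

Variables (mu : prob_on R A1) (nu nu' : prob_on R A2).
Variables (S : set (borel T1)) (mS : measurable S).
Hypotheses (muS : mu S = 1%E) (SA1 : S `<=` A1).
Variables (n : nat) (psi : 'I_n -> borel T2 -> R).
Hypotheses (mpsi : forall i, measurable_fun setT (psi i))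
  (psi0 : forall i y, 0 <= psi i y)
  (psi_le1 : forall y, \sum_i psi i y <= 1)
  (psi1 : forall y, A2 y -> \sum_i psi i y = 1).
Variables (w C e : R).
Hypotheses (w0 : 0 <= w) (C0 : 0 <= C) (e0 : 0 < e) (e1 : e < 1).
Hypothesis c_psi : forall i x y y', S x -> A2 y -> A2 y' -> 0 < psi i y ->
  0 < psi i y' -> c x y' <= c x y + w.
Hypothesis cC : forall x y, S x -> A2 y -> c x y <= C.

(* The kernel K below couples the part of mass m i inside each piece psi i and
   couples the remainders rho and rho', of mass r, independently.  The factor
   1 - e in m i keeps r positive, so that the division by r is legitimate. *)
Let a i := \int[nu]_y psi i y.
Let b i := \int[nu']_y psi i y.
Hypothesis ab : \sum_i `|a i - b i| <= e.

Let m i := (1 - e) * Num.min (a i) (b i).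
Let k i := m i / (a i * b i).
Let rho y := 1 - \sum_i k i * b i * psi i y.
Let rho' y := 1 - \sum_i k i * a i * psi i y.
Let r := 1 - \sum_i m i.

Let psi_bounded i : bounded_mfun (psi i).
Proof.
split=> //; exists 1 => y; rewrite ger0_norm//.
apply: le_trans (psi_le1 y); rewrite (bigD1 i)//= lerDl.
by apply: sumr_ge0.
Qed.

Let a0 i : 0 <= a i. Proof. exact: Rintegral_ge0. Qed.
Let b0 i : 0 <= b i. Proof. exact: Rintegral_ge0. Qed.
Let min0 i : 0 <= Num.min (a i) (b i).
Proof. by rewrite le_min a0 b0. Qed.
Let m0 i : 0 <= m i.
Proof. by rewrite mulr_ge0// subr_ge0 ltW. Qed.
Let k0 i : 0 <= k i.
Proof. by rewrite divr_ge0// mulr_ge0. Qed.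
Let ma i : m i <= a i.
Proof.
apply: (@le_trans _ _ (Num.min (a i) (b i))); last by rewrite ge_min lexx.
by rewrite ler_piMl// gerBl ltW.
Qed.
Let mb i : m i <= b i.
Proof.
apply: (@le_trans _ _ (Num.min (a i) (b i))); last by rewrite ge_min lexx orbT.
by rewrite ler_piMl// gerBl ltW.
Qed.
Let kab i : k i * a i * b i = m i.
Proof.
rewrite /k; have [ai0|ai0] := eqVneq (a i) 0.
  rewrite ai0 mulr0 mul0r; apply/esym/eqP; rewrite eq_le m0 andbT.
  by rewrite -ai0.
have [bi0|bi0] := eqVneq (b i) 0.
  rewrite bi0 mulr0; apply/esym/eqP; rewrite eq_le m0 andbT.
  by rewrite -bi0.
by rewrite -mulrA divfK// mulf_neq0.
Qed.
Let kb1 i : k i * b i <= 1.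
Proof.
have [ai0|ai0] := eqVneq (a i) 0.
  by rewrite /k ai0 mul0r invr0 mulr0 mul0r.
by rewrite -(ler_pM2r (_ : 0 < a i)) ?lt_def ?ai0 ?a0// mulrAC kab mul1r.
Qed.
Let ka1 i : k i * a i <= 1.
Proof.
have [bi0|bi0] := eqVneq (b i) 0.
  by rewrite /k bi0 mulr0 invr0 mulr0 mul0r.
by rewrite -(ler_pM2r (_ : 0 < b i)) ?lt_def ?bi0 ?b0// kab mul1r.
Qed.
Let rho0 y : 0 <= rho y.
Proof.
rewrite subr_ge0; apply: le_trans (psi_le1 y); apply: ler_sum => i _.
by rewrite ler_piMl.
Qed.
Let rho'0 y : 0 <= rho' y.
Proof.
rewrite subr_ge0; apply: le_trans (psi_le1 y); apply: ler_sum => i _.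
by rewrite ler_piMl.
Qed.

Let total (nu0 : prob_on R A2) : \sum_i \int[nu0]_y psi i y = 1.
Proof.
rewrite -expect_sum// -[RHS](expect_cst nu0 1).
have mA2 : measurable (A2 : set (borel T2)) by exact: closed_borel.
have nu0A2 : nu0 (~` A2) = 0%E by rewrite probability_setC// prob_on1 subee.
rewrite /Rintegral; congr fine; apply: ae_eq_integral => //.
- by apply/measurable_EFinP; apply: (bounded_mfun_sum psi_bounded).1.
- by apply/measurable_EFinP; exact: measurable_cst.
- exists (~` A2); split; first exact: measurableC.
    exact: nu0A2.
  by move=> y /= H Ay; apply: H => _; rewrite psi1.
Qed.

Let sum_min : 1 - e <= \sum_i Num.min (a i) (b i).
Proof.
rewrite lerBlDr -[1](total nu).
apply: (@le_trans _ _ (\sum_i Num.min (a i) (b i) + \sum_i `|a i - b i|)).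
  rewrite -big_split; apply: ler_sum => i _ /=; rewrite -/(a i).
  rewrite /Num.min; case: ltP => h; first by rewrite lerDl.
  by rewrite addrC -lerBlDr ler_norm.
by rewrite lerD2l.
Qed.

Let sum_min1 : \sum_i Num.min (a i) (b i) <= 1.
Proof.
by rewrite -(total nu); apply: ler_sum => i _; rewrite ge_min lexx.
Qed.

Let r_ge : e <= r.
Proof.
rewrite /r /m -mulr_sumr lerBrDr -lerBrDl.
by rewrite ler_piMr// subr_ge0 ltW.
Qed.

Let r_gt0 : 0 < r. Proof. exact: lt_le_trans r_ge. Qed.

Let r_le : r <= 2 * e.
Proof.
rewrite /r /m -mulr_sumr.
have : (1 - e) * (1 - e) <= (1 - e) * \sum_i Num.min (a i) (b i).
  by rewrite ler_wpM2l// subr_ge0 ltW.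
have : 0 <= e * e by rewrite mulr_ge0// ltW.
by move: (\sum_i _) => s; nra.
Qed.

Let K (z : borel T2 * borel T2) :=
  \sum_i k i * psi i z.1 * psi i z.2 + rho z.1 * rho' z.2 / r.

Let K0 z : 0 <= K z.
Proof.
apply: addr_ge0; last by rewrite divr_ge0 ?(ltW r_gt0)// mulr_ge0.
by apply: sumr_ge0 => i _; apply: mulr_ge0; [apply: mulr_ge0|]; [exact: k0|exact: psi0..].
Qed.

Let brho : bounded_mfun rho.
Proof.
apply: bounded_mfunD; first exact: (bounded_mfun_cst _ 1).
rewrite (_ : (fun y => _) = (fun y => -1 * \sum_i k i * b i * psi i y)).
  by apply: bounded_mfunZ; apply: bounded_mfun_sum => i; exact: bounded_mfunZ.
by apply/funext => y; rewrite mulN1r.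
Qed.

Let brho' : bounded_mfun rho'.
Proof.
apply: bounded_mfunD; first exact: (bounded_mfun_cst _ 1).
rewrite (_ : (fun y => _) = (fun y => -1 * \sum_i k i * a i * psi i y)).
  by apply: bounded_mfunZ; apply: bounded_mfun_sum => i; exact: bounded_mfunZ.
by apply/funext => y; rewrite mulN1r.
Qed.

Let int_rho : \int[nu]_y rho y = r.
Proof.
rewrite /rho; under eq_Rintegral do rewrite -mulN1r.
rewrite (@expectD _ _ _ _ (cst 1))//; last 2 first.
- exact: bounded_mfun_cst.
- by apply: bounded_mfunZ; apply: bounded_mfun_sum => i; exact: bounded_mfunZ.
rewrite expect_cst expectZ; last first.
  by apply: bounded_mfun_sum => i; exact: bounded_mfunZ.
rewrite expect_sum; last by move=> i; exact: bounded_mfunZ.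
rewrite mulN1r /r; congr (1 - _); apply: eq_bigr => i _.
by rewrite expectZ// mulrAC -/(a i) kab.
Qed.

Let int_rho' : \int[nu']_y rho' y = r.
Proof.
rewrite /rho'; under eq_Rintegral do rewrite -mulN1r.
rewrite (@expectD _ _ _ _ (cst 1))//; last 2 first.
- exact: bounded_mfun_cst.
- by apply: bounded_mfunZ; apply: bounded_mfun_sum => i; exact: bounded_mfunZ.
rewrite expect_cst expectZ; last first.
  by apply: bounded_mfun_sum => i; exact: bounded_mfunZ.
rewrite expect_sum; last by move=> i; exact: bounded_mfunZ.
rewrite mulN1r /r; congr (1 - _); apply: eq_bigr => i _.
by rewrite expectZ// -/(b i) kab.
Qed.

Let mK : measurable_fun setT K.
Proof.
have m1 (f : borel T2 -> R) : measurable_fun setT f ->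
    measurable_fun setT (fun z : borel T2 * borel T2 => f z.1).
  by move=> mf; exact: (measurableT_comp mf measurable_fst).
have m2 (f : borel T2 -> R) : measurable_fun setT f ->
    measurable_fun setT (fun z : borel T2 * borel T2 => f z.2).
  by move=> mf; exact: (measurableT_comp mf measurable_snd).
apply: measurable_funD.
  apply: measurable_sum => i; apply: measurable_funM; last exact: m2.
  by apply: measurable_funM => //; exact: m1.
apply: measurable_funM => //; apply: measurable_funM.
  by apply: m1; exact: brho.1.
by apply: m2; exact: brho'.1.
Qed.

Let K1 y : (\int[nu']_y' (K (y, y'))%:E = 1)%E.
Proof.
have b1 : bounded_mfun (fun y' => \sum_i k i * psi i y * psi i y').
  by apply: bounded_mfun_sum => i; exact: bounded_mfunZ.
have b2 : bounded_mfun (fun y' => (rho y / r) * rho' y').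
  exact: bounded_mfunZ.
transitivity (\int[nu']_y' (\sum_i k i * psi i y * psi i y' + (rho y / r) * rho' y')%:E)%E.
  by apply: eq_integral => y' _; rewrite /K/= [rho y * _ / r]mulrAC.
rewrite bounded_mfunE; last exact: bounded_mfunD.
rewrite expectD// expectZ// int_rho' divfK ?gt_eqF//.
rewrite expect_sum; last by move=> i; exact: bounded_mfunZ.
congr EFin; rewrite /rho addrC.
have -> : \sum_i \int[nu']_x (k i * psi i y * psi i x) =
    \sum_i k i * b i * psi i y.
  by apply: eq_bigr => i _; rewrite expectZ// -/(b i) mulrAC.
by rewrite subrK.
Qed.

Let K2 y' : (\int[nu]_y (K (y, y'))%:E = 1)%E.
Proof.
have b1 : bounded_mfun (fun y => \sum_i k i * psi i y' * psi i y).
  by apply: bounded_mfun_sum => i; exact: bounded_mfunZ.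
have b2 : bounded_mfun (fun y => (rho' y' / r) * rho y).
  exact: bounded_mfunZ.
transitivity (\int[nu]_y (\sum_i k i * psi i y' * psi i y + (rho' y' / r) * rho y)%:E)%E.
  apply: eq_integral => y _; rewrite /K/=; congr (_ + _)%:E.
    by apply: eq_bigr => i _; rewrite mulrAC.
  by rewrite [rho y * _]mulrC mulrAC.
rewrite bounded_mfunE; last exact: bounded_mfunD.
rewrite expectD// expectZ// int_rho divfK ?gt_eqF//.
rewrite expect_sum; last by move=> i; exact: bounded_mfunZ.
congr EFin; rewrite /rho' addrC.
have -> : \sum_i \int[nu]_x (k i * psi i y' * psi i x) =
    \sum_i k i * a i * psi i y'.
  by apply: eq_bigr => i _; rewrite expectZ// -/(a i) mulrAC.
by rewrite subrK.
Qed.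

(* Two points of a common piece are close; outside N only the remainder term
   of K survives, and its mass is r. *)
Let N : set (borel T2 * borel T2) :=
  \bigcup_(i in [set: 'I_n]) ([set y | 0 < psi i y] `*` [set y | 0 < psi i y]).

Let mN : measurable N.
Proof.
apply: fin_bigcup_measurable => // i _.
have mi : measurable ([set y | 0 < psi i y] : set (borel T2)).
  have := mpsi i measurableT (measurable_itv `]0, +oo[%R).
  rewrite setTI; congr measurable; apply/seteqP.
  by split => y /=; rewrite in_itv/= andbT.
exact: measurableX.
Qed.

Let KN : (\int[nu]_y \int[nu']_y' (K (y, y') * \1_(~` N) (y, y'))%:E <= r%:E)%E.
Proof.
apply: (@le_trans _ _ (\int[nu]_y (rho y)%:E)%E); last first.
  by rewrite bounded_mfunE// int_rho.
have mI : measurable_fun [set: (borel T2 * borel T2)%type] (\1_(~` N) : _ -> R).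
  by apply: measurable_indic; exact: measurableC.
have mKN : measurable_fun setT (fun z => (K z * \1_(~` N) z)%:E).
  apply/measurable_EFinP; exact: measurable_funM.
have KN0 z : (0 <= (K z * \1_(~` N) z)%:E)%E by rewrite lee_fin mulr_ge0.
apply: ge0_le_integral => //.
- by move=> y _; apply: integral_ge0.
- exact: (measurable_fun_fubini_tonelli_F _ mKN KN0).
- by apply/measurable_EFinP; exact: brho.1.
move=> y _; apply: (@le_trans _ _ (\int[nu']_y' (rho y / r * rho' y')%:E)%E).
  apply: ge0_le_integral => //.
  - apply/measurable_EFinP; apply: measurable_funM.
      by apply: (measurableT_comp mK); exact: measurable_fun_pair.
    apply: (measurableT_comp mI).
    exact: measurable_fun_pair.
  - by apply/measurable_EFinP; apply: measurable_funM => //; exact: brho'.1.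
  move=> y' _; rewrite lee_fin indicE.
  have := rho0 y; have := rho'0 y'; have := r_gt0 => r0 h1 h2.
  case: (boolP (_ \in ~` N)) => [/set_mem hN|_]; rewrite ?mulr1 ?mulr0.
    rewrite /K/= big1 ?add0r 1?mulrAC// => i _.
    have [h|h] := eqVneq (psi i y) 0; first by rewrite h mulr0 mul0r.
    have [h'|h'] := eqVneq (psi i y') 0; first by rewrite h' mulr0.
    by exfalso; apply: hN; exists i => //; split => /=; rewrite lt_def ?h ?h' psi0.
  by rewrite mulr_ge0// divr_ge0// ltW.
rewrite bounded_mfunE; last exact: bounded_mfunZ.
by rewrite expectZ// int_rho' divfK// gt_eqF.
Qed.

(** Closeness of nu and nu' is only used through finitely many integrals of
    continuous functions, which is what a weak neighbourhood controls. *)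
Lemma Tc_partition : (Tc c mu nu' <= Tc c mu nu + (w + C * (2 * e))%:E)%E.
Proof.
have cN x y y' : S x -> A2 y -> A2 y' -> N (y, y') -> c x y' <= c x y + w.
  by move=> Sx Yy Yy' [i _ [/= h1 h2]]; exact: (c_psi Sx Yy Yy' h1 h2).
apply: (le_trans (Tc_kernel dD1 dD2 cA1 cA2 c_ge0 mc mS muS SA1 mK K0 K1 K2 mN w0 C0 cN cC KN)).
by apply: leeD2l; rewrite lee_fin lerD2l ler_wpM2l.
Qed.

End partition_perturbation.

Lemma continuous_maxr (R : realType) (T : topologicalType) (f g : T -> R) :
  continuous f -> continuous g -> continuous (fun x => Num.max (f x) (g x)).
Proof.
move=> cf cg x.
exact: (@continuous_max R T (f : T -> R^o) (g : T -> R^o) x (cf x) (cg x)).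
Qed.

Section partition_of_unity.
Context {R : realType} {T : normedModType R}.
Variables (D : nat -> T) (dD : dense_seq D) (Y : set T) (cY : compact Y).

Lemma compact_finite_net (r : R) : 0 < r ->
  exists n : nat, forall y, Y y -> exists2 i, (i < n)%N & ball (D i) r y.
Proof.
move=> r0; move/compact_near_coveringP : cY => H.
have : \forall n \near \oo,
    Y `<=` (fun y => exists2 i, (i < n)%N & ball (D i) r y).
  apply: (H nat \oo (fun n y => exists2 i, (i < n)%N & ball (D i) r y)).
  move=> y Yy.
  have r2 : 0 < r / 2 by rewrite divr_gt0.
  have [i hi] := dD y r2.
  near=> y' n; have hin : (i < n)%N by near: n; exact: nbhs_infty_gt.
  have hy' : ball y (r / 2) y' by near: y'; exact: nbhsx_ballx.
  have Dy' : ball (D i) r y'.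
    by rewrite [r]splitr; apply: ball_triangle hy'; exact: ball_sym.
  by exists i.
by move=> [n _ hn]; exists n => y Yy; exact: (hn n (leqnn n) y Yy).
Unshelve. all: by end_near. Qed.

(** Tents around a finite net, divided by their sum.  The sum is replaced by
    its maximum with r / 2, which changes nothing on Y and makes the quotients
    continuous everywhere. *)
Lemma exists_partition_of_unity (del : R) : 0 < del ->
  exists (n : nat) (psi : 'I_n -> T -> R),
    [/\ forall i, continuous (psi i),
        forall i y, 0 <= psi i y,
        forall y, \sum_i psi i y <= 1,
        forall y, Y y -> \sum_i psi i y = 1 &
        forall i y y', 0 < psi i y -> 0 < psi i y' -> ball y del y'].
Proof.
move=> del0; pose r := del / 2.
have r0 : 0 < r by rewrite divr_gt0.
have r20 : 0 < r / 2 by rewrite divr_gt0.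
have [n hn] := compact_finite_net r20.
pose g (i : 'I_n) y := Num.max 0 (r - `|D i - y|).
have g0 i y : 0 <= g i y by rewrite le_max lexx.
have cg i : continuous (g i).
  apply: continuous_maxr; first by move=> y; exact: cvg_cst.
  move=> y; apply: cvgB; first exact: cvg_cst.
  apply: cvg_norm; apply: cvgB; first exact: cvg_cst.
  exact: cvg_id.
pose G y := \sum_i g i y.
have cG : continuous G.
  by apply: continuous_big => // ; exact: add_continuous.
pose H y := Num.max (G y) (r / 2).
have H0 y : 0 < H y by rewrite lt_max r20 orbT.
have cH : continuous H.
  by apply: continuous_maxr => // y; exact: cvg_cst.
exists n, (fun i y => g i y / H y); split.
- move=> i y; apply: cvgM; first exact: cg.
  by apply: cvgV; [rewrite gt_eqF|exact: cH].
- by move=> i y; rewrite divr_ge0// ltW.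
- by move=> y; rewrite -mulr_suml ler_pdivrMr// mul1r le_max lexx.
- move=> y Yy; rewrite -mulr_suml -/(G y) /H.
  have [i0 i0n hi0] := hn y Yy.
  suff Gr : r / 2 <= G y by rewrite (max_idPl Gr) divff// gt_eqF// (lt_le_trans r20).
  rewrite /G (bigD1 (Ordinal i0n))//=.
  apply: (@le_trans _ _ (g (Ordinal i0n) y)); last by rewrite lerDl sumr_ge0.
  rewrite /g le_max; apply/orP; right.
  by move: hi0; rewrite -ball_normE/=; lra.
- move=> i y y'.
  have gb z : 0 < g i z / H z -> ball (D i) r z.
    rewrite pmulr_lgt0 ?invr_gt0// /g lt_max ltxx/= subr_gt0.
    by rewrite -ball_normE.
  move=> /gb h1 /gb h2.
  by rewrite [del]splitr; apply: (ball_triangle (ball_sym h1)).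
Qed.

End partition_of_unity.

Lemma Rintegral_full d (T : measurableType d) (R : realType)
    (P : probability T R) (D : set T) (f : T -> R) :
  measurable D -> P D = 1%E -> measurable_fun setT f ->
  \int[P]_(x in D) f x = \int[P]_x f x.
Proof.
move=> mD PD mf; rewrite Rintegral_mkcond /Rintegral; congr fine.
have PDC : P (~` D) = 0%E by rewrite probability_setC// PD subee.
apply: ae_eq_integral => //.
- by apply/measurable_EFinP; apply/(measurable_restrictT _ mD); exact: measurable_funTS.
- exact/measurable_EFinP.
- exists (~` D); split; [exact: measurableC|exact: PDC|].
  by move=> x /= H Dx; apply: H => _; rewrite patchE mem_set.
Qed.

Section weak_nbhs.
Context {R : realType} {T : normedModType R} (A : set T) (cA : closed A).

Lemma Rintegral_prob_on (nu : prob_on R A) (f : borel T -> R) :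
  measurable_fun setT f -> \int[nu]_(x in A) f x = \int[nu]_x f x.
Proof.
by apply: Rintegral_full; [exact: closed_borel|exact: prob_on1].
Qed.

Lemma near_integral (nu : prob_on R A) (f : borel T -> R) (M e : R) :
  continuous (f : T -> R) ->
  (forall x, `|f x| <= M) -> 0 < e ->
  nbhs nu [set nu' : prob_on R A | `|\int[nu]_x f x - \int[nu']_x f x| < e].
Proof.
move=> cf fM e0.
have Cf : {within A, continuous f} /\ exists M, forall x, A x -> `|f x| <= M.
  by split; [exact: continuous_subspaceT|exists M].
pose F : Cb R A := exist _ f Cf.
have H0 : (@Cb_eval T R A) @ nbhs nu --> Cb_eval nu.
  exact: (@initial_continuous _ _ (@Cb_eval T R A)).
have /cvg_sup/(_ F) H := H0.
pose V := [set g : Cb R A -> R | ball (\int[nu]_(x in A) f x) e (g F)].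
have : ((@Cb_eval T R A) @ nbhs nu) V.
  apply: H; exists V; split => //=; last exact: ballxx.
  by exists (ball (\int[nu]_(x in A) f x) e) => //; exact: ball_open.
have mf := continuous_borelR cf.
apply: (@filterS _ (nbhs nu) _ ((@Cb_eval T R A) @^-1` V)) => nu'.
by rewrite /V/= /ball/= /Cb_eval/= !Rintegral_prob_on.
Qed.

End weak_nbhs.

Section Tc_continuous_nu.
Context {R : realType} {T1 T2 : normedModType R}.
Variables (D1 : nat -> T1) (D2 : nat -> T2).
Hypotheses (dD1 : dense_seq D1) (dD2 : dense_seq D2).
Context (A1 : set T1) (A2 : set T2) (c : T1 -> T2 -> R).
Hypotheses (cA1 : closed A1) (kA2 : compact A2) (cA2 : closed A2).
Hypothesis c_ge0 : forall x y, A1 x -> A2 y -> 0 <= c x y.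
Hypothesis mc : measurable_fun [set: borel (T1 * T2)%type] (cost_ext A1 A2 c).
Variables (S : set (borel T1)) (mS : measurable S) (SA1 : S `<=` A1).
Hypothesis cC : exists2 C, 0 <= C & forall x y, S x -> A2 y -> c x y <= C.
Hypothesis cS : forall w, 0 < w -> exists2 del, 0 < del &
  forall x y y', S x -> A2 y -> A2 y' -> ball y del y' -> c x y' <= c x y + w.

(** The neighbourhood of nu does not depend on mu, so the estimate holds for
    mu that varies with nu', as the minimisers do. *)
Lemma Tc_near (nu : prob_on R A2) (eps : R) : 0 < eps ->
  \forall nu' \near nu, forall mu : prob_on R A1, mu S = 1%E ->
    (Tc c mu nu' <= Tc c mu nu + eps%:E)%E /\
    (Tc c mu nu <= Tc c mu nu' + eps%:E)%E.
Proof.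
move=> eps0; have [C C0 hC] := cC.
have w0 : 0 < eps / 2 by rewrite divr_gt0.
have [del del0 hdel] := cS w0.
have [n [psi [cpsi psi0 psi_le1 psi1 psib]]] := exists_partition_of_unity dD2 kA2 del0.
have C10 : 0 < C + 1 by rewrite ltr_wpDl.
pose e := Num.min (1 / 2) (eps / 4 / (C + 1)).
have e0 : 0 < e by rewrite lt_min !divr_gt0.
have e1 : e < 1 by rewrite gt_min; apply/orP; left; lra.
have eC : eps / 2 + C * (2 * e) <= eps.
  have : e <= eps / 4 / (C + 1) by rewrite ge_min lexx orbT.
  rewrite ler_pdivlMr// => h; have : 0 <= e by exact: ltW.
  nra.
have psiM i x : `|psi i x| <= 1.
  rewrite ger0_norm//; apply: le_trans (psi_le1 x).
  by rewrite (bigD1 i)//= lerDl; exact: sumr_ge0.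
have en0 : 0 < e / n.+1%:R by rewrite divr_gt0.
have mpsi i := continuous_borelR (cpsi i).
pose psi' i : borel T2 -> R := psi i.
have : nbhs nu [set nu' : prob_on R A2 | forall i,
    `|\int[nu]_x psi' i x - \int[nu']_x psi' i x| < e / n.+1%:R].
  apply: (@filter_forall (prob_on R A2) 'I_n (fun i nu' =>
    `|\int[nu]_x psi' i x - \int[nu']_x psi' i x| < e / n.+1%:R) (nbhs nu)) => i.
  exact: (near_integral cA2 nu (cpsi i) (psiM i)).
apply: (@filterS _ (nbhs nu)) => nu' hnu' mu muS.
have bnd : \sum_i `|\int[nu]_x psi' i x - \int[nu']_x psi' i x| <= e.
  apply: (@le_trans _ _ (\sum_(i < n) (e / n.+1%:R))).
    by apply: ler_sum => i _; exact/ltW/hnu'.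
  rewrite sumr_const card_ord -[leLHS]mulr_natr mulrAC ler_pdivrMr//.
  by rewrite ler_pM2l// ler_nat.
have cpsi' i x y y' : S x -> A2 y -> A2 y' -> 0 < psi i y -> 0 < psi i y' ->
    c x y' <= c x y + eps / 2.
  by move=> Sx Yy Yy' h1 h2; apply: hdel => //; exact: psib h1 h2.
have W0 := ltW w0.
have bnd' : \sum_i `|\int[nu']_x psi' i x - \int[nu]_x psi' i x| <= e.
  by apply: le_trans bnd; apply: ler_sum => i _; rewrite distrC.
split.
  apply: (le_trans (Tc_partition dD1 dD2 cA1 cA2 c_ge0 mc mS muS SA1 mpsi psi0 psi_le1 psi1
    W0 C0 e0 e1 cpsi' hC bnd)).
  by apply: leeD2l; rewrite lee_fin.
apply: (le_trans (Tc_partition dD1 dD2 cA1 cA2 c_ge0 mc mS muS SA1 mpsi psi0 psi_le1 psi1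
    W0 C0 e0 e1 cpsi' hC bnd')).
by apply: leeD2l; rewrite lee_fin.
Qed.

End Tc_continuous_nu.

(** * Weak sequential compactness *)

(** Tychonoff gives a cluster point of the sequence in the product of the
    intervals; the subsequence follows it on longer and longer initial segments
    of coordinates. *)
Lemma diagonal_subsequence (R : realType) (u : nat -> nat -> R) :
  (forall n i, 0 <= u n i <= 1) ->
  exists (k : nat -> nat) (m : nat -> R), {homo k : i j / (i < j)%N} /\
    forall i, u (k n) i @[n --> \oo] --> m i.
Proof.
move=> u01.
pose PT := prod_topology (fun _ : nat => R).
have K := @tychonoff nat (fun=> R) (fun=> `[0, 1]%classic)
  (fun=> @segment_compact R 0 1).
have [|m [_ clm]] := K ((u : nat -> PT) @ \oo) _.
  by exists 0%N => // n _ i /=; rewrite in_itv/= u01.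
have step (kN : nat * nat) : exists n, (kN.2 <= n)%N /\
    forall i : 'I_kN.1, `|m i - u n i| < kN.1.+1%:R^-1.
  have e0 : 0 < kN.1.+1%:R^-1 :> R by rewrite invr_gt0.
  have nV : nbhs (m : PT) [set f : PT | forall i : 'I_kN.1, `|m i - f i| < kN.1.+1%:R^-1].
    apply: (@filter_forall PT 'I_kN.1 (fun i f => `|m i - f i| < kN.1.+1%:R^-1) (nbhs (m : PT))) => i.
    have := @proj_continuous nat (fun=> R) i m.
    by move=> /(_ (ball (m i) kN.1.+1%:R^-1)); apply; exact: nbhsx_ballx.
  have uN : ((u : nat -> PT) @ \oo) [set u n | n in [set n | (kN.2 <= n)%N]].
    by exists kN.2 => // n Nn; exists n.
  have [_ [[n Nn <-] hn]] := clm _ _ uN nV.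
  by exists n.
have [nxt hnxt] := choice step.
pose k := fix k n := if n is n'.+1 then nxt (n, (k n').+1) else nxt (0%N, 0%N).
have kS n : (k n < k n.+1)%N by have [] := hnxt (n.+1, (k n).+1).
have kV n i : (i < n)%N -> `|m i - u (k n) i| < n.+1%:R^-1.
  case: n => // n hi; have [_ /(_ (Ordinal hi))] := hnxt (n.+1, (k n).+1).
  exact.
exists k, m; split.
  by apply: homo_ltn => //; exact: ltn_trans.
move=> i; apply/cvgrPdist_lt => e e0.
have [N _ hN] := near_infty_natSinv_lt (PosNum e0).
exists (maxn N i.+1) => // n /=; rewrite geq_max => /andP[Nn iN].
by apply: lt_trans (kV n i iN) _; exact: hN.
Qed.

Section compact_uniform.
Context {R : realType} {T : normedModType R}.

Lemma within_continuousP (A : set T) (f : T -> R) : {within A, continuous f} <->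
  forall x e, A x -> 0 < e -> \forall y \near x, A y -> `|f y - f x| < e.
Proof.
rewrite subspace_continuousP; split => H x.
  move=> e Ax e0.
  have h : within A (nbhs x) (f @^-1` ball (f x) e).
    by apply: (H x Ax); exact: nbhsx_ballx.
  move: h; rewrite /within /=; apply: filterS => y hy Ay.
  by have := hy Ay; rewrite /ball/= distrC.
move=> Ax V /nbhs_ballP[e /= e0 eV]; have := H x e Ax e0.
apply: filterS => y h Ay; apply: eV; rewrite /ball/= distrC; exact: h.
Qed.

Lemma compact_unif_continuous (A K : set T) (f : T -> R) : compact K -> K `<=` A ->
  {within A, continuous f} -> forall e, 0 < e -> exists2 del, 0 < del &
    forall x y, K x -> K y -> ball x del y -> `|f x - f y| <= e.
Proof.
move=> /compact_near_coveringP/near_covering_withinP H KA /within_continuousP cf e e0.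
pose P del x := forall y, K y -> ball x del y -> `|f x - f y| <= e.
have : \forall del \near (0:R)^'+, K `<=` P del.
  apply: H => z Kz.
  have e2 : 0 < e / 2 by rewrite divr_gt0.
  have /nbhs_ballP[r /= r0 hr] := cf z _ (KA _ Kz) e2.
  have r2 : 0 < r / 2 by rewrite divr_gt0.
  near=> x del; have delr : del <= r / 2 by near: del; exact: nbhs_right_le.
  have zx : ball z (r / 2) x by near: x; exact: nbhsx_ballx.
  move=> Kx y Ky xy.
  have h1 : `|f x - f z| < e / 2.
    apply: hr (KA _ Kx); apply: le_ball zx; by move: r0; lra.
  have h2 : `|f y - f z| < e / 2.
    apply: hr (KA _ Ky); rewrite [r]splitr; apply: ball_triangle zx _.
    exact: le_ball xy.
  rewrite [e]splitr -(subrKA (f z)) (le_trans (ler_normD _ _))// lerD// ?ltW//.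
  by rewrite distrC.
move=> near_d; near (0:R)^'+ => del.
have del0 : 0 < del by near: del; exact: nbhs_right_gt.
have Pdel : K `<=` P del by near: del.
by exists del => // x y Kx Ky; exact: Pdel.
Unshelve. all: by end_near. Qed.

Lemma within_continuous_measurable (A : set T) (f : T -> R) : closed A ->
  {within A, continuous f} -> measurable_fun (A : set (borel T)) f.
Proof.
move=> cA /continuousP cf.
apply: (measurability _ (RGenOpens.measurableE R)).
move=> _ [_ [a [b ->] <-]].
have /open_subspaceP[V oV VA] : open ((f : subspace A -> R) @^-1` `]a, b[%classic).
  by apply: cf; exact: interval_open.
rewrite setIC -VA; apply: measurableI; first exact: open_borel.
exact: closed_borel.
Qed.

(** The sets are balls of rational radius around a dense sequence; the first n
    of them contain a cover of K by balls of radius below e / 2. *)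
Lemma compact_separating_sets (D : nat -> T) (dD : dense_seq D) (K : set T) :
  compact K -> exists E : nat -> set T, (forall i, open (E i)) /\
    forall e, 0 < e -> exists n, forall x y, K x -> K y ->
      (forall i, (i < n)%N -> E i x <-> E i y) -> ball x e y.
Proof.
move=> cK.
exists (fun i => let j := odflt (0%N, 0%N) (unpickle i) in
  ball (D j.1) j.2.+1%:R^-1); split => [i|e e0]; first exact: ball_open.
have [k ke] : exists k : nat, k.+1%:R^-1 < e / 2.
  have [N _ NN] := near_infty_natSinv_lt (PosNum (divr_gt0 e0 (ltr0n _ 2))).
  by exists N; apply: NN => /=.
have k0 : 0 < k.+1%:R^-1 :> R by rewrite invr_gt0.
have [N hN] := compact_finite_net dD cK k0.
exists (\max_(j < N) (pickle (nat_of_ord j, k))).+1 => x y Kx Ky xy.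
have [j jN xj] := hN x Kx.
have pj : (pickle (j, k) < (\max_(j < N) (pickle (nat_of_ord j, k))).+1)%N.
  rewrite ltnS.
  exact: (@leq_bigmax _ (fun j : 'I_N => pickle (nat_of_ord j, k)) (Ordinal jN)).
have := xy _ pj; rewrite pickleK/= => /iffLR/(_ xj) yj.
have kke : k.+1%:R^-1 + k.+1%:R^-1 <= e :> R.
  by rewrite [leRHS]splitr lerD// ltW.
by apply: (le_ball kke); apply: ball_triangle yj; exact: ball_sym.
Qed.

End compact_uniform.

Section dyadic_tree.
Context {R : realType}.

(** The integral, against masses m of the words of length size w + n that
    extend w, of the function taking the value v on each of them.  Words are
    built by adding the most recent bit at the head. *)
Fixpoint tree_sum (v m : seq bool -> R) n w : R :=
  if n is n'.+1 then tree_sum v m n' (true :: w) + tree_sum v m n' (false :: w)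
  else v w * m w.

(** A function that is e-close to a constant on each cell of level N has its
    integral e-close to the corresponding sum.  The same lemma serves for cells
    of a compact set and for subintervals of the unit interval. *)
Lemma tree_sum_integral d (Z : measurableType d) (P : probability Z R)
    (C : seq bool -> set Z) (mC : forall w, measurable (C w))
    (CU : forall w, C w = C (true :: w) `|` C (false :: w))
    (CI : forall w, C (true :: w) `&` C (false :: w) = set0)
    (g : Z -> R) (bg : bounded_mfun g) (v : seq bool -> R) (N : nat) (e : R) :
  (forall w z, size w = N -> C w z -> `|g z - v w| <= e) ->
  forall n w, (size w + n = N)%N ->
    `|\int[P]_(z in C w) g z - tree_sum v (fun w => fine (P (C w))) n w|
      <= e * fine (P (C w)).
Proof.
move=> gv; have ig := bounded_mfun_integrable P bg.
have igC w : P.-integrable (C w) (EFin \o g).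
  exact: (integrableS measurableT (mC w)).
have PE w : fine (P (C w)) = fine (P (C (true :: w))) + fine (P (C (false :: w))).
  by rewrite {1}CU measureU// fineD// ?fin_num_measure.
elim => [|n IH] w wN /=.
  rewrite addn0 in wN.
  rewrite -Rintegral_cst//.
  have ic k : P.-integrable (C w) (EFin \o cst k).
    apply: (integrableS measurableT (mC w)) => //.
    exact: (bounded_mfun_integrable P (bounded_mfun_cst _ k)).
  rewrite -RintegralB//; last exact: ic.
  have ib : P.-integrable (C w) (EFin \o (fun z => g z - v w)).
    have := integrableB (mC w) (igC w) (ic (v w)).
    by apply: eq_integrable.
  apply: (le_trans (le_normr_Rintegral (mC w) ib)).
  rewrite -Rintegral_cst//; apply: le_Rintegral => //.
  - exact: integrable_norm.
  - exact: ic.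
  - by move=> z Cz; exact: gv.
rewrite {1}CU Rintegral_setU//; last 2 first.
- by rewrite -CU.
- by apply/disj_setPS; rewrite CI.
rewrite PE mulrDr opprD addrACA (le_trans (ler_normD _ _))//.
by apply: lerD; apply: IH; rewrite addSnnS.
Qed.

Lemma tree_sum_cvg (v m : seq bool -> R) (u : nat -> seq bool -> R) :
  (forall w, u n w @[n --> \oo] --> m w) -> forall N w,
  tree_sum v (u n) N w @[n --> \oo] --> tree_sum v m N w.
Proof.
move=> um; elim => [|N IH] w /=; last by apply: cvgD; exact: IH.
by apply: cvgM => //; exact: cvg_cst.
Qed.

End dyadic_tree.

Section interval_tree.
Context {R : realType} (m : seq bool -> R).
Hypotheses (m0 : forall w, 0 <= m w) (m_nil : m [::] = 1)
  (mS : forall w, m w = m (true :: w) + m (false :: w)).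

(** The unit interval is divided in proportion to the masses m, the interval of
    false :: w coming before that of true :: w. *)
Fixpoint left_end (w : seq bool) : R :=
  if w is b :: w' then left_end w' + (if b then m (false :: w') else 0) else 0.

Definition tree_itv w : set R := `[left_end w, left_end w + m w[%classic.

Lemma tree_itvU w : tree_itv w = tree_itv (true :: w) `|` tree_itv (false :: w).
Proof.
apply/seteqP; split => u; rewrite /tree_itv/= !in_itv/= addr0.
  move=> /andP[h1]; rewrite mS => h2.
  have [h|h] := ltP u (left_end w + m (false :: w)).
    by right; rewrite h1.
  by left; rewrite -addrA [m (false :: w) + _]addrC h2.
have := m0 (true :: w); have := m0 (false :: w); rewrite (mS w) => ? ?.
by move=> [|] /andP[? ?]; apply/andP; split; lra.
Qed.

Lemma tree_itvI w : tree_itv (true :: w) `&` tree_itv (false :: w) = set0.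
Proof.
apply/seteqP; split => u // []; rewrite /tree_itv/= !in_itv/= addr0.
by move=> /andP[h _] /andP[_ h']; move: (le_lt_trans h h'); rewrite ltxx.
Qed.

Lemma tree_itv_measure w : lebesgue_measure (tree_itv w) = (m w)%:E.
Proof.
rewrite /tree_itv lebesgue_measure_itv/= lte_fin ltrDl.
have := m0 w; rewrite le_eqVlt => /predU1P[<-|->]; first by rewrite ltxx.
by rewrite -EFinD addrAC subrr add0r.
Qed.

Fixpoint tree_word (u : R) n : seq bool :=
  if n is n'.+1 then
    (left_end (tree_word u n') + m (false :: tree_word u n') <= u)
      :: tree_word u n'
  else [::].

Lemma size_tree_word u n : size (tree_word u n) = n.
Proof. by elim: n => //= n ->. Qed.

Lemma tree_word_itv u n : 0 <= u < 1 -> tree_itv (tree_word u n) u.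
Proof.
move=> u01; elim: n => [|n] /=.
  by rewrite /tree_itv/= in_itv/= m_nil add0r.
move: (tree_word u n) (tree_itvU (tree_word u n)) => /= w -> [].
  by move=> h; have := h; rewrite {1}/tree_itv/= in_itv/= => /andP[-> _].
move=> h; have := h; rewrite {1}/tree_itv/= in_itv/= addr0 => /andP[_].
by rewrite ltNge => /negbTE ->.
Qed.

Lemma tree_wordP u w : tree_itv w u -> tree_word u (size w) = w.
Proof.
elim: w => //= b w IH bw.
have wu : tree_itv w u by rewrite tree_itvU; case: b bw => ?; [left|right].
rewrite IH//; congr (_ :: _); case: b bw.
  by rewrite /tree_itv/= in_itv/= => /andP[].
by rewrite /tree_itv/= in_itv/= addr0 => /andP[_]; rewrite ltNge => /negbTE.
Qed.

Lemma tree_word_measurable n w :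
  measurable ([set u | tree_word u n = w] : set (measurableTypeR R)).
Proof.
elim: n w => [|n IH] w.
  have [->|w0] := eqVneq w [::].
    by rewrite (_ : mkset _ = setT)//; apply/seteqP; split.
  by rewrite (_ : mkset _ = set0)//; apply/seteqP; split => // u /esym/eqP; rewrite (negbTE w0).
case: w => [|b w]; first by rewrite (_ : mkset _ = set0)//; apply/seteqP; split.
rewrite (_ : mkset _ = [set u | tree_word u n = w] `&`
    (if b then `[left_end w + m (false :: w), +oo[%classic
     else `]-oo, left_end w + m (false :: w)[%classic)).
  by apply: measurableI => //; case: b.
apply/seteqP; split => u /=.
  move=> [<- ->]; split => //.
  by case: leP => h; rewrite /= in_itv/= ?h.
move=> [-> h]; congr (_ :: _).
by case: b h; rewrite /= in_itv/= ?andbT// ltNge => /negbTE.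
Qed.

End interval_tree.

Section weak_compactness.
Context {R : realType} {T : normedModType R}.
Variables (D : nat -> T) (dD : dense_seq D).
Context (A K : set T) (cA : closed A) (kK : compact K) (KA : K `<=` A).
Variables (gam : nat -> prob_on R A) (gamK : forall n, gam n K = 1%E).

Let cK : closed K. Proof. by apply: compact_closed => //; exact: norm_hausdorff. Qed.
Let mK : measurable (K : set (borel T)). Proof. exact: closed_borel. Qed.
Let mA : measurable (A : set (borel T)). Proof. exact: closed_borel. Qed.

(** Sort the points of K by the first n separating sets; this gives a binary
    tree of cells.  Along a diagonal subsequence the mass of every cell
    converges.  The limit masses divide the unit interval into subintervals
    indexed by the same tree, and the map th that sends u to a point in the
    closures of the cells coding u carries Lebesgue measure to the limit
    measure: both the integral of a continuous function against the sequence
    and its integral against the image are approximated by the same sums over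
    the cells of a fine level. *)
Lemma weak_compactness : exists (k : nat -> nat) (g : prob_on R A),
  [/\ {homo k : i j / (i < j)%N}, g K = 1%E & (gam \o k) @ \oo --> g].
Proof.
have [x0 Kx0] : K !=set0.
  apply/set0P/eqP => K0; have := gamK 0%N; rewrite K0 measure0 => /eqP.
  by rewrite eq_sym onee_eq0.
have [E [oE sepE]] := compact_separating_sets dD kK.
pose cell := fix cell (w : seq bool) : set (borel T) :=
  if w is b :: w' then cell w' `&` (if b then E (size w') else ~` E (size w'))
  else K.
have mcell w : measurable (cell w).
  elim: w => // b w IH /=; apply: measurableI => //; case: b.
    exact: open_borel.
  by apply: measurableC; exact: open_borel.
have cellU w : cell w = cell (true :: w) `|` cell (false :: w).
  by rewrite /= -setIUr setUv setIT.
have cellI w : cell (true :: w) `&` cell (false :: w) = set0.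
  by rewrite /= setIACA setICr setI0.
have cellK w : cell w `<=` K.
  by elim: w => // b w IH x [/IH].
have cell_agree w x y : cell w x -> cell w y ->
    forall i, (i < size w)%N -> E i x <-> E i y.
  elim: w => // b w IH /= [wx bx] [wy by_] i; rewrite ltnS leq_eqVlt.
  by move=> /predU1P[->|]; [case: b bx by_|exact: IH].
pose mass n w := fine (gam n (cell w)).
have mass01 n w : 0 <= mass n w <= 1.
  rewrite fine_ge0//= -lee_fin fineK ?fin_num_measure//.
  exact: probability_le1.
have massS n w : mass n w = mass n (true :: w) + mass n (false :: w).
  by rewrite /mass {1}cellU measureU// fineD// ?fin_num_measure.
have [k [m' [kincr hm]]] := diagonal_subsequence (fun n i =>
  mass01 n (odflt [::] (unpickle i))).
pose m (w : seq bool) := m' (pickle w).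
have um w : mass (k n) w @[n --> \oo] --> m w.
  by have := hm (pickle w); rewrite pickleK.
have m0 w : 0 <= m w.
  have := um w; move/cvg_lim => <-//; apply: limr_ge.
    by apply/cvg_ex; exists (m w); exact: um.
  by apply: nearW => n; case/andP: (mass01 (k n) w).
have m_nil : m [::] = 1.
  have := um [::]; rewrite (_ : (fun n => _) = cst 1); last first.
    by apply/funext => n; rewrite /mass/= gamK.
  by move=> h; apply: (cvg_unique _ h (@cvg_cst _ _ _ _ _)) => //; exact: norm_hausdorff.
have mS w : m w = m (true :: w) + m (false :: w).
  have h : mass (k n) w @[n --> \oo] --> m (true :: w) + m (false :: w).
    rewrite (_ : (fun n => _) = (fun n => mass (k n) (true :: w) + mass (k n) (false :: w))).
      by apply: cvgD; exact: um.
    by apply/funext => n; exact: massS.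
  by apply: (cvg_unique _ (um w) h) => //; exact: norm_hausdorff.
(* An interval that contains a point has positive length, so its cell is not
   empty and a point can be chosen in it. *)
have m_cell w : 0 < m w -> cell w !=set0.
  move=> mw; apply/set0P/eqP => w0; have := um w.
  rewrite (_ : (fun n => _) = cst 0); last first.
    by apply/funext => n; rewrite /mass/= w0 measure0.
  move=> h; have mw0 : m w = 0.
    by apply: (cvg_unique _ h (@cvg_cst _ _ _ _ _)) => //; exact: norm_hausdorff.
  by move: mw; rewrite mw0 ltxx.
pose pt w := xget x0 (cell w).
have pt_cell w : cell w !=set0 -> cell w (pt w).
  by move=> [x wx]; exact: (xgetI x0 wx).
pose word := tree_word m.
have word_cell u n : 0 <= u < 1 -> cell (word u n) !=set0.
  move=> u01; apply: m_cell; have := tree_word_itv m0 m_nil mS n u01.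
  rewrite /tree_itv/= in_itv/= => /andP[h1 h2].
  by have := le_lt_trans h1 h2; rewrite ltrDl.
have word_sub u n n' : (n <= n')%N -> cell (word u n') `<=` cell (word u n).
  move=> /subnKC <-; elim: (n' - n)%N => [|j IH]; first by rewrite addn0.
  by rewrite addnS => x [+ _]; exact: IH.
(* th has to be defined on the whole line; points outside the unit interval,
   which form a null set, are treated as 0. *)
pose clamp (u : R) := if u \in `[0, 1[ then u else 0.
have clamp01 u : 0 <= clamp u < 1.
  by rewrite /clamp; case: ifPn; rewrite ?in_itv//= lexx ltr01.
have mclamp : measurable_fun setT (clamp : measurableTypeR R -> measurableTypeR R).
  apply: measurable_fun_ifT => //; apply: (measurable_fun_bool true).
  rewrite setTI (_ : _ @^-1` _ = `[0, 1[%classic); first exact: measurable_itv.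
  by apply/seteqP; split => z.
have /choice[th hth] : forall u : R, exists t, K t /\
    forall n, closure (cell (word (clamp u) n)) t.
  move=> u; have c01 := clamp01 u.
  have [|t [Kt clt]] := kK (F := (fun n => pt (word (clamp u) n)) @ \oo) _.
    by exists 0%N => // n _; apply: (cellK (word (clamp u) n)); apply: pt_cell; exact: word_cell.
  exists t; split => // n V Vt; apply: clt => //.
  exists n => // j /= nj; apply: (word_sub _ _ _ nj).
  by apply: pt_cell; exact: word_cell.
have thclose e : 0 < e -> exists N, forall u n x, (N <= n)%N ->
    cell (word (clamp u) n) x -> ball x e (th u).
  move=> e0; have e2 : 0 < e / 2 by rewrite divr_gt0.
  have [N hN] := sepE _ e2; exists N => u n x Nn nx.
  have [_ clu] := hth u.
  have [y [ny uy]] := clu n _ (nbhsx_ballx (th u) _ e2).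
  rewrite [e]splitr; apply: ball_triangle (ball_sym uy).
  apply: hN => [||i iN]; [exact: (cellK _ _ nx)|exact: (cellK _ _ ny)|].
  apply: cell_agree nx ny _ _; rewrite size_tree_word.
  exact: leq_trans Nn.
have ptclose e : 0 < e -> exists N, forall u n, (N <= n)%N ->
    ball (pt (word (clamp u) n)) e (th u).
  move=> /thclose[N hN]; exists N => u n Nn; apply: (hN u n) => //.
  by apply: pt_cell; exact: word_cell.
have mword (N : nat) (Q : set (seq bool)) :
    measurable ([set u | Q (word (clamp u) N)] : set (measurableTypeR R)).
  rewrite (_ : mkset _ = \bigcup_(w in Q) (clamp @^-1` [set u | word u N = w])).
    rewrite bigcup_mkcond; apply: countable_bigcupT_measurable => [|w].
      exact: countableP.
    case: ifPn => // _; rewrite -[X in measurable X]setTI; apply: mclamp => //.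
    exact: tree_word_measurable.
  apply/seteqP; split => u /= => [Qu|[w Qw uw]]; last by rewrite -uw in Qw.
  by exists (word (clamp u) N).
(* th is a uniform limit of functions of finitely many bits of the code. *)
have mth : measurable_fun [set: measurableTypeR R] (th : _ -> borel T).
  apply: (@measurability _ _ _ (borel T) setT _ open erefl) => _ [V oV <-].
  rewrite setTI.
  have e0 (j : nat) : 0 < j.+1%:R^-1 :> R by rewrite invr_gt0.
  have /choice[N hN] := fun j => ptclose _ (e0 j).
  rewrite (_ : _ @^-1` _ = \bigcup_j [set u | [set w | ball (pt w) j.+1%:R^-1 `<=` V]
      (word (clamp u) (N j))]).
    by apply: bigcupT_measurable => j; exact: mword.
  apply/seteqP; split => u /=; last first.
    by move=> [j _ /=]; apply; exact: hN.
  move=> Vu; have /nbhs_ballP[e /= ep eV] : nbhs (th u) V by exact: open_nbhs_nbhs.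
  have [j je] : exists j : nat, j.+1%:R^-1 < e / 2.
    have [J _ JJ] := near_infty_natSinv_lt (PosNum (divr_gt0 ep (ltr0n _ 2))).
    by exists J; apply: JJ => /=.
  exists j => // x px; apply: eV.
  rewrite [e]splitr; apply: ball_triangle (le_ball (ltW je) px).
  by apply: (le_ball (ltW je)); apply: ball_sym; exact: hN.
have mI : measurable (`[0, 1[%classic : set (measurableTypeR R)).
  exact: measurable_itv.
have I1 : mrestr lebesgue_measure mI setT = 1%E.
  by rewrite /mrestr setTI lebesgue_measure_itv/= lte_fin ltr01 sube0.
pose P := prob_of I1.
have mitv w : measurable (tree_itv m w : set (measurableTypeR R)) by exact: measurable_itv.
have Pitv w : P (tree_itv m w) = (m w)%:E.
  rewrite -(tree_itv_measure m0) -[LHS]/(lebesgue_measure (tree_itv m w `&` `[0, 1[%classic)).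
  rewrite setIidl//; elim: w => [|b w IH].
    by rewrite /tree_itv/= m_nil add0r.
  apply: subset_trans IH; rewrite (tree_itvU m0 mS w); case: b => u ?; [by left|by right].
have g1 : Defs.image P mth setT = 1%E by exact: probability_setT.
have gK1 : prob_of g1 K = 1%E.
  rewrite -(probability_setT P) -[LHS]/(P (th @^-1` K)); congr (P _).
  by apply/seteqP; split => // u _; have [] := hth u.
have gA1 : prob_of g1 A = 1%E.
  apply/eqP; rewrite eq_le probability_le1//= -gK1 le_measure ?inE//.
exists k, (ProbOn gA1); split => //.
apply/prob_on_cvgP => -[f [cf [M fM]]] /=.
have mfA : measurable_fun [set: borel T] (f \_ A).
  by apply/(measurable_restrictT _ mA); exact: within_continuous_measurable.
have bfA : bounded_mfun (f \_ A : borel T -> R).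
  split=> //; exists `|M| => x; rewrite patchE; case: ifPn => [/set_mem Ax|_].
    by rewrite (le_trans (fM _ Ax))// ler_norm.
  by rewrite normr0.
have toK (h : prob_on R A) : h K = 1%E ->
    \int[h]_(x in A) f x = \int[h]_(x in K) (f \_ A) x.
  by move=> hK; rewrite Rintegral_mkcond Rintegral_full.
apply/cvgrPdist_le => e e0; have e3 : 0 < e / 3 by rewrite divr_gt0.
have [del del0 hdel] := compact_unif_continuous kK KA cf e3.
have [N1 hN1] := ptclose _ del0; have [N2 hN2] := sepE _ del0.
pose N := maxn N1 N2.
pose v w := (f \_ A) (pt w).
have ptK w : K (pt w).
  rewrite /pt; case: xgetP => [x -> /cellK//|_ //].
have fAK x : K x -> (f \_ A) x = f x by move=> Kx; rewrite patchE mem_set//; exact: KA.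
have estim n : `|\int[gam n]_(x in K) (f \_ A) x - tree_sum v (mass n) N [::]| <= e / 3.
  have h := tree_sum_integral (gam n) mcell cellU cellI bfA (v := v) (N := N) (e := e / 3).
  apply: (le_trans (h _ N [::] (add0n _))); last by rewrite /= gamK mulr1.
  move=> w z wN wz; rewrite /v !fAK//; last exact: cellK wz.
  apply: hdel => //; first exact: cellK wz.
  apply: hN2 => //; first exact: cellK wz.
  have wpt : cell w (pt w) by apply: pt_cell; exists z.
  move=> i iN2; apply: cell_agree wz wpt _ _; rewrite wN.
  by apply: leq_trans iN2 _; exact: leq_maxr.
have bth : bounded_mfun (fun u : measurableTypeR R => (f \_ A) (th u)).
  split; first exact: (measurableT_comp mfA mth).
  by have [_ [L hL]] := bfA; exists L.
have estimg : `|\int[prob_of g1]_(x in K) (f \_ A) x - tree_sum v m N [::]| <= e / 3.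
  have -> : \int[prob_of g1]_(x in K) (f \_ A) x = \int[P]_(u in tree_itv m [::]) (f \_ A) (th u).
    rewrite Rintegral_full//.
    rewrite (@Rintegral_full _ _ _ P (tree_itv m [::]) _ (mitv _) _ bth.1); last by rewrite Pitv m_nil.
    rewrite /Rintegral; congr fine.
    have mfE : measurable_fun [set: borel T] (fun x => ((f \_ A) x)%:E).
      exact/measurable_EFinP.
    transitivity (\int[pushforward P (th : measurableTypeR R -> borel T)]_x ((f \_ A) x)%:E)%E.
      by apply: eq_measure_integral.
    exact: (@integral_pushforward _ _ (measurableTypeR R) (borel T) R th mth P setT _ mfE (bounded_mfun_integrable P bth) measurableT).
  have h := tree_sum_integral P mitv
    (tree_itvU m0 mS) (tree_itvI m) bth (v := v) (N := N) (e := e / 3).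
  rewrite (_ : tree_sum v m = tree_sum v (fun w => fine (P (tree_itv m w)))); last first.
    by congr tree_sum; apply/funext => w; rewrite Pitv.
  apply: (le_trans (h _ N [::] (add0n _))); last by rewrite Pitv m_nil mulr1.
  move=> w u wN wu; rewrite /v !fAK//; last by have [] := hth u.
  have u01 : u \in `[0, 1[.
    have : tree_itv m [::] u.
      elim: w wu {wN} => // b w IH bw; apply: IH.
      by rewrite (tree_itvU m0 mS); case: b bw => ?; [left|right].
    by rewrite /tree_itv/= m_nil add0r.
  have cu : clamp u = u by rewrite /clamp u01.
  rewrite distrC; apply: hdel => //; first by have [] := hth u.
  have := hN1 u N (leq_maxl _ _); rewrite cu.
  by have /= := tree_wordP m0 mS wu; rewrite wN => <-.
have cvS : tree_sum v (mass (k n)) N [::] @[n --> \oo] --> tree_sum v m N [::].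
  exact: tree_sum_cvg.
move/cvgrPdist_le : cvS => /(_ _ e3); apply: filterS => n hn.
rewrite (toK (ProbOn gA1))// (toK (gam (k n)))//.
have tri (a b x y : R) : `|a - b| <= e / 3 -> `|x - b| <= e / 3 ->
    `|y - a| <= e / 3 -> `|y - x| <= e.
  rewrite !ler_norml => /andP[? ?] /andP[? ?] /andP[? ?].
  by apply/andP; split; lra.
exact: tri hn (estim (k n)) estimg.
Qed.

End weak_compactness.

(** * Measures determined by continuous functions *)
Section continuous_tests.
Context {R : realType} {T : normedModType R}.
Variables (D : nat -> T) (dD : dense_seq D).

(** Tents with supports in the balls of a countable cover of V by balls
    contained in V: N times the sum of the first N of them tends to infinity
    on V and vanishes outside. *)
Lemma open_indic_approx (V : set T) : open V ->
  exists f : nat -> T -> R, [/\ forall N, continuous (f N),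
    forall N x, 0 <= f N x <= 1 & forall x, f N x @[N --> \oo] --> (\1_V x : R)].
Proof.
move=> oV.
pose i2 (i : nat) := odflt (0%N, 0%N) (unpickle i) : nat * nat.
pose r i : R := (i2 i).2.+1%:R^-1.
pose d i := D (i2 i).1.
pose g i x : R := if `[< ball (d i) (r i) `<=` V >] then Num.max 0 (r i - `|d i - x|) else 0.
have g0 i x : 0 <= g i x by rewrite /g; case: ifP => // _; rewrite le_max lexx.
have cg i : continuous (g i).
  rewrite /g; case: (asboolP (ball (d i) (r i) `<=` V)) => _; last by move=> x; exact: cvg_cst.
  apply: continuous_maxr; first by move=> y; exact: cvg_cst.
  move=> y; apply: cvgB; first exact: cvg_cst.
  apply: cvg_norm; apply: cvgB; first exact: cvg_cst.
  exact: cvg_id.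
pose G N x := N%:R * \sum_(i < N) g i x.
have G0 N x : 0 <= G N x by rewrite mulr_ge0// sumr_ge0.
exists (fun N x => Num.min 1 (G N x)); split.
- move=> N x.
  have cG : continuous (G N).
    move=> y; apply: cvgM; first exact: cvg_cst.
    by apply: continuous_big => // ; exact: add_continuous.
  exact: (@continuous_min R T (fun=> 1 : R^o) (G N : T -> R^o) x (@cvg_cst _ _ _ _ _) (cG x)).
- by move=> N x; rewrite le_min ler01 G0 ge_min lexx.
- move=> x; rewrite indicE; case: (boolP (x \in V)) => [/set_mem Vx|/negP Vx].
    move: Vx; rewrite {1}(open_bigcup_ball dD oV) => -[[j k] /= jkV jkx].
    pose i0 := pickle (j, k).
    have g0x : 0 < g i0 x.
      rewrite /g /d /r /i2 pickleK/=; case: asboolP => // _.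
      by rewrite lt_max subr_gt0; move: jkx; rewrite -ball_normE/= => ->; rewrite orbT.
    have [N1 hN1] : exists N1 : nat, (g i0 x)^-1 <= N1%:R.
      by exists (Num.bound (g i0 x)^-1); apply/ltW/archi_boundP; rewrite invr_ge0.
    apply: cvg_near_cst; exists (maxn N1 i0.+1) => // N /=; rewrite geq_max => /andP[N1N iN].
    apply/min_idPl; apply: (@le_trans _ _ (N%:R * g i0 x)).
      rewrite -ler_pdivrMr// mul1r (le_trans hN1)// ler_nat//.
    by rewrite ler_wpM2l// (bigD1 (Ordinal iN))//= lerDl sumr_ge0.
  apply: cvg_near_cst; apply: nearW => N.
  have -> : G N x = 0; last by apply/min_idPr.
  rewrite /G big1 ?mulr0// => i _; rewrite /g; case: asboolP => // h.
  apply/max_idPl; rewrite subr_le0 leNgt; apply/negP => h'.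
  by apply: Vx; apply: mem_set; apply: h; rewrite -ball_normE.
Qed.

(** Open sets form a generating family closed under intersection, and their
    measures are limits of integrals of continuous functions. *)
Lemma prob_eq_continuous (P Q : probability (borel T) R) :
  (forall f : borel T -> R, continuous (f : T -> R) ->
    (forall x, `|f x| <= 1) -> \int[P]_x f x = \int[Q]_x f x) ->
  forall U, measurable U -> P U = Q U.
Proof.
move=> PQ.
have PQo (V : set T) : open V -> P V = Q V.
  move=> oV; have [f [cf f01 fV]] := open_indic_approx oV.
  have f1 N x : `|f N x| <= 1 by rewrite ger0_norm; case/andP: (f01 N x).
  have mV : measurable (V : set (borel T)) by exact: open_borel.
  have lim (P' : probability (borel T) R) :
      (\int[P']_x (f N x)%:E @[N --> \oo] --> P' V)%E.
    rewrite -[V in P' V]setIT -integral_indic//.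
    apply: (@dominated_cvg _ _ _ P' setT measurableT
      (fun N x => (f N x)%:E) (fun x => (\1_V x : R)%:E) (cst 1%E)) => //.
    - by move=> N; apply/measurable_EFinP; exact: continuous_borelR.
    - by move=> x _; apply: cvg_EFin; [exact: nearW|exact: fV].
    - exact: (bounded_mfun_integrable P' (bounded_mfun_cst _ 1)).
    - by move=> N x _; rewrite lee_fin.
  have bf N : bounded_mfun (f N : borel T -> R).
    by split; [exact: continuous_borelR|exists 1].
  apply: (cvg_unique _ (lim P)); first exact: ereal_hausdorff.
  rewrite (_ : (fun N => _) = (fun N => \int[Q]_x (f N x)%:E)%E); first exact: lim.
  by apply/funext => N; rewrite !bounded_mfunE// PQ.
move=> U mU.
apply: (@measure_unique _ R (borel T) (@open T) (fun=> setT) erefl _ _ _ P Q) => //.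
- by move=> A B; exact: openI.
- by move=> _; exact: openT.
- by rewrite bigcup_const//; exists 0%N.
- by move=> _; rewrite (le_lt_trans (probability_le1 P measurableT))// ltry.
Qed.

End continuous_tests.

(** * Lebesgue measure and subgraphs *)
Section lebesgue_facts.
Context {R : realType} {n : nat}.
Local Notation leb := (@lebesgue_rV R n).
Local Notation lebX := (@lebesgue_rVR R n).

Lemma lebesgue_rVRE (U : set (borel ('rV[R]_n * R)%type)) :
  lebX U = (\int[leb]_s lebesgue_measure (xsection U s))%E.
Proof. by []. Qed.

Lemma lebesgue_rV_ball (x : 'rV[R]_n) (e : R) : 0 < e ->
  leb (ball x e) = ((e *+ 2) ^+ n)%:E.
Proof.
move=> e0.
have -> : ball x e = [set v : 'rV[R]_n | forall i, ball (x 0 i) e (v 0 i)].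
  apply/seteqP; split => v /=; first by move=> [_ h] i; exact: h.
  by move=> h; split => // i j; rewrite [i]ord1; exact: h.
rewrite (@lebesgue_rV_box R n (fun i => ball (x 0 i) e)); last first.
  by move=> i; apply: open_measurable; exact: ball_open.
under eq_bigr do rewrite lebesgue_measure_ball ?ltW//.
by rewrite big_const_ord; elim: n => //= k ->; rewrite exprS EFinM.
Qed.

Lemma lebesgue_rV_compact (B : set 'rV[R]_n) : compact B -> (leb B < +oo)%E.
Proof.
move=> cB.
have mB : measurable (B : set (borel 'rV[R]_n)).
  by apply: closed_borel; apply: compact_closed => //; exact: norm_hausdorff.
have [M M0 hM] : exists2 M, 0 < M & B `<=` ball (0 : 'rV[R]_n) M.
  have [M [_ hM]] := compact_bounded cB.
  exists (Num.max 1 (M + 1) + 1); first by rewrite addr_gt0// lt_max ltr01.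
  move=> v Bv; rewrite -ball_normE/= sub0r normrN.
  apply: le_lt_trans (hM (Num.max 1 (M + 1)) _ v Bv) _; last by rewrite ltrDl.
  by rewrite lt_max ltrDl ltr01 orbT.
apply: (@le_lt_trans _ _ (leb (ball (0 : 'rV[R]_n) M))).
  by rewrite le_measure ?inE//; apply: open_borel; exact: ball_open.
by rewrite lebesgue_rV_ball// ltry.
Qed.

Lemma lebesgue_rV_interior (B : set 'rV[R]_n) : compact B -> B° !=set0 ->
  (0 < leb B)%E.
Proof.
move=> cB [x]; rewrite /interior/= => /nbhs_ballP[e /= e0 eB].
have mB : measurable (B : set (borel 'rV[R]_n)).
  by apply: closed_borel; apply: compact_closed => //; exact: norm_hausdorff.
apply: (@lt_le_trans _ _ (leb (ball x e))).
  by rewrite lebesgue_rV_ball// lte_fin exprn_gt0// mulrn_wgt0.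
by rewrite le_measure ?inE//; apply: open_borel; exact: ball_open.
Qed.

End lebesgue_facts.

Section subgraphs.
Context {R : realType} {n : nat}.
Local Notation leb := (@lebesgue_rV R n).
Local Notation lebX := (@lebesgue_rVR R n).
Variables (B : set 'rV[R]_n) (cB : compact B).

Lemma compact_borel : measurable (B : set (borel 'rV[R]_n)).
Proof.
by apply: closed_borel; apply: compact_closed => //; exact: norm_hausdorff.
Qed.
Let mB := compact_borel.

Lemma subgraph_borel (q : borel 'rV[R]_n -> R) : measurable_fun (B : set (borel 'rV[R]_n)) q ->
  measurable (subgraph B q : set (borel ('rV[R]_n * R)%type)).
Proof. by move=> mq; apply: measurable_rVR; exact: subgraph_measurable. Qed.

Lemma mu_pacE (p : Pac B) (U : set (borel ('rV[R]_n * R)%type)) :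
  mu_pac cB p U = lebX (U `&` subgraph B p).
Proof. by []. Qed.

Lemma xsection_subgraphD (p q : 'rV[R]_n -> R) s : B s -> 0 <= q s ->
  xsection (subgraph B p `\` subgraph B q) s = `]q s, p s]%classic.
Proof.
move=> Bs q0; apply/seteqP; split => r; rewrite /xsection/= inE in_itv/=.
  move=> [[[/= _ r0] /= rp] h]; rewrite rp andbT ltNge; apply/negP => rq.
  by apply: h.
move=> /andP[qr rp]; split; last by move=> [_ /=]; rewrite leNgt qr.
by split => //; split => //=; rewrite (le_trans q0)// ltW.
Qed.

Lemma xsection_subgraphD0 (p q : 'rV[R]_n -> R) s : ~ B s ->
  xsection (subgraph B p `\` subgraph B q) s = set0.
Proof.
move=> Bs; apply/seteqP; split => // r; rewrite /xsection/= inE.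
by move=> [[[/= /Bs]]].
Qed.

Lemma subgraphD_measure (p q : borel 'rV[R]_n -> R) :
  (forall s, B s -> 0 <= q s) ->
  lebX (subgraph B p `\` subgraph B q) =
  (\int[leb]_(s in B) (Num.max 0 (p s - q s))%:E)%E.
Proof.
move=> q0; rewrite lebesgue_rVRE [RHS]integral_mkcond; apply: eq_integral => s _.
rewrite patchE; case: ifPn => [/set_mem Bs|/negP Bs]; last first.
  rewrite xsection_subgraphD0 ?measure0// => ?; apply: Bs; exact: mem_set.
rewrite xsection_subgraphD//; last exact: q0.
rewrite lebesgue_measure_itv/= lte_fin.
have [h|h] := ltP (q s) (p s).
  by rewrite -EFinB max_r// subr_ge0 ltW.
by rewrite max_l// subr_le0.
Qed.

Lemma Pac_of (f : borel 'rV[R]_n -> R) : measurable_fun (B : set (borel 'rV[R]_n)) f ->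
  (forall s, B s -> 0 <= f s) -> (\int[leb]_(s in B) (f s)%:E = 1)%E ->
  exists p : Pac B, density p = f.
Proof.
move=> mf f0 f1.
have f0' : {ae leb, forall s, B s -> 0 <= f s} by exact: aeW.
by exists (MkPac mf f0' f1).
Qed.

(** A density may be changed on a null set; this is how densities are made
    nonnegative or bounded everywhere rather than almost everywhere. *)
Lemma Pac_ae (p : Pac B) (f : borel 'rV[R]_n -> R) : measurable_fun (B : set (borel 'rV[R]_n)) f ->
  (forall s, B s -> 0 <= f s) -> {ae leb, forall s, B s -> f s = p s} ->
  exists2 p' : Pac B, density p' = f & forall U, measurable U ->
    mu_pac cB p' U = mu_pac cB p U.
Proof.
move=> mf f0 fp.
have mp := density_measurable p.
have f1 : (\int[leb]_(s in B) (f s)%:E = 1)%E.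
  rewrite -(density1 p); apply: ae_eq_integral => //.
  - exact/measurable_EFinP.
  - exact/measurable_EFinP.
  - have aeF := ae_filter_ringOfSetsType leb.
    by apply: (@filterS _ _ aeF) fp => s + Bs => ->.
have [p' p'f] := Pac_of mf f0 f1.
exists p' => // U mU.
have mS (q : Pac B) : measurable (U `&` subgraph B q).
  apply: measurableI => //; apply: subgraph_borel; exact: density_measurable.
rewrite !mu_pacE !lebesgue_rVRE.
have mx (V : set (borel ('rV[R]_n * R)%type)) : measurable V ->
    measurable_fun setT (fun s : borel 'rV[R]_n => lebesgue_measure (xsection V s)).
  move=> mV.
  apply: (@measurable_fun_xsection _ _ (borel 'rV[R]_n) (measurableTypeR R) R lebesgue_measure V).
  by rewrite -[X in measurable X]setTI; apply: (@measurable_fun_rVR R n).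
apply: ae_eq_integral => //.
- exact: mx.
- exact: mx.
have aeF := ae_filter_ringOfSetsType leb.
apply: (@filterS _ _ aeF) fp => s fps _.
congr lebesgue_measure; apply/seteqP; split => r; rewrite /xsection/= !inE p'f.
  by move=> [Ur [[/= Bs r0] /= rf]]; split => //; split => //=; rewrite -fps.
by move=> [Ur [[/= Bs r0] /= rf]]; split => //; split => //=; rewrite fps.
Qed.

End subgraphs.

(** * Transport from subgraphs *)
Section cylinder_transport.
Context {R : realType} {n : nat} {T : normedModType R}.
Local Notation leb := (@lebesgue_rV R n).
Local Notation lebX := (@lebesgue_rVR R n).
Local Notation X := ('rV[R]_n * R)%type.
Variables (D1 : nat -> X) (D2 : nat -> T).
Hypotheses (dD1 : dense_seq D1) (dD2 : dense_seq D2).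
Variables (B : set 'rV[R]_n) (cB : compact B) (Y : set T) (cY : closed Y).
Context (c : X -> T -> R).
Hypothesis c_ge0 : forall x y, cylinder B x -> Y y -> 0 <= c x y.
Hypothesis mc : measurable_fun [set: borel (X * T)%type] (cost_ext (cylinder B) Y c).

Lemma cylinder_closed : closed (cylinder B).
Proof.
have cB' : closed B by apply: compact_closed => //; exact: norm_hausdorff.
have -> : cylinder B = fst @^-1` B `&` snd @^-1` [set r | 0 <= r] by [].
apply: closedI.
  by apply: preimage_closed => // z _; exact: cvg_fst.
apply: preimage_closed; last exact: closed_ge.
by move=> z _; exact: cvg_snd.
Qed.

Let mS (p : Pac B) : measurable (subgraph B p : set (borel X)).
Proof. by apply: subgraph_borel => //; exact: density_measurable. Qed.

Lemma subgraph_measure1 (p : Pac B) : lebX (subgraph B p) = 1%E.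
Proof.
have := probability_setT (mu_pac cB p).
by rewrite -[X in X = _ -> _]/(lebX (setT `&` subgraph B p)) setTI.
Qed.

(** Two subgraphs have the same measure 1, hence exceed each other equally. *)
Lemma subgraphD_sym (p q : Pac B) :
  lebX (subgraph B p `\` subgraph B q) = lebX (subgraph B q `\` subgraph B p).
Proof.
have := subgraph_measure1 p; rewrite -(subgraph_measure1 q).
rewrite (measureDI lebX (mS p) (mS q)) (measureDI lebX (mS q) (mS p)).
rewrite [subgraph B q `&` _]setIC => h.
have Ifin : lebX (subgraph B p `&` subgraph B q) \is a fin_num.
  rewrite ge0_fin_numE//; apply: (@le_lt_trans _ _ (lebX (subgraph B p))).
    by rewrite le_measure ?inE//; exact: measurableI.
  by rewrite subgraph_measure1 ltry.
by rewrite -[LHS](addeK _ Ifin) h addeK.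
Qed.

Variable nu : prob_on R Y.
Local Notation F := (transport_functional c cB nu).
Local Open Scope ereal_scope.

Lemma transport_functional_ext (p q : Pac B) :
  (forall U, measurable U -> mu_pac cB p U = mu_pac cB q U) -> F p = F q.
Proof. exact: Tc_ext. Qed.

(** The subgraph of q is obtained from that of p by deleting the part above q
    and adding a region of the same measure, so mass deleted at x may be
    resampled uniformly in the added region.  The constant a measures a gain,
    b a loss. *)
Lemma Tc_move (p q : Pac B) (a b : R) : (0 <= a)%R -> (0 <= b)%R ->
  (forall x x' y, (subgraph B p `\` subgraph B q) x ->
    (subgraph B q `\` subgraph B p) x' -> Y y -> (c x' y + a <= c x y + b)%R) ->
  F q + a%:E * lebX (subgraph B p `\` subgraph B q) <=
  F p + b%:E * lebX (subgraph B p `\` subgraph B q).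
Proof.
move=> a0 b0 cab.
set A := subgraph B p `\` subgraph B q.
pose Q := subgraph B q `\` subgraph B p.
have mA : measurable (A : set (borel X)) by exact: measurableD.
have mQ : measurable (Q : set (borel X)) by exact: measurableD.
have muA : mu_pac cB p A = lebX A.
  rewrite -[LHS]/(lebX (A `&` subgraph B p)) setIidl//.
  by move=> x [].
have AQ : lebX Q = lebX A by rewrite /Q /A subgraphD_sym.
have Afin : lebX A \is a fin_num by rewrite -muA fin_num_measure.
have [A0|A0] := eqVneq (lebX A) 0.
  have FE : F q = F p; last by rewrite A0 FE; apply: leeD2l; rewrite !mule0.
  apply: transport_functional_ext => U mU.
  rewrite -[LHS]/(lebX (U `&` subgraph B q)) -[RHS]/(lebX (U `&` subgraph B p)).
  have null (V W : Pac B) : lebX (subgraph B V `\` subgraph B W) = 0 ->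
      lebX (U `&` subgraph B V) <= lebX (U `&` subgraph B W).
    move=> VW0.
    apply: (@le_trans _ _ (lebX ((U `&` subgraph B W) `|` (subgraph B V `\` subgraph B W)))).
      rewrite le_measure ?inE//.
      - exact: measurableI.
      - by apply: measurableU; [exact: measurableI|exact: measurableD].
      - move=> x [Ux Vx]; have [Wx|Wx] := pselect (subgraph B W x); first by left.
        by right.
    rewrite measureU0//; first exact: measurableI.
    exact: measurableD.
  have Q0 : lebX Q = 0 by rewrite AQ.
  by apply/eqP; rewrite eq_le; apply/andP; split; [exact: null Q0|exact: null A0].
have A00 : (0 < fine (lebX A))%R by rewrite fine_gt0// lt0e A0/= measure_ge0 ltey_eq Afin.
have k0 : (0 <= (fine (lebX A))^-1)%R by rewrite invr_ge0 ltW.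
pose u : {measure set (borel X) -> \bar R} := mscale (NngNum k0) (mrestr lebX mQ).
have uE V : u V = ((fine (lebX A))^-1)%:E * lebX (V `&` Q) by [].
have u1 : u setT = 1.
  by rewrite uE setTI AQ -(fineK Afin) -EFinM mulVf// gt_eqF.
have uQ : prob_of u1 Q = 1.
  by rewrite -u1 -[LHS]/(u Q) !uE setTI setIid.
rewrite -muA; apply: (Tc_resample dD1 dD2 cylinder_closed cY c_ge0 mc nu mA (mS p) mQ _ uQ _ _ _ a0 b0).
- rewrite -[LHS]/(lebX (subgraph B p `&` subgraph B p)) setIid.
  exact: subgraph_measure1.
- by move=> x [].
- by move=> x [[]].
- move=> V mV; rewrite muA -[LHS]/(lebX (V `&` subgraph B q)).
  rewrite -[X in _ = X + _]/(lebX ((V `\` A) `&` subgraph B p)).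
  rewrite -[prob_of u1 V]/(u V) uE muleA -{1}(fineK Afin) -EFinM divff ?gt_eqF// mul1e.
  have -> : V `&` subgraph B q = ((V `\` A) `&` subgraph B p) `|` (V `&` Q).
    apply/seteqP; split => x.
      move=> [Vx qx]; have [px|px] := pselect (subgraph B p x).
        by left; split; [split; [exact: Vx|move=> [_]; exact]|exact: px].
      by right; split; [exact: Vx|split].
    move=> [[[Vx Ax] px]|[Vx [qx _]]]; last by split.
    split; first exact: Vx.
    by apply: contrapT => qx; apply: Ax.
  apply: measureU.
  + by apply: measurableI => //; exact: measurableD.
  + exact: measurableI.
  + by apply/seteqP; split => // x [[_ px] [_ [_ /(_ px)]]].
- by move=> x x' y _ Ax Qx' Yy; exact: cab.
Qed.

End cylinder_transport.

(** * Regularity of minimisers *)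
Lemma no_gain (R : realType) (x x1 x2 : \bar R) (k a : R) : x \is a fin_num ->
  x1 = x -> (x <= x2)%E -> (x2 + k%:E * a%:E <= x1 + 0%:E * a%:E)%E -> k * a <= 0.
Proof.
move=> + -> xx2; rewrite mul0e adde0 => xfin /(le_trans (leeD2r _ xx2)).
by rewrite -(fineK xfin) -EFinM -EFinD lee_fin gerDl.
Qed.

Section one_swap.
Context {R : realType} {n : nat} {T : normedModType R}.
Local Notation leb := (@lebesgue_rV R n).
Local Notation lebX := (@lebesgue_rVR R n).
Local Notation X := ('rV[R]_n * R)%type.
Variables (D1 : nat -> X) (D2 : nat -> T).
Hypotheses (dD1 : dense_seq D1) (dD2 : dense_seq D2).
Variables (B : set 'rV[R]_n) (cB : compact B) (Y : set T) (cY : closed Y).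
Hypothesis Y0 : Y !=set0.
Context (c : X -> T -> R).
Hypothesis c_ge0 : forall x y, cylinder B x -> Y y -> 0 <= c x y.
Hypothesis mc : measurable_fun [set: borel (X * T)%type] (cost_ext (cylinder B) Y c).
Hypothesis c_incr : forall s y, B s -> Y y ->
  forall p p' : R, 0 <= p -> p < p' -> c (s, p) y < c (s, p') y.
Variable nu : prob_on R Y.
Local Notation F := (transport_functional c cB nu).

Let mB := compact_borel cB.

Lemma cost_le s y r r' : B s -> Y y -> 0 <= r -> r <= r' -> c (s, r) y <= c (s, r') y.
Proof.
move=> Bs Yy r0; rewrite le_eqVlt => /predU1P[->//|rr'].
by apply/ltW/c_incr.
Qed.

Lemma leb_fin (E : set (borel 'rV[R]_n)) : measurable E -> E `<=` B ->
  leb E \is a fin_num.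
Proof.
move=> mE EB; rewrite ge0_fin_numE//.
apply: le_lt_trans (lebesgue_rV_compact cB).
by rewrite le_measure ?inE.
Qed.

Lemma Pac_pos_part (p : Pac B) : exists p' : Pac B,
  density p' = (fun s => Num.max 0 (p s)) /\
  forall U, measurable U -> mu_pac cB p' U = mu_pac cB p U.
Proof.
have mp := density_measurable p.
have [|||p' p'E p'U] := @Pac_ae _ _ _ cB p (fun s => Num.max 0 (p s)).
- by apply: measurable_maxr => //; exact: measurable_cst.
- by move=> s _; rewrite le_max lexx.
- have aeF := ae_filter_ringOfSetsType leb.
  apply: (@filterS _ _ aeF) (density_ge0 p) => s ps Bs.
  by rewrite max_r// ps.
by exists p'.
Qed.

(** Let E be the set where p >= b + t and G the set where p <= a - t.  If both
    have positive measure, lower p by th on E and raise it by be on G, with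
    th, be <= t chosen to preserve the total mass.  The mass removed is above
    height b, the mass added is below height a, so the functional
    drops. *)
Lemma minimiser_swap (p : Pac B) (V : set (borel 'rV[R]_n)) (a b t k : R) :
  measurable V ->
  is_minimiser F p -> F p \is a fin_num ->
  0 < t -> t <= a -> 0 <= b -> 0 < k ->
  (forall s s' y, B s -> V s -> B s' -> V s' -> Y y ->
    c (s', a) y + k <= c (s, b) y) ->
  leb [set s | (B s /\ V s) /\ b + t <= p s] = 0%E \/
  leb [set s | (B s /\ V s) /\ p s <= a - t] = 0%E.
Proof.
move=> mV minp Fp t0 ta b0 k0 cab.
have [p1 [p1E p1U]] := Pac_pos_part p.
have p1ge0 s : 0 <= p1 s by rewrite p1E le_max lexx.
set E := [set s | _]; set G := (X in _ \/ leb X = _).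
have [y Yy] := Y0.
have mp1 := density_measurable p1.
have EE : E = V `&` (B `&` [set s | b + t <= p1 s]).
  apply/seteqP; split => s; rewrite /E/= p1E.
    by move=> [[Bs Vs] h]; split => //; split => //=; rewrite le_max h orbT.
  move=> [Vs [Bs /=]]; rewrite le_max => /orP[h|//].
  by exfalso; move: h b0 t0; lra.
have GE : G = V `&` (B `&` [set s | p1 s <= a - t]).
  apply/seteqP; split => s; rewrite /G/= p1E.
    by move=> [[Bs Vs] h]; split => //; split => //=; rewrite ge_max h subr_ge0 ta.
  by move=> [Vs [Bs /=]]; rewrite ge_max => /andP[].
have mE : measurable (E : set (borel 'rV[R]_n)).
  by rewrite EE; apply: measurableI => //; apply: measurable_fun_le => //; exact: measurable_cst.
have mG : measurable (G : set (borel 'rV[R]_n)).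
  by rewrite GE; apply: measurableI => //; apply: measurable_fun_le => //; exact: measurable_cst.
have EB : E `<=` B by move=> s [[]].
have GB : G `<=` B by move=> s [[]].
have [E0|E0] := eqVneq (leb E) 0%E; first by left.
have [G0|G0] := eqVneq (leb G) 0%E; first by right.
exfalso.
have Efin := leb_fin mE EB; have Gfin := leb_fin mG GB.
pose e := fine (leb E); pose g := fine (leb G).
have e0 : 0 < e by rewrite fine_gt0// lt0e E0/= measure_ge0 ltey_eq Efin.
have g0 : 0 < g by rewrite fine_gt0// lt0e G0/= measure_ge0 ltey_eq Gfin.
have eg0 : 0 < e + g by rewrite addr_gt0.
pose th := t * g / (e + g); pose be := t * e / (e + g).
have th0 : 0 < th by rewrite divr_gt0// mulr_gt0.
have be0 : 0 < be by rewrite divr_gt0// mulr_gt0.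
have tht : th <= t by rewrite ler_pdivrMr// ler_pM2l// lerDr ltW.
have bet : be <= t by rewrite ler_pdivrMr// ler_pM2l// lerDl ltW.
have thebe : th * e = be * g by rewrite /th /be; field; rewrite gt_eqF.
have EG s : E s -> G s -> False.
  move=> [[Bs Vs] h1] [_ h2]; have bt := le_trans h1 h2.
  have := cab s s y Bs Vs Bs Vs Yy; apply/negP; rewrite -ltNge.
  apply: (@le_lt_trans _ _ (c (s, a) y)); last by rewrite ltrDl.
  by apply: cost_le => //; move: bt t0; lra.
pose q s := p1 s - th * \1_E s + be * \1_G s.
have qge s : 0 <= p1 s - th * \1_E s.
  rewrite indicE; case: (boolP (s \in E)) => [|_]; last by rewrite mulr0 subr0.
  rewrite EE => /set_mem[_ [_ /=]]; rewrite mulr1; move: b0 tht; lra.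
have q0 s : 0 <= q s by rewrite addr_ge0// mulr_ge0// ltW.
have mq : measurable_fun (B : set (borel 'rV[R]_n)) q.
  apply: measurable_funD; last by apply: measurable_funM => //; exact: measurable_indic.
  apply: measurable_funB => //.
  by apply: measurable_funM => //; exact: measurable_indic.
have intI (W : set (borel 'rV[R]_n)) (r : R) : measurable W -> W `<=` B -> 0 <= r ->
    (\int[leb]_(s in B) (r * \1_W s)%:E = r%:E * leb W)%E.
  move=> mW WB r0; under eq_integral do rewrite EFinM.
  rewrite ge0_integralZl//; last by apply/measurable_EFinP; exact: measurable_indic.
  by rewrite integral_indic// setIidl.
have mrI (W : set (borel 'rV[R]_n)) (r : R) : measurable W ->
    measurable_fun (B : set (borel 'rV[R]_n)) (fun s => (r * \1_W s)%:E).
  by move=> mW; apply/measurable_EFinP; apply: measurable_funM => //; exact: measurable_indic.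
have rI0 (W : set 'rV[R]_n) (r : R) s : 0 <= r -> (0 <= (r * \1_W s)%:E)%E.
  by move=> r0; rewrite lee_fin mulr_ge0.
have q1 : (\int[leb]_(s in B) (q s)%:E = 1)%E.
  have h : (\int[leb]_(s in B) (q s)%:E + th%:E * leb E = 1 + be%:E * leb G)%E.
    rewrite -(intI E)// ?ltW// -(intI G)// ?ltW// -(density1 p1).
    rewrite -!ge0_integralD//; first last.
    - exact: mrI.
    - by move=> s _; apply: rI0; exact: ltW.
    - exact/measurable_EFinP.
    - by move=> s _; rewrite lee_fin.
    - exact: mrI.
    - by move=> s _; apply: rI0; exact: ltW.
    - exact/measurable_EFinP.
    - by move=> s _; rewrite lee_fin.
    apply: eq_integral => s _; rewrite -!EFinD; congr EFin.
    by rewrite /q addrAC subrK.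
  have thE : (th%:E * leb E = (th * e)%:E)%E by rewrite (EFinM th e) [e%:E]fineK.
  have beG : (be%:E * leb G = (th * e)%:E)%E by rewrite thebe (EFinM be g) [g%:E]fineK.
  by move: h; rewrite thE beG => /(congr1 (fun x => x - (th * e)%:E)%E); rewrite !addeK.
have [p2 p2E] := Pac_of mq (fun s _ => q0 s) q1.
have move_up : (F p2 + k%:E * lebX (subgraph B p1 `\` subgraph B p2) <=
    F p1 + 0%:E * lebX (subgraph B p1 `\` subgraph B p2))%E.
  apply: (Tc_move dD1 dD2 cB cY c_ge0 mc nu) => //; first exact: ltW.
  move=> [s r] [s' r'] z [[[/= Bs r0] /= rp1] rp2] [[[/= Bs' r'0] /= rp2'] rp1'] Yz.
  have {}rp2 : q s < r.
    by rewrite ltNge; apply/negP => h; apply: rp2; split => //=; rewrite p2E.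
  have {}rp1' : p1 s' < r'.
    by rewrite ltNge; apply/negP => h; apply: rp1'; split.
  rewrite p2E in rp2'.
  have Es : E s.
    apply: contrapT => Es; have := lt_le_trans rp2 rp1.
    have -> : q s = p1 s + be * \1_G s by rewrite /q [\1_E s]indicE memNset// mulr0 subr0.
    by rewrite ltNge lerDl mulr_ge0// ltW.
  have Gs' : G s'.
    apply: contrapT => Gs'; have := lt_le_trans rp1' rp2'.
    have -> : q s' = p1 s' - th * \1_E s' by rewrite /q [\1_G s']indicE memNset// mulr0 addr0.
    by rewrite ltNge gerBl mulr_ge0// ltW.
  have qs : q s = p1 s - th.
    rewrite /q !indicE mem_set// memNset ?mulr0 ?mulr1 ?addr0//.
    by move=> /(EG _ Es).
  have qs' : q s' = p1 s' + be.
    rewrite /q !indicE [s' \in G]mem_set// memNset ?mulr0 ?mulr1 ?subr0//.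
    by move=> /EG/(_ Gs').
  have br : b <= r.
    move: Es rp2; rewrite qs EE => -[_ [_ /=]] h1 h2; move: h1 h2 tht; lra.
  have ra : r' <= a.
    move: Gs' rp2'; rewrite qs' GE => -[_ [_ /=]] h1 h2; move: h1 h2 bet; lra.
  rewrite addr0; apply: (le_trans _ (cost_le Bs Yz b0 br)).
  have [[_ Vs] _] := Es; have [[_ Vs'] _] := Gs'.
  apply: le_trans (cab s s' z Bs Vs Bs' Vs' Yz).
  by rewrite lerD2r; exact: cost_le.
have tau : lebX (subgraph B p1 `\` subgraph B p2) = (th * e)%:E.
  rewrite subgraphD_measure//; last by move=> s _; rewrite p2E.
  transitivity (th%:E * leb E)%E; last by rewrite (EFinM th e) [e%:E]fineK.
  rewrite -(intI E th)//; last exact: ltW.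
  apply: eq_integral => s _.
  congr EFin; rewrite p2E /q.
  case: (boolP (s \in E)) => [/set_mem|/negP] Es.
    rewrite !indicE mem_set// memNset; last exact: EG.
    by rewrite mulr0 addr0 mulr1 opprB addrC subrK max_r// ltW.
  rewrite [\1_E s]indicE memNset; last by move=> h; apply: Es; exact: mem_set.
  rewrite mulr0 subr0 opprD addrA subrr add0r max_l// oppr_le0.
  by apply: mulr_ge0 => //; exact: ltW.
have p1F : F p1 = F p by exact: transport_functional_ext.
rewrite tau in move_up; have := no_gain Fp p1F (minp p2) move_up.
rewrite leNgt => /negP; apply.
exact: (mulr_gt0 k0 (mulr_gt0 th0 e0)).
Qed.

End one_swap.

(** Index sets such as triples of naturals and rationals occur below, hence
    the countType. *)
Lemma null_countable_bigcup d (T : measurableType d) (R : realType) (I : countType)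
    (mu : {measure set T -> \bar R}) (F : I -> set T) :
  (forall i, measurable (F i)) -> (forall i, mu (F i) = 0%E) ->
  mu (\bigcup_i F i) = 0%E.
Proof.
move=> mF F0.
pose G (k : nat) := if unpickle k is Some i then F i else set0.
have -> : \bigcup_i F i = \bigcup_k G k.
  apply/seteqP; split => [x [i _ Fx]|x [k _]].
    by exists (pickle i) => //; rewrite /G pickleK.
  by rewrite /G; case: (unpickle k) => // i; exists i.
have mG k : measurable (G k) by rewrite /G; case: unpickle.
apply/negligibleP; first exact: bigcupT_measurable.
apply: negligible_bigcup => k; apply/negligibleP => //.
by rewrite /G; case: unpickle.
Qed.

Section bounded_cost.
Context {R : realType} {T1 T2 : normedModType R}.
Variables (D1 : nat -> T1) (D2 : nat -> T2).
Hypotheses (dD1 : dense_seq D1) (dD2 : dense_seq D2).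
Context (A1 : set T1) (A2 : set T2) (c : T1 -> T2 -> R).
Hypotheses (cA1 : closed A1) (cA2 : closed A2).
Hypothesis c_ge0 : forall x y, A1 x -> A2 y -> 0 <= c x y.
Hypothesis mc : measurable_fun [set: borel (T1 * T2)%type] (cost_ext A1 A2 c).

(** The product measure is a coupling. *)
Lemma Tc_le_bound (mu : prob_on R A1) (nu : prob_on R A2) (S : set (borel T1))
    (C : R) : measurable S -> mu S = 1%E -> S `<=` A1 -> 0 <= C ->
  (forall x y, S x -> A2 y -> c x y <= C) -> (Tc c mu nu <= C%:E)%E.
Proof.
move=> mS muS SA1 C0 hC.
pose Z := (borel T1 * borel T2)%type.
pose rho : probability Z R := (mu \x nu)%E.
have rhoE P Q : measurable P -> measurable Q -> (rho (P `*` Q) = mu P * nu Q)%E.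
  by move=> mP mQ; exact: product_measure1E.
have h1 (U : set (borel T1)) : measurable U -> rho (fst @^-1` U) = mu U.
  move=> mU; have -> : fst @^-1` U = U `*` setT :> set Z.
    by apply/seteqP; split => z //= [].
  by rewrite rhoE ?probability_setT ?mule1.
have h2 (V : set (borel T2)) : measurable V -> rho (snd @^-1` V) = nu V.
  move=> mV; have -> : snd @^-1` V = setT `*` V :> set Z.
    by apply/seteqP; split => z //= [].
  by rewrite rhoE ?probability_setT ?mul1e.
have := Tc_le_law dD1 dD2 cA1 cA2 c_ge0 mc measurable_fst measurable_snd h1 h2.
move/le_trans; apply.
have -> : C%:E = (\int[rho]_z (cst C%:E z))%E.
  rewrite integral_cst//; transitivity (C%:E * 1)%E; first by rewrite mule1.
  by congr (_ * _)%E; apply/esym; exact: probability_setT.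
have mA2 : measurable (A2 : set (borel T2)) by exact: closed_borel.
apply: ae_ge0_le_integral => //.
- by move=> z _; exact: cost_ext_ge0.
- apply: (measurableT_comp mc); apply: (measurable_pair_borel dD1 dD2).
    exact: measurable_fst.
  exact: measurable_snd.
have mSC : measurable (fst @^-1` (~` S) : set Z).
  by rewrite -[X in measurable X]setTI; apply: measurable_fst => //; exact: measurableC.
have mAC : measurable (snd @^-1` (~` A2) : set Z).
  by rewrite -[X in measurable X]setTI; apply: measurable_snd => //; exact: measurableC.
have z1 : rho (fst @^-1` (~` S)) = 0%E.
  by rewrite h1 ?probability_setC ?muS ?subee//; exact: measurableC.
have z2 : rho (snd @^-1` (~` A2)) = 0%E.
  by rewrite h2 ?probability_setC ?prob_on1 ?subee//; exact: measurableC.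
exists ((fst @^-1` (~` S)) `|` (snd @^-1` (~` A2))); split.
- exact: measurableU.
- by rewrite -z1; exact: (measureU0 mSC mAC z2).
move=> [x y] H; apply: contrapT => notN; apply: H => _.
have Sx : S x by apply: contrapT => h; apply: notN; left.
have Ay : A2 y by apply: contrapT => h; apply: notN; right.
by rewrite /= cost_extE// ?lee_fin; [exact: hC|exact: SA1].
Qed.

End bounded_cost.

Section regularity.
Context {R : realType} {n : nat} {T : normedModType R}.
Local Notation leb := (@lebesgue_rV R n).
Local Notation lebX := (@lebesgue_rVR R n).
Local Notation X := ('rV[R]_n * R)%type.
Variables (D1 : nat -> X) (D2 : nat -> T) (D3 : nat -> 'rV[R]_n).
Hypotheses (dD1 : dense_seq D1) (dD2 : dense_seq D2) (dD3 : dense_seq D3).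
Variables (B : set 'rV[R]_n) (cB : compact B) (Y : set T) (kY : compact Y).
Hypothesis B0 : (0 < leb B)%E.
Hypotheses (Y0 : Y !=set0) (cY : closed Y).
Context (c : X -> T -> R).
Hypothesis c_ge0 : forall x y, cylinder B x -> Y y -> 0 <= c x y.
Hypothesis mc : measurable_fun [set: borel (X * T)%type] (cost_ext (cylinder B) Y c).
Hypothesis c_cont : forall (z : X * T) e, (cylinder B `*` Y) z -> 0 < e ->
  \forall w \near z, (cylinder B `*` Y) w -> `|c w.1 w.2 - c z.1 z.2| < e.
Hypothesis c_incr : forall s y, B s -> Y y ->
  forall p p' : R, 0 <= p -> p < p' -> c (s, p) y < c (s, p') y.
Hypothesis c_unbounded : forall s y, B s -> Y y ->
  forall M : R, exists2 p : R, 0 <= p & M < c (s, p) y.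
Local Notation F nu := (transport_functional c cB nu).

Let mB := compact_borel cB.
Let lebB_fin : leb B \is a fin_num.
Proof. by rewrite ge0_fin_numE// lebesgue_rV_compact. Qed.
Let b := fine (leb B).
Let b0 : 0 < b.
Proof. by rewrite /b fine_gt0// B0 lebesgue_rV_compact. Qed.

Lemma transport_functional_ge0 (nu : prob_on R Y) (p : Pac B) : (0 <= F nu p)%E.
Proof. exact: (Tc_ge0 c_ge0). Qed.

Lemma transport_functional_bounded (nu : prob_on R Y) (p : Pac B) (M C : R) : 0 <= C ->
  (forall s, B s -> p s <= M) ->
  (forall s r y, B s -> 0 <= r <= M -> Y y -> c (s, r) y <= C) ->
  F nu p \is a fin_num.
Proof.
move=> C0 pM hC.
rewrite ge0_fin_numE ?transport_functional_ge0//.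
apply: (@le_lt_trans _ _ C%:E); last by rewrite ltry.
have mS : measurable (subgraph B p : set (borel X)).
  by apply: subgraph_borel => //; exact: density_measurable.
apply: (Tc_le_bound dD1 dD2 _ cY c_ge0 mc _ (S := subgraph B p)) => //.
- exact: cylinder_closed.
- rewrite -[LHS]/(lebX (subgraph B p `&` subgraph B p)) setIid.
  exact: subgraph_measure1.
- by move=> x [].
- move=> [s r] y [[/= Bs r0] /= rp] Yy; apply: hC => //.
  by rewrite r0 (le_trans rp)// pM.
Qed.

(** The uniform density has finite cost. *)
Lemma minimiser_fin_num (nu : prob_on R Y) (p : Pac B) : is_minimiser (F nu) p ->
  F nu p \is a fin_num.
Proof.
move=> minp; rewrite ge0_fin_numE ?transport_functional_ge0//.
have bV0 : 0 <= b^-1 by rewrite invr_ge0 ltW.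
have [|||q qE] := @Pac_of _ _ B (fun=> b^-1).
- exact: measurable_cst.
- by [].
- by rewrite integral_cst// -(fineK lebB_fin) -EFinM mulVf// gt_eqF.
have [C C0 hC] := cost_bounded cB kY c_cont b^-1.
apply: le_lt_trans (minp q) _.
have : F nu q \is a fin_num.
  by apply: (@transport_functional_bounded nu q b^-1 C) => // s _; rewrite qE.
by rewrite ge0_fin_numE// transport_functional_ge0.
Qed.

(** Swap between heights a1 and M, where M is so large that the cost above it
    exceeds every cost at height a1.  The set where p <= 2 / b cannot be null,
    b being the measure of B: it would force the integral of p to be at least
    2. *)
Lemma minimiser_bounded : exists2 M, 0 <= M &
  forall (nu : prob_on R Y) (p : Pac B), is_minimiser (F nu) p ->
    leb [set s | B s /\ M <= p s] = 0%E.
Proof.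
pose a1 := 2 / b + 1.
have b20 : 0 <= 2 / b by rewrite divr_ge0// ltW.
have [C C0 hC] := cost_bounded cB kY c_cont a1.
have [M M0 hM] := cost_coercive cB kY c_cont c_incr c_unbounded (C + 1).
exists (M + 1) => [|nu p minp]; first by rewrite addr_ge0.
have Fp := minimiser_fin_num minp.
have swap : leb [set s | (B s /\ [set: 'rV[R]_n] s) /\ M + 1 <= p s] = 0%E \/
    leb [set s | (B s /\ [set: 'rV[R]_n] s) /\ p s <= a1 - 1] = 0%E.
  apply: (@minimiser_swap _ _ _ _ _ dD1 dD2 _ cB _ cY Y0 _ c_ge0 mc c_incr nu p
    setT a1 M 1 1) => //.
    by rewrite /a1 lerDr.
  move=> s s' y Bs _ Bs' _ Yy; apply: (@le_trans _ _ (C + 1)); last exact: hM.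
  by rewrite lerD2r; apply: hC => //; rewrite lexx andbT addr_ge0.
case: swap.
  by move=> <-; congr (leb _); apply/seteqP; split => s [] // [].
rewrite /a1 addrK => G0; exfalso.
have [p1 [p1E p1U]] := Pac_pos_part cB p.
have mp := density_measurable p.
have mp1 := density_measurable p1.
have mG : measurable ([set s | (B s /\ [set: 'rV[R]_n] s) /\ p s <= 2 / b] : set (borel 'rV[R]_n)).
  rewrite (_ : mkset _ = B `&` [set s | p s <= 2 / b]).
    by apply: measurable_fun_le => //; exact: measurable_cst.
  by apply/seteqP; split => s /=; [move=> [[]]|move=> []].
have : (\int[leb]_(s in B) (cst (2 / b)%:E s) <= \int[leb]_(s in B) (p1 s)%:E)%E.
  apply: ae_ge0_le_integral => //.
  - by move=> s _; rewrite p1E lee_fin le_max lexx.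
  - exact/measurable_EFinP.
  exists [set s | (B s /\ [set: 'rV[R]_n] s) /\ p s <= 2 / b]; split => // s /= H.
  have [Bs|Bs] := pselect (B s); last by exfalso; apply: H.
  split => //; rewrite leNgt; apply/negP => h; apply: H => _.
  by rewrite p1E lee_fin le_max (ltW h) orbT.
rewrite density1 integral_cst// -(fineK lebB_fin) -EFinM divfK ?gt_eqF// lee_fin.
by rewrite leNgt ltr1n.
Qed.

(** For base points close enough to each other, the increase of the cost between
    heights l + t and l + 3 t dominates its variation with the base point, so
    minimiser_swap applies on each small ball: p cannot be both at least
    l + 4 t and at most l on sets of positive measure.  Letting the ball run
    over a dense sequence and l over the rationals leaves countably many null
    sets to discard. *)
Lemma minimiser_regular : exists (M : R) (del : nat -> R),
  [/\ 0 <= M, forall k, 0 < del k &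
  forall (nu : prob_on R Y) (p : Pac B), is_minimiser (F nu) p ->
    exists D : set (borel 'rV[R]_n), [/\ D `<=` B, measurable D,
      leb (B `\` D) = 0%E, forall s, D s -> 0 <= p s <= M &
      forall k s s', D s -> D s' -> ball s (del k) s' ->
        p s <= p s' + k.+1%:R^-1]].
Proof.
have [M M0 hM] := minimiser_bounded.
have modulus (k : nat) : exists kd : R * R, [/\ 0 < kd.1, 0 < kd.2 &
    forall s s' l y, B s -> B s' -> ball s kd.2 s' -> Y y -> 0 <= l <= M ->
    c (s', l + k.+1%:R^-1 / 4) y + kd.1 <= c (s, l + 3 * (k.+1%:R^-1 / 4)) y].
  pose t : R := k.+1%:R^-1 / 4.
  have t0 : 0 < t by rewrite divr_gt0// invr_gt0.
  have [kap kap0 hk] := cost_increment cB kY c_cont c_incr (M + t) t0.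
  have kap2 : 0 < kap / 2 by rewrite divr_gt0.
  have [de de0 hde] := cost_unif_continuous cB kY c_cont (M + t) kap2.
  exists (kap / 2, de); split => //= s s' l y Bs Bs' ss' Yy /andP[l0 lM].
  rewrite -/t.
  have lt0 : 0 <= l + t <= M + t by rewrite addr_ge0 ?lerD2r// ltW.
  have h1 := hde (s, l + t, y) (s', l + t, y).
  have {}h1 : c (s', l + t) y <= c (s, l + t) y + kap / 2.
    apply: h1; [by split => //; split => //=; rewrite in_itv|by split => //; split => //=; rewrite in_itv|].
    by split => //=; [split => //=; exact: ballxx|exact: ballxx].
  have h2 := hk s (l + t) y Bs lt0 Yy (l + 3 * t).
  have {}h2 : c (s, l + t) y + kap <= c (s, l + 3 * t) y by apply: h2; lra.
  by move: h1 h2; lra.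
have [kd hkd] := choice modulus.
exists M, (fun k => (kd k).2 / 4); split => // [k|nu p minp].
  by have [_ h _] := hkd k; rewrite divr_gt0.
have Fp := minimiser_fin_num minp.
have mp := density_measurable p.
pose V k i : set (borel 'rV[R]_n) := ball (D3 i) ((kd k).2 / 2).
have mV k i : measurable (V k i) by apply: open_borel; exact: ball_open.
pose E k i (l : R) := [set s | (B s /\ V k i s) /\ l + k.+1%:R^-1 <= p s].
pose G k i (l : R) := [set s | (B s /\ V k i s) /\ p s <= l].
have mE k i l : measurable (E k i l : set (borel 'rV[R]_n)).
  rewrite (_ : E k i l = V k i `&` (B `&` [set s | l + k.+1%:R^-1 <= p s])).
    by apply: measurableI => //; apply: measurable_fun_le => //; exact: measurable_cst.
  by apply/seteqP; split => s; [move=> [[]]|move=> [? []]].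
have mG k i l : measurable (G k i l : set (borel 'rV[R]_n)).
  rewrite (_ : G k i l = V k i `&` (B `&` [set s | p s <= l])).
    by apply: measurableI => //; apply: measurable_fun_le => //; exact: measurable_cst.
  by apply/seteqP; split => s; [move=> [[]]|move=> [? []]].
have EG k i (l : R) : 0 <= l <= M -> leb (E k i l) = 0%E \/ leb (G k i l) = 0%E.
  move=> l0M; have [kd1 kd2 hk] := hkd k.
  pose t : R := k.+1%:R^-1 / 4.
  have t0 : 0 < t by rewrite divr_gt0// invr_gt0.
  have l0 : 0 <= l by case/andP: l0M.
  have := @minimiser_swap _ _ _ _ _ dD1 dD2 _ cB _ cY Y0 _ c_ge0 mc c_incr nu p
    (V k i) (l + t) (l + 3 * t) t (kd k).1 (mV k i) minp Fp t0 _ _ kd1.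
  rewrite addrK (_ : l + 3 * t + t = l + k.+1%:R^-1); last by rewrite /t; field.
  apply; [by rewrite lerDr|by apply: addr_ge0 => //; move: t0; lra|].
  move=> s s' y Bs Vs Bs' Vs' Yy; apply: hk => //.
  rewrite [(kd k).2]splitr; apply: ball_triangle Vs'; exact: ball_sym.
(* Whichever of the two sets is null. *)
pose N (j : nat * nat * rat) : set (borel 'rV[R]_n) :=
  let k := j.1.1 in let i := j.1.2 in let l : R := ratr j.2 in
  if `[< leb (E k i l) = 0%E >] then E k i l
  else if `[< leb (G k i l) = 0%E >] then G k i l else set0.
have mN j : measurable (N j).
  by rewrite /N; case: asboolP => _ //; case: asboolP => _.
have N0 j : leb (N j) = 0%E.
  rewrite /N; case: asboolP => // _; case: asboolP => // _.
pose BM := [set s | B s /\ M <= p s].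
have mBM : measurable (BM : set (borel 'rV[R]_n)).
  by apply: measurable_fun_le => //; exact: measurable_cst.
pose Bn := [set s | B s /\ p s < 0].
have mBn : measurable (Bn : set (borel 'rV[R]_n)).
  rewrite (_ : Bn = B `\` (B `&` [set s | 0 <= p s])).
    by apply: measurableD => //; apply: measurable_fun_le => //; exact: measurable_cst.
  apply/seteqP; split => s [Bs] /= h; split => //; last first.
    by rewrite ltNge; apply/negP => h'; apply: h.
  by move=> [_]; rewrite leNgt h.
have Bn0 : leb Bn = 0%E.
  have [A [mA A0 hA]] := density_ge0 p.
  apply/eqP; rewrite eq_le measure_ge0 andbT -A0 le_measure ?inE//.
  move=> s [Bs ps]; apply: hA => /= /(_ Bs); apply/negP; by rewrite -ltNge.
pose NN : set (borel 'rV[R]_n) := (\bigcup_j N j) `|` BM `|` Bn.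
have mbN : measurable (\bigcup_j N j).
  apply: countable_bigcupT_measurable => //; exact: countableP.
have mNN : measurable NN by apply: measurableU => //; exact: measurableU.
have NN0 : leb NN = 0%E.
  have bN0 : leb (\bigcup_j N j) = 0%E.
    exact: null_countable_bigcup.
  have h : leb (\bigcup_j N j `|` BM) = 0%E.
    by rewrite measureU0//; exact: hM minp.
  rewrite /NN measureU0//; exact: measurableU.
exists (B `\` NN); split.
- by move=> s [].
- exact: measurableD.
- apply/eqP; rewrite eq_le measure_ge0 andbT -NN0 le_measure ?inE//.
    by apply: measurableD => //; exact: measurableD.
  by move=> s [Bs h]; apply: contrapT => Ns; apply: h.
- move=> s [Bs Ns]; apply/andP; split; rewrite leNgt; apply/negP => h; apply: Ns.
    by right.
  by left; right; split => //; exact: ltW.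
move=> k s s' [Bs Ns] [Bs' Ns'] ss'.
rewrite leNgt; apply/negP => h.
have ps0 : 0 <= p s'.
  by rewrite leNgt; apply/negP => h'; apply: Ns'; right.
have psM : p s <= M.
  by rewrite leNgt; apply/negP => h'; apply: Ns; left; right; split => //; exact: ltW.
have h2 : p s' < p s - k.+1%:R^-1 by rewrite ltrBrDr.
have [l] := rat_in_itvoo h2; rewrite in_itv/= => /andP[l1 l2].
have [_ kd2 _] := hkd k.
have kd4 : 0 < (kd k).2 / 4 by rewrite divr_gt0.
have [i si] := dD3 s kd4.
have Vs : V k i s.
  apply: ball_sym; apply: le_ball si; move: kd2; lra.
have Vs' : V k i s'.
  rewrite /V (_ : (kd k).2 / 2 = (kd k).2 / 4 + (kd k).2 / 4); last by field.
  by apply: ball_triangle ss'; exact: ball_sym.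
have Es : E k i (ratr l) s by split => //; rewrite -lerBrDr ltW.
have Gs' : G k i (ratr l) s' by split => //; exact: ltW.
have lM : 0 <= (ratr l : R) <= M.
  rewrite (le_trans ps0 (ltW l1)) (le_trans (ltW l2))//.
  by rewrite (le_trans _ psM)// gerBl invr_ge0.
have [E0|G0] := EG k i _ lM.
  by apply: Ns; left; left; exists (k, i, l) => //; rewrite /N/=; case: asboolP.
have [E0|E0] := pselect (leb (E k i (ratr l)) = 0%E).
  by apply: Ns; left; left; exists (k, i, l) => //; rewrite /N/=; case: asboolP.
apply: Ns'; left; left; exists (k, i, l) => //; rewrite /N/=.
by case: asboolP => // _; case: asboolP.
Qed.

End regularity.

(** * Strict convexity at the midpoint of two densities *)
Section fold_line.
Context {R : realType}.
Local Notation lam := (@lebesgue_measure R).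

Lemma lebesgue_measure_shift (d : R) (A : set (measurableTypeR R)) : measurable A ->
  lam ((fun r => r - d) @^-1` A) = lam A.
Proof.
move=> mA.
have ms : measurable_fun [set: measurableTypeR R] (fun r : R => r - d : measurableTypeR R).
  exact: measurable_funB.
transitivity (pushforward lam (fun r => r - d : measurableTypeR R) A) => //.
apply/esym/lebesgue_measure_unique => //= _ [[a b]] _ <-.
rewrite /pushforward.
rewrite (_ : _ @^-1` _ = `]a + d, b + d]%classic); last first.
  by apply/seteqP; split => r /=; rewrite !in_itv/= ltrBrDr lerBlDr.
rewrite !lebesgue_measure_itv/= !lte_fin ltrD2r; case: ifP => // _.
by rewrite -!EFinB; congr EFin; ring.
Qed.

(** Translates the upper half of the interval between a and b onto its lower
    half. *)
Definition fold_down (a b r : R) : R :=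
  if (a + b) / 2 < r then r - (b - a) / 2 else r.

(** Folding sends the two intervals [0, b] and [0, a] onto two copies of
    [0, (a + b) / 2]: the part of [0, b] above the midpoint fills the gap
    between a and the midpoint. *)
Lemma fold_down_measure (a b : R) (V : set (measurableTypeR R)) : 0 <= a -> a <= b -> measurable V ->
  (lam (fold_down a b @^-1` V `&` `[0%R, b]) + lam (fold_down a b @^-1` V `&` `[0%R, a]) =
   lam (V `&` `[0%R, ((a + b) / 2)%R]) + lam (V `&` `[0%R, ((a + b) / 2)%R]))%E.
Proof.
move=> a0 ab mV; set h := (a + b) / 2; pose d := (b - a) / 2.
have ah : a <= h by rewrite /h; move: ab; lra.
have hb : h <= b by rewrite /h; move: ab; lra.
have hd : h - d = a by rewrite /h /d; lra.
have bd : b - d = h by rewrite /h /d; lra.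
have mitv i j x y : measurable ([set` Interval (BSide i x) (BSide j y)] : set (measurableTypeR R)).
  exact: measurable_itv.
have -> : fold_down a b @^-1` V `&` `[0, a] = V `&` `[0, a].
  apply/seteqP; split => r /=; rewrite /fold_down -/h in_itv/= => -[Vr /andP[r0 ra]].
    by move: Vr; rewrite ltNge (le_trans ra ah)/= r0 ra.
  by rewrite ltNge (le_trans ra ah)/= r0 ra.
have -> : fold_down a b @^-1` V `&` `[0, b] =
    (V `&` `[0, h]) `|` ((fun r => r - d) @^-1` (V `&` `]a, h])).
  apply/seteqP; split => r /=; rewrite /fold_down -/h -/d !in_itv/=.
    move=> [Vr /andP[r0 rb]]; move: Vr; case: ltP => hr Vr; [right|left].
      by split => //; rewrite -hd ltrBlDr subrK hr -bd lerB.
    by split => //; rewrite r0.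
  move=> [[Vr /andP[r0 rh]]|[Vr /andP[h1 h2]]].
    by rewrite ltNge rh/= r0 (le_trans rh hb).
  have hr : h < r by move: h1; rewrite -hd ltrBlDr subrK.
  by rewrite hr; split => //; rewrite (le_trans a0 (le_trans ah (ltW hr)))/=; move: h2; rewrite -bd lerBlDr subrK.
have mVI i j x y : measurable (V `&` [set` Interval (BSide i x) (BSide j y)]).
  by apply: measurableI => //; exact: mitv.
have ms : measurable ((fun r => r - d) @^-1` (V `&` `]a, h]) : set (measurableTypeR R)).
  rewrite -[X in measurable X]setTI.
  by apply: (@measurable_funB _ (measurableTypeR R) R setT (fun r => r) (cst d)) => //; exact: mVI.
have -> : lam ((V `&` `[0, h]) `|` ((fun r => r - d) @^-1` (V `&` `]a, h]))) =
    (lam (V `&` `[0%R, h]) + lam ((fun r => (r - d)%R) @^-1` (V `&` `]a, h])))%E.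
  apply: measureU; [exact: mVI|exact: ms|].
  apply/seteqP; split => r //= [[_]]; rewrite !in_itv/= => /andP[_ rh] [_ /andP[ar _]].
  by move: ar; rewrite -hd ltrBlDr subrK ltNge rh.
rewrite lebesgue_measure_shift; last exact: mVI.
rewrite -addeA; congr (_ + _)%E.
have <- : lam ((V `&` `]a, h]) `|` (V `&` `[0, a])) =
    (lam (V `&` `]a, h]) + lam (V `&` `[0%R, a]))%E.
  apply: measureU; [exact: mVI|exact: mVI|].
  apply/seteqP; split => r //= [[_]]; rewrite in_itv/= => /andP[ar _] [_].
  by rewrite in_itv/= => /andP[_]; rewrite leNgt ar.
congr (lam _); rewrite -setIUr; congr (_ `&` _).
apply/seteqP; split => r /=; rewrite !in_itv/=.
  move=> [/andP[ar rh]|/andP[r0 ra]]; first by rewrite rh andbT (le_trans a0)// ltW.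
  by rewrite r0 (le_trans ra).
move=> /andP[r0 rh]; case: (leP r a) => ra; [right|left]; first by rewrite r0.
by rewrite rh.
Qed.

End fold_line.

Lemma le_addey (R : realType) (x y : \bar R) : x \is a fin_num -> (y <= x + +oo)%E.
Proof. by case: x => // r _; rewrite addey// leey. Qed.

Section midpoint.
Context {R : realType} {n : nat} {T : normedModType R}.
Local Notation leb := (@lebesgue_rV R n).
Local Notation lebX := (@lebesgue_rVR R n).
Local Notation X := ('rV[R]_n * R)%type.
Variables (D1 : nat -> X) (D2 : nat -> T).
Hypotheses (dD1 : dense_seq D1) (dD2 : dense_seq D2).
Variables (B : set 'rV[R]_n) (cB : compact B) (Y : set T) (cY : closed Y).
Context (c : X -> T -> R).
Hypothesis c_ge0 : forall x y, cylinder B x -> Y y -> 0 <= c x y.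
Hypothesis mc : measurable_fun [set: borel (X * T)%type] (cost_ext (cylinder B) Y c).
Let mB := compact_borel cB.

Section two_densities.
Variables (p0 p1 : Pac B) (M : R).
Hypothesis p0M : forall s, B s -> 0 <= p0 s <= M.
Hypothesis p1M : forall s, B s -> 0 <= p1 s <= M.

Let h s := (p0 s + p1 s) / 2.
Let mp0 := density_measurable p0.
Let mp1 := density_measurable p1.

Let lo s := Num.min (p0 s) (p1 s).
Let hi s := Num.max (p0 s) (p1 s).

Let lohi s : lo s + hi s = p0 s + p1 s.
Proof. by rewrite /lo /hi addr_min_max. Qed.

Let mh : measurable_fun (B : set (borel 'rV[R]_n)) h.
Proof. by apply: measurable_funM => //; exact: measurable_funD. Qed.

Lemma midpoint_Pac : exists p : Pac B, density p = h.
Proof.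
apply: Pac_of => //.
- by move=> s Bs; rewrite divr_ge0// addr_ge0//; [case/andP: (p0M Bs)|case/andP: (p1M Bs)].
transitivity (\int[leb]_(s in B) (2^-1%:E * ((p0 s)%:E + (p1 s)%:E)))%E.
  by apply: eq_integral => s _; rewrite -EFinD -EFinM mulrC.
rewrite ge0_integralZl//; last 2 first.
- by apply: emeasurable_funD; exact/measurable_EFinP.
- move=> s Bs; rewrite -EFinD lee_fin addr_ge0//.
    by case/andP: (p0M Bs).
  by case/andP: (p1M Bs).
rewrite ge0_integralD//.
- by rewrite !density1 -EFinD -EFinM mulVf.
- by move=> s Bs; rewrite lee_fin; case/andP: (p0M Bs).
- exact/measurable_EFinP.
- by move=> s Bs; rewrite lee_fin; case/andP: (p1M Bs).
- exact/measurable_EFinP.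
Qed.

Variables (p : Pac B) (pE : density p = h).

(* The folding between the two densities, on each vertical line over B. *)
Let fold (x : X) : X := (x.1, if x.1 \in B then fold_down (lo x.1) (hi x.1) x.2 else x.2).

Let mhB : measurable_fun [set: borel 'rV[R]_n] (h \_ B).
Proof. exact/(measurable_restrictT _ mB). Qed.
Let md : measurable_fun [set: borel 'rV[R]_n] ((fun s => (hi s - lo s) / 2) \_ B).
Proof.
apply/(measurable_restrictT _ mB); apply: measurable_funM => //.
by apply: measurable_funB; [exact: measurable_maxr|exact: measurable_minr].
Qed.

Let m1 : measurable_fun [set: borel X] (fst : _ -> borel 'rV[R]_n).
Proof. by apply: (@continuous_borel _ _ fst) => z; exact: cvg_fst. Qed.
Let m2 : measurable_fun [set: borel X] (snd : X -> R).
Proof. by apply: (@continuous_borelR _ _ snd) => z; exact: cvg_snd. Qed.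

Let foldE (x : X) : fold x = (x.1, if (h \_ B) x.1 < x.2 then
    x.2 - ((fun s => (hi s - lo s) / 2) \_ B) x.1 else x.2).
Proof.
rewrite /fold !patchE; case: ifPn => Bx; last by rewrite subr0 if_same.
by rewrite /fold_down lohi.
Qed.

Let mfold : measurable_fun [set: borel X] (fold : _ -> borel X).
Proof.
rewrite (funext foldE).
have mf2 : measurable_fun [set: borel X] (fun x : X => if (h \_ B) x.1 < x.2 then
    x.2 - ((fun s => (hi s - lo s) / 2) \_ B) x.1 else x.2 : measurableTypeR R).
  apply: measurable_fun_ifT => //.
    apply: measurable_fun_ltr => //.
    exact: (measurableT_comp mhB m1).
  apply: measurable_funB => //.
  exact: (measurableT_comp md m1).
have mpair : measurable_fun [set: borel X] (fun x : X => (x.1, if (h \_ B) x.1 < x.2 then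
    x.2 - ((fun s => (hi s - lo s) / 2) \_ B) x.1 else x.2)
    : (borel 'rV[R]_n * measurableTypeR R)%type).
  by apply: measurable_fun_pair; [exact: m1|exact: mf2].
exact: (measurableT_comp (@measurable_fun_rVR R n) mpair).
Qed.

Let mS (q : Pac B) : measurable (subgraph B q : set (borel X)).
Proof. by apply: subgraph_borel => //; exact: density_measurable. Qed.

Let mxs (V : set (borel X)) : measurable V ->
  measurable_fun setT (fun s : borel 'rV[R]_n => lebesgue_measure (xsection V s)).
Proof.
move=> mV.
apply: (@measurable_fun_xsection _ _ (borel 'rV[R]_n) (measurableTypeR R) R lebesgue_measure V).
by rewrite -[X in measurable X]setTI; apply: (@measurable_fun_rVR R n).
Qed.

Let mxsec (V : set (borel X)) s : measurable V ->
  measurable (xsection V s : set (measurableTypeR R)).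
Proof.
move=> mV; apply: (@measurable_xsection _ _ (borel 'rV[R]_n) (measurableTypeR R)).
by rewrite -[X in measurable X]setTI; apply: (@measurable_fun_rVR R n).
Qed.

Let xsec_fold (q : Pac B) (U : set (borel X)) s : B s ->
  xsection (fold @^-1` U `&` subgraph B q) s =
  fold_down (lo s) (hi s) @^-1` (xsection U s) `&` `[0, q s].
Proof.
move=> Bs; apply/seteqP; split => r.
  rewrite /xsection/= in_itv/= !inE /fold/= mem_set//.
  by move=> [Ur [[/= _ r0] /= rq]]; split => //; rewrite r0.
rewrite /xsection/= in_itv/= !inE /fold/= mem_set//.
by move=> -[Ur /andP[r0 rq]].
Qed.

Let xsec_notB (q : Pac B) (U : set (borel X)) s : ~ B s ->
  xsection (U `&` subgraph B q) s = set0.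
Proof.
by move=> Bs; apply/seteqP; split => // r; rewrite /xsection/= inE => -[_ [[/= /Bs]]].
Qed.

Let xsec_sub (q : Pac B) (U : set (borel X)) s : B s ->
  xsection (U `&` subgraph B q) s = xsection U s `&` `[0, q s].
Proof.
move=> Bs; apply/seteqP; split => r; rewrite /xsection/= in_itv/= !inE.
  by move=> [Ur [[/= _ r0] /= rq]]; split => //; rewrite r0.
by move=> -[Ur /andP[r0 rq]].
Qed.

Let fold_measure (U : set (borel X)) : measurable U ->
  (lebX (fold @^-1` U `&` subgraph B p0) + lebX (fold @^-1` U `&` subgraph B p1) =
   lebX (U `&` subgraph B p) + lebX (U `&` subgraph B p))%E.
Proof.
move=> mU.
have mfU : measurable (fold @^-1` U : set (borel X)).
  by rewrite -[X in measurable X]setTI; exact: mfold.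
rewrite !lebesgue_rVRE -!ge0_integralD//; try by apply: mxs; exact: measurableI.
apply: eq_integral => s _.
have [Bs|Bs] := pselect (B s); last by rewrite !xsec_notB// !measure0.
have lo0 : 0 <= lo s.
  by rewrite le_min; case/andP: (p0M Bs) => -> _; case/andP: (p1M Bs) => -> _.
have lh : lo s <= hi s by rewrite ge_min le_max lexx.
have := fold_down_measure lo0 lh (mxsec s mU).
rewrite lohi -/(h s) !xsec_fold// xsec_sub// pE => <-.
rewrite /lo /hi; case: (leP (p0 s) (p1 s)) => h01; last by [].
by rewrite addeC.
Qed.

Variable nu : prob_on R Y.
Local Notation F := (transport_functional c cB nu).
Variables (eta kap : R).
Hypothesis kap0 : 0 <= kap.
Hypothesis hkap : forall s r y, B s -> 0 <= r <= M -> Y y ->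
    forall r', r + eta <= r' -> c (s, r) y + kap <= c (s, r') y.
Hypothesis c_le : forall s y r r', B s -> Y y -> 0 <= r -> r <= r' -> c (s, r) y <= c (s, r') y.

Let gap := [set s | B s /\ 2 * eta <= `|p0 s - p1 s|].
(* Points that are moved down by at least eta. *)
Let W : set (borel X) := [set x | gap x.1 /\ (h \_ B) x.1 < x.2].

Let mgap : measurable (gap : set (borel 'rV[R]_n)).
Proof.
apply: measurable_fun_le => //.
by apply: measurableT_comp => //; exact: measurable_funB.
Qed.

Let mW : measurable W.
Proof.
have -> : W = fst @^-1` gap `&` [set x | (h \_ B) x.1 < x.2] by [].
apply: measurableI.
  by rewrite -[X in measurable X]setTI; exact: m1.
have := @measurable_fun_ltr _ (borel X) R setT (fun x : X => (h \_ B) x.1) snd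
  (measurableT_comp mhB m1) m2.
move=> /(_ measurableT [set true]); rewrite setTI; apply => //.
Qed.

Let W_measure : (lebX (W `&` subgraph B p0) + lebX (W `&` subgraph B p1) =
  \int[leb]_(s in gap) (`|p0 s - p1 s| / 2)%:E)%E.
Proof.
rewrite !lebesgue_rVRE -ge0_integralD//; try by apply: mxs; exact: measurableI.
rewrite [RHS]integral_mkcond; apply: eq_integral => s _; rewrite patchE.
case: ifPn => [/set_mem|/negP] sg; last first.
  have W0 q : xsection (W `&` subgraph B q) s = set0.
    apply/seteqP; split => // r; rewrite /xsection/= inE => -[[/= sg' _] _].
    by apply: sg; exact: mem_set.
  by rewrite !W0 !measure0 adde0.
have Bs : B s by case: sg.
have hs0 : 0 <= h s.
  by rewrite divr_ge0// addr_ge0//; [case/andP: (p0M Bs)|case/andP: (p1M Bs)].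
have WE (q : Pac B) : xsection (W `&` subgraph B q) s = `]h s, q s]%classic.
  apply/seteqP; split => r; rewrite /xsection/= in_itv/= !inE.
    by move=> [[/= _ hr] [_ /= rq]]; move: hr; rewrite patchE mem_set// => ->.
  move=> /andP[hr rq]; split; first by split => //=; rewrite patchE mem_set.
  by split => //; split => //=; rewrite (le_trans hs0)// ltW.
rewrite !WE !lebesgue_measure_itv/= !lte_fin /h.
have [h01|h01|h01] := ltgtP (p0 s) (p1 s).
- rewrite [X in (if X then _ else _)%E](_ : _ = false); last by apply/negbTE; rewrite -leNgt; lra.
  rewrite [X in (if X then _ else _)%E](_ : _ = true); last by lra.
  by rewrite add0e -EFinB ltr0_norm ?subr_lt0//; congr EFin; field.
- rewrite [X in (if X then _ else _)%E](_ : _ = true); last by lra.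
  rewrite [X in (if X then _ else _)%E](_ : _ = false); last by apply/negbTE; rewrite -leNgt; lra.
  by rewrite adde0 -EFinB gtr0_norm ?subr_gt0//; congr EFin; field.
- by rewrite h01 (_ : (p1 s + p1 s) / 2 = p1 s) ?ltxx ?subrr ?normr0 ?mul0r ?adde0//; field.
Qed.

Local Open Scope ereal_scope.

Let cost_drop (q : Pac B) (qM : forall s, B s -> (0 <= q s <= M)%R) g : couplings (mu_pac cB q) nu g ->
  \int[g]_z cost_ext (cylinder B) Y c (fold z.1, z.2) + kap%:E * lebX (W `&` subgraph B q)
    <= transport_cost c g.
Proof.
move=> gmn; have [g1 g2] := gmn.
pose XT := borel (X * T)%type.
have mfst' : measurable_fun [set: XT] (fst : _ -> borel X).
  by apply: (@continuous_borel _ _ fst) => z; exact: cvg_fst.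
have msnd' : measurable_fun [set: XT] (snd : _ -> borel T).
  by apply: (@continuous_borel _ _ snd) => z; exact: cvg_snd.
have mW' : measurable (fst @^-1` W : set XT).
  by rewrite -[X in measurable X]setTI; exact: mfst'.
have -> : kap%:E * lebX (W `&` subgraph B q) =
    \int[g]_z (kap * \1_(fst @^-1` W : set XT) z)%:E.
  under eq_integral do rewrite EFinM.
  rewrite ge0_integralZl//; last by apply/measurable_EFinP; exact: measurable_indic.
  rewrite integral_indic// setIT; congr (_ * _)%E.
  by rewrite -[LHS]/(mu_pac cB q W) -g1.
have mcf : measurable_fun [set: XT] (fun z : XT => cost_ext (cylinder B) Y c (fold z.1, z.2)).
  apply: (measurableT_comp mc); apply: (measurable_pair_borel dD1 dD2) => //.
  exact: (measurableT_comp mfold mfst').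
have mk : measurable_fun [set: XT] (fun z : XT => (kap * \1_(fst @^-1` W : set XT) z)%:E).
  by apply/measurable_EFinP; apply: measurable_funM => //; exact: measurable_indic.
rewrite -ge0_integralD//; last 2 first.
- by move=> z _; exact: cost_ext_ge0.
- by move=> z _; rewrite lee_fin mulr_ge0.
rewrite transport_costE; apply: ae_ge0_le_integral => //.
- by move=> z _; apply: adde_ge0; [exact: cost_ext_ge0|rewrite lee_fin mulr_ge0].
- exact: emeasurable_funD.
- by move=> z _; exact: cost_ext_ge0.
have muS : mu_pac cB q (subgraph B q) = 1.
  rewrite -[LHS]/(lebX (subgraph B q `&` subgraph B q)) setIid.
  exact: subgraph_measure1.
have mYT : measurable (Y : set (borel T)) by exact: closed_borel.
have mE1 : measurable (fst @^-1` (~` subgraph B q) : set XT).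
  by rewrite -[X in measurable X]setTI; apply: mfst' => //; exact: measurableC.
have mE2 : measurable (snd @^-1` (~` Y) : set XT).
  by rewrite -[X in measurable X]setTI; apply: msnd' => //; exact: measurableC.
have z1 : g (fst @^-1` (~` subgraph B q)) = 0.
  rewrite g1; last exact: measurableC.
  by rewrite probability_setC// muS subee.
have z2 : g (snd @^-1` (~` Y)) = 0.
  rewrite g2; last exact: measurableC.
  by rewrite probability_setC// prob_on1 subee.
exists ((fst @^-1` (~` subgraph B q)) `|` (snd @^-1` (~` Y))); split.
- exact: measurableU.
- by rewrite -z1; exact: (measureU0 mE1 mE2 z2).
move=> [[s r] y] H; apply: contrapT => notN; apply: H => _.
have [[/= Bs r0] /= rq] : subgraph B q (s, r) by apply: contrapT => h'; apply: notN; left.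
have Yy : Y y by apply: contrapT => h'; apply: notN; right.
have /andP[p00 p0M'] := p0M Bs; have /andP[p10 p1M'] := p1M Bs.
have /andP[q0 qM'] := qM s Bs.
rewrite /= foldE/= !patchE mem_set//.
have dE : ((hi s - lo s) / 2 = `|p0 s - p1 s| / 2)%R.
  by rewrite /hi /lo; case: (leP (p0 s) (p1 s)) => h01;
    [rewrite ler0_norm ?subr_le0// opprB|rewrite gtr0_norm ?subr_gt0].
have dh : ((hi s - lo s) / 2 <= h s)%R.
  rewrite /h ler_pM2r//; rewrite /hi /lo; case: (leP (p0 s) (p1 s)) => h01; lra.
have d0 : (0 <= (hi s - lo s) / 2)%R by rewrite dE divr_ge0.
rewrite indicE; case: (ltP (h s) r) => hr.
  have rd0 : (0 <= r - (hi s - lo s) / 2)%R by rewrite subr_ge0 (le_trans dh)// ltW.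
  rewrite !cost_extE//.
  rewrite -EFinD lee_fin; case: (boolP (_ \in fst @^-1` W)) => [/set_mem[/= [_ hgap] _]|_].
    rewrite mulr1; apply: hkap => //.
      by rewrite rd0 (le_trans _ qM')// (le_trans _ rq)// gerBl.
    by rewrite -addrA gerDl addrC subr_le0 dE; move: hgap; lra.
  by rewrite mulr0 addr0; apply: c_le => //; rewrite gerBl.
rewrite (_ : (_ \in fst @^-1` W) = false) ?mulr0 ?adde0//.
apply/negbTE/negP => /set_mem[/= _]; rewrite patchE mem_set// ltNge hr//.
Qed.

(** Given plans g0 and g1 for p0 and p1, the average of g0 and g1, with its
    source points folded, is a plan for the mean density p.  Folding never
    raises a point, and on W it lowers the cost by kap. *)
Lemma midpoint_le : F p0 \is a fin_num -> F p1 \is a fin_num ->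
  F p + F p + kap%:E * \int[leb]_(s in gap) (`|p0 s - p1 s| / 2)%:E <= F p0 + F p1.
Proof.
move=> F0 F1.
pose XT := borel (X * T)%type.
have mfst' : measurable_fun [set: XT] (fst : _ -> borel X).
  by apply: (@continuous_borel _ _ fst) => z; exact: cvg_fst.
have msnd' : measurable_fun [set: XT] (snd : _ -> borel T).
  by apply: (@continuous_borel _ _ snd) => z; exact: cvg_snd.
have mff : measurable_fun [set: XT] (fun z : XT => fold z.1 : borel X).
  exact: (measurableT_comp mfold mfst').
pose phi (z : XT) := cost_ext (cylinder B) Y c (fold z.1, z.2).
have mphi : measurable_fun [set: XT] phi.
  by apply: (measurableT_comp mc); apply: (measurable_pair_borel dD1 dD2).
have phi0 z : 0 <= phi z by exact: cost_ext_ge0.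
set I := \int[leb]_(s in gap) _.
have half_twice (x : \bar R) : 0 <= x -> (2^-1)%:E * (x + x) = x.
  case: x => [r| |]//= _; last by rewrite mulry gtr0_sg ?mul1e.
  by rewrite -EFinD -EFinM; congr EFin; field.
have half2 (x : \bar R) : 0 <= x -> (2^-1)%:E * x + (2^-1)%:E * x = x.
  move=> x0; rewrite -[RHS](half_twice x)//.
  by rewrite ge0_muleDr.
have key g0 g1 : couplings (mu_pac cB p0) nu g0 -> couplings (mu_pac cB p1) nu g1 ->
    F p + F p + kap%:E * I <= transport_cost c g0 + transport_cost c g1.
  move=> c0 c1; have [c01 c02] := c0; have [c11 c12] := c1.
  have V0 : (0 <= 2^-1 :> R)%R by rewrite invr_ge0.
  pose rho : {measure set XT -> \bar R} := mscale (NngNum V0) (measure_add g0 g1).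
  have rhoE V : rho V = (2^-1)%:E * (g0 V + g1 V).
    by rewrite -[LHS]/((2^-1)%:E * measure_add g0 g1 V) measure_addE.
  have rho1 (U : set (borel X)) : measurable U -> rho ((fun z : XT => fold z.1) @^-1` U) = mu_pac cB p U.
    move=> mU.
    have mfU : measurable (fold @^-1` U : set (borel X)).
      by rewrite -[X in measurable X]setTI; exact: mfold.
    rewrite rhoE -[(fun z : XT => fold z.1) @^-1` U]/(fst @^-1` (fold @^-1` U)).
    rewrite c01// c11//.
    rewrite -[X in _ * (X + _)]/(lebX (fold @^-1` U `&` subgraph B p0)).
    rewrite -[X in _ * (_ + X)]/(lebX (fold @^-1` U `&` subgraph B p1)).
    by rewrite fold_measure// half_twice.
  have rho2 (V : set (borel T)) : measurable V -> rho (snd @^-1` V) = nu V.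
    by move=> mV; rewrite rhoE c02// c12// half_twice.
  have h1 := Tc_le_law dD1 dD2 (cylinder_closed cB) cY c_ge0 mc mff msnd' rho1 rho2.
  have intE : \int[rho]_z phi z = (2^-1)%:E * (\int[g0]_z phi z + \int[g1]_z phi z).
    rewrite ge0_integral_mscale//; congr (_ * _).
    by rewrite ge0_integral_measure_add.
  have h2 : F p + F p <= \int[g0]_z phi z + \int[g1]_z phi z.
    have S0 : 0 <= \int[g0]_z phi z + \int[g1]_z phi z.
      by apply: adde_ge0; apply: integral_ge0.
    by rewrite -[leRHS](half2 _ S0) -intE; apply: leeD.
  rewrite /I -W_measure ge0_muleDr//.
  apply: (le_trans (leeD h2 (lexx _))).
  rewrite addeACA; apply: leeD; exact: cost_drop.
have Fp0E := esym (fineK F0).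
(* The infima over g0 and over g1 are taken one after the other. *)
have step g1 : couplings (mu_pac cB p1) nu g1 ->
    F p + F p + kap%:E * I <= F p0 + transport_cost c g1.
  move=> c1.
  have [c1fin|] := boolP (transport_cost c g1 \is a fin_num).
    rewrite -(fineK c1fin) {3}/transport_functional.
    by apply: le_Tc => g0 c0; rewrite fineK//; exact: key.
  rewrite ge0_fin_numE; last first.
    by rewrite transport_costE; apply: integral_ge0 => z _; exact: cost_ext_ge0.
  rewrite -leNgt leye_eq => /eqP ->.
  exact: le_addey F0.
rewrite [leRHS]addeC Fp0E {3}/transport_functional.
by apply: le_Tc => g1 c1; rewrite -Fp0E [leRHS]addeC; exact: step.
Qed.

End two_densities.
End midpoint.

(** * Stability of minimisers in L^1 *)
Lemma gain_le (R : realType) (u v w x : \bar R) (a : R) :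
  u \is a fin_num -> v \is a fin_num -> w \is a fin_num ->
  (w + w + x <= u + v -> v <= u + a%:E -> u <= w -> x <= a%:E)%E.
Proof.
case: u => // u _; case: v => // v _; case: w => // w _; case: x => [x| |] //; last by move=> _ _ _; exact: leNye.
by rewrite -!EFinD !lee_fin; lra.
Qed.

Section stability.
Context {R : realType} {n : nat} {T : normedModType R}.
Local Notation leb := (@lebesgue_rV R n).
Local Notation lebX := (@lebesgue_rVR R n).
Local Notation X := ('rV[R]_n * R)%type.
Variables (D1 : nat -> X) (D2 : nat -> T).
Hypotheses (dD1 : dense_seq D1) (dD2 : dense_seq D2).
Variables (B : set 'rV[R]_n) (cB : compact B) (Y : set T) (kY : compact Y).
Hypothesis B0 : (0 < leb B)%E.
Hypotheses (cY : closed Y).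
Context (c : X -> T -> R).
Hypothesis c_ge0 : forall x y, cylinder B x -> Y y -> 0 <= c x y.
Hypothesis mc : measurable_fun [set: borel (X * T)%type] (cost_ext (cylinder B) Y c).
Hypothesis c_cont : forall (z : X * T) e, (cylinder B `*` Y) z -> 0 < e ->
  \forall w \near z, (cylinder B `*` Y) w -> `|c w.1 w.2 - c z.1 z.2| < e.
Hypothesis c_incr : forall s y, B s -> Y y ->
  forall p p' : R, 0 <= p -> p < p' -> c (s, p) y < c (s, p') y.
Local Notation F nu := (transport_functional c cB nu).

Let mB := compact_borel cB.
Let lebB_fin : leb B \is a fin_num.
Proof. by rewrite ge0_fin_numE// lebesgue_rV_compact. Qed.
Let b := fine (leb B).
Let b0 : 0 < b.
Proof. by rewrite /b fine_gt0// B0 lebesgue_rV_compact. Qed.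

Lemma Pac_clip (p : Pac B) (M : R) : 0 <= M -> leb [set s | B s /\ M < p s] = 0%E ->
  exists p' : Pac B, [/\ density p' = (fun s => Num.max 0 (Num.min M (p s))),
    forall s, B s -> 0 <= p' s <= M &
    forall U, measurable U -> mu_pac cB p' U = mu_pac cB p U].
Proof.
move=> M0 pM; have mp := density_measurable p.
have mN : measurable ([set s | B s /\ M < p s] : set (borel 'rV[R]_n)).
  rewrite (_ : mkset _ = B `\` (B `&` [set s | p s <= M])).
    by apply: measurableD => //; apply: measurable_fun_le => //; exact: measurable_cst.
  apply/seteqP; split => s [Bs] /= h; split => //.
    by move=> [_]; rewrite leNgt h.
  by rewrite ltNge; apply/negP => h'; apply: h.
have [|||p' p'E p'U] := @Pac_ae _ _ _ cB p (fun s => Num.max 0 (Num.min M (p s))).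
- apply: measurable_maxr; first exact: measurable_cst.
  by apply: measurable_minr => //; exact: measurable_cst.
- by move=> s _; rewrite le_max lexx.
- have aeF := ae_filter_ringOfSetsType leb.
  have aeM : {ae leb, forall s, B s -> p s <= M}.
    exists [set s | B s /\ M < p s]; split => // s /= H.
    have [Bs|Bs] := pselect (B s); last by exfalso; apply: H.
    by split => //; rewrite ltNge; apply/negP => h; apply: H.
  apply: (@filterS2 _ _ aeF _ _ _ _ (density_ge0 p) aeM) => s ps psM Bs.
  by rewrite (min_idPr (psM Bs)) (max_idPr (ps Bs)).
exists p'; split => // s _; rewrite p'E le_max lexx/= ge_max M0/=.
by rewrite ge_min lexx.
Qed.

(** Here p minimises F nu and q nearly does, while their mean does no better
    than p, so midpoint_le bounds the part of the L^1 distance coming from the set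
    where p and q differ by at least 2 eta; elsewhere they differ by less than
    2 eta.  The constants eta and eps make each part at most th / 2. *)
Lemma L1_stability (M th : R) : 0 <= M -> 0 < th -> exists2 eps, 0 < eps &
  forall (nu nu' : prob_on R Y) (p q : Pac B),
    (forall s, B s -> 0 <= p s <= M) -> (forall s, B s -> 0 <= q s <= M) ->
    is_minimiser (F nu) p -> is_minimiser (F nu') q ->
    (F nu q <= F nu' q + eps%:E)%E -> (F nu' p <= F nu p + eps%:E)%E ->
    (\int[leb]_(s in B) `|p s - q s|%:E <= th%:E)%E.
Proof.
move=> M0 th0.
have b10 : 0 < b + 1 by rewrite addr_gt0.
pose eta := th / 4 / (b + 1).
have eta0 : 0 < eta by rewrite !divr_gt0.
have [kap kap0 hkap] := cost_increment cB kY c_cont c_incr M eta0.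
pose eps := kap * th / 8.
have eps0 : 0 < eps by rewrite divr_gt0// mulr_gt0.
exists eps => // nu nu' p q pM qM minp minq h1 h2.
have [C C0 hC] := cost_bounded cB kY c_cont M.
have pfin : F nu p \is a fin_num.
  apply: (@transport_functional_bounded _ _ _ _ _ dD1 dD2 _ cB _ cY _ c_ge0 mc nu p M C) => //.
  by move=> s /pM/andP[].
have qfin : F nu q \is a fin_num.
  apply: (@transport_functional_bounded _ _ _ _ _ dD1 dD2 _ cB _ cY _ c_ge0 mc nu q M C) => //.
  by move=> s /qM/andP[].
have [m mE] := midpoint_Pac cB pM qM.
have cle s y r r' : B s -> Y y -> 0 <= r -> r <= r' -> c (s, r) y <= c (s, r') y.
  exact: (cost_le c_incr).
have := midpoint_le dD1 dD2 cY c_ge0 mc pM qM mE (ltW kap0) hkap cle pfin qfin.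
set gap := [set s | _]; set I := (\int[leb]_(s in gap) _)%E => hm.
have I0 : (0 <= I)%E.
  by apply: integral_ge0 => s _; rewrite lee_fin divr_ge0.
have hI : (kap%:E * I <= (2 * eps)%:E)%E.
  have h3 : (F nu q <= F nu p + (2 * eps)%:E)%E.
    apply: (le_trans h1); rewrite mulr_natl mulr2n EFinD addeA.
    by apply: leeD2r; apply: le_trans (minq p) h2.
  have mfin : F nu m \is a fin_num.
    apply: (@transport_functional_bounded _ _ _ _ _ dD1 dD2 _ cB _ cY _ c_ge0 mc nu m M C) => //.
    by move=> s Bs; rewrite mE; move: (pM s Bs) (qM s Bs) => /andP[_ ?] /andP[_ ?]; lra.
  have kI0 : (0 <= kap%:E * I)%E by rewrite mule_ge0// lee_fin ltW.
  exact: (gain_le pfin qfin mfin hm h3 (minp m)).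
have mp := density_measurable p. have mq := density_measurable q.
have mabs : measurable_fun (B : set (borel 'rV[R]_n)) (fun s => `|p s - q s|).
  by apply: measurableT_comp => //; exact: measurable_funB.
have mgap : measurable (gap : set (borel 'rV[R]_n)).
  exact: measurable_fun_le.
have IE : I = (\int[leb]_(s in B) ((`|p s - q s| / 2) * \1_gap s)%:E)%E.
  rewrite /I [LHS]integral_mkcond [RHS]integral_mkcond; apply: eq_integral => s _.
  rewrite !patchE indicE; case: ifPn => [/set_mem gs|_]; last by rewrite mulr0 if_same.
  by rewrite mulr1 mem_set//; case: gs.
pose phi s : R := (`|p s - q s| / 2) * \1_gap s.
have mphi : measurable_fun (B : set (borel 'rV[R]_n)) (EFin \o phi).
  apply/measurable_EFinP; apply: measurable_funM; last exact: measurable_indic.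
  by apply: measurable_funM => //; exact: measurable_cst.
have phi0 s : 0 <= phi s by rewrite mulr_ge0// divr_ge0.
have step : (\int[leb]_(s in B) `|p s - q s|%:E <= 2%:E * I + (2 * eta)%:E * leb B)%E.
  have I2 : (2%:E * I = \int[leb]_(s in B) (2%:E * (phi s)%:E))%E.
    by rewrite IE ge0_integralZl// => s _; rewrite lee_fin.
  have E2 : ((2 * eta)%:E * leb B = \int[leb]_(s in B) (2 * eta)%:E)%E.
    by rewrite integral_cst.
  have m2phi : measurable_fun (B : set (borel 'rV[R]_n)) (fun s => (2%:E * (phi s)%:E)%E).
    by apply: emeasurable_funM => //; exact: measurable_cst.
  have phi20 s : B s -> (0 <= 2%:E * (phi s)%:E)%E.
    by move=> _; rewrite -EFinM lee_fin mulr_ge0.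
  have eta20 s : B s -> (0 <= (2 * eta)%:E)%E.
    by move=> _; rewrite lee_fin mulr_ge0// ltW.
  have mcst : measurable_fun (B : set (borel 'rV[R]_n)) (fun=> (2 * eta)%:E).
    exact: measurable_cst.
  rewrite I2 E2 -ge0_integralD//.
  apply: ge0_le_integral => //.
  - exact/measurable_EFinP.
  - exact: emeasurable_funD.
  move=> s Bs; rewrite -EFinM -EFinD lee_fin /phi indicE.
  case: (boolP (s \in gap)) => [_|/negP gs].
    by rewrite mulr1 mulrC divfK// lerDl mulr_ge0// ltW.
  rewrite !mulr0 add0r leNgt; apply/negP => h; apply: gs; apply: mem_set.
  by split => //; exact: ltW.
apply: (le_trans step).
have hI2 : (2%:E * I <= (th / 2)%:E)%E.
  have : (I <= (th / 4)%:E)%E.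
    rewrite -(@lee_pmul2l _ kap%:E) ?lte_fin// -EFinM.
    by apply: (le_trans hI); rewrite lee_fin /eps; lra.
  move=> /(@lee_wpmul2l _ 2%:E); rewrite lee_fin -EFinM => /(_ (ler0n _ 2)) h.
  by apply: (le_trans h); rewrite lee_fin; lra.
have hB : ((2 * eta)%:E * leb B <= (th / 2)%:E)%E.
  rewrite -(fineK lebB_fin) -EFinM lee_fin /eta -/b.
  rewrite (_ : 2 * _ * _ = th / 2 * (b / (b + 1))); last by field; rewrite gt_eqF.
  rewrite ler_piMr//; first by rewrite divr_ge0// ltW.
  by rewrite ler_pdivrMr// mul1r lerDl.
by rewrite (_ : th = th / 2 + th / 2) ?EFinD ?leeD//; field.
Qed.

(** Stated for p and q but computed with representatives p' and q' that are
    nonnegative everywhere, for which the vertical sections are intervals. *)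
Lemma subgraph_symdiff (p q : Pac B) (p' q' : Pac B) :
  (forall s, B s -> 0 <= p' s) -> (forall s, B s -> 0 <= q' s) ->
  (forall U, measurable U -> mu_pac cB p' U = mu_pac cB p U) ->
  (forall U, measurable U -> mu_pac cB q' U = mu_pac cB q U) ->
  (\int[lebX]_x (Num.norm ((\1_(subgraph B p) \- \1_(subgraph B q)) x : R))%:E =
   \int[leb]_(s in B) `|p' s - q' s|%:E)%E.
Proof.
move=> p0 q0 p'U q'U.
have mS (r : Pac B) : measurable (subgraph B r : set (borel X)).
  by apply: subgraph_borel => //; exact: density_measurable.
have muE (r : Pac B) (U : set (borel X)) : mu_pac cB r U = lebX (U `&` subgraph B r) by [].
have D (r r' u u' : Pac B) :
    (forall U, measurable U -> mu_pac cB r' U = mu_pac cB r U) ->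
    (forall U, measurable U -> mu_pac cB u' U = mu_pac cB u U) ->
    lebX (subgraph B r `\` subgraph B u) = lebX (subgraph B r' `\` subgraph B u').
  move=> rU uU.
  have sw (V W : Pac B) : lebX (subgraph B V `\` subgraph B W) = mu_pac cB V (~` subgraph B W).
    by rewrite muE setIC.
  rewrite sw -rU; last exact: measurableC.
  rewrite -sw (subgraphD_sym cB) sw -uU; last exact: measurableC.
  by rewrite -sw (subgraphD_sym cB).
have mI (V : set (borel X)) : measurable V ->
    measurable_fun setT (fun x : borel X => (\1_V x : R)%:E).
  by move=> mV; apply/measurable_EFinP; exact: measurable_indic.
transitivity (\int[lebX]_x ((\1_(subgraph B p `\` subgraph B q) x)%:E +
    (\1_(subgraph B q `\` subgraph B p) x)%:E))%E.
  apply: eq_integral => x _; rewrite -EFinD; congr EFin => /=.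
  rewrite !indicE !in_setD.
  case: (x \in subgraph B p) => /=; case: (x \in subgraph B q) => /=.
  - by rewrite subrr normr0 addr0.
  - by rewrite subr0 normr1 addr0.
  - by rewrite sub0r normrN normr1 add0r.
  - by rewrite subrr normr0 addr0.
rewrite ge0_integralD//; [|by apply: mI; exact: measurableD..].
rewrite !integral_indic//; [|exact: measurableD..].
rewrite !setIT (D _ _ _ _ p'U q'U) (D _ _ _ _ q'U p'U) !subgraphD_measure//.
have mp := density_measurable p'. have mq := density_measurable q'.
rewrite -ge0_integralD//.
- apply: eq_integral => s _; rewrite -EFinD; congr EFin.
  have [h|h] := leP (p' s) (q' s).
    by rewrite max_l ?subr_le0// max_r ?subr_ge0// add0r ler0_norm ?subr_le0// opprB.
  by rewrite max_r ?subr_ge0 ?ltW// max_l ?subr_le0 ?ltW// addr0 gtr0_norm ?subr_gt0.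
- by move=> s _; rewrite lee_fin le_max lexx.
- apply/measurable_EFinP; apply: measurable_maxr; first exact: measurable_cst.
  exact: measurable_funB.
- by move=> s _; rewrite lee_fin le_max lexx.
- apply/measurable_EFinP; apply: measurable_maxr; first exact: measurable_cst.
  exact: measurable_funB.
Qed.

End stability.

(** * From L^1 to uniform convergence *)
Section modulus_extension.
Context {R : realType} {T : normedModType R}.
Variables (D : set T) (M : R) (del : nat -> R).
Hypotheses (M0 : 0 <= M) (del0 : forall k, 0 < del k) (D0 : D !=set0).

(** The values of del form the modulus: errors 1 / (k + 1) at scale del k. *)
Definition has_modulus (f : T -> R) :=
  (forall s, D s -> 0 <= f s <= M) /\
  forall k s s', D s -> D s' -> ball s (del k) s' -> f s <= f s' + k.+1%:R^-1.

Let cone (f : T -> R) t k s := f t + k.+1%:R^-1 + M / del k * `|t - s|.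
Let cones f s := [set v | exists t k, D t /\ v = cone f t k s].
Let ext f s := inf (cones f s).

Let slope0 k : 0 <= M / del k. Proof. by rewrite divr_ge0// ltW. Qed.
Let inv0 k : 0 <= k.+1%:R^-1 :> R. Proof. by rewrite invr_ge0. Qed.

Let cones_neq0 f s : cones f s !=set0.
Proof. by have [t Dt] := D0; exists (cone f t 0 s), t, 0%N. Qed.

Let cones_lb f s : has_modulus f -> has_lbound (cones f s).
Proof.
move=> [fM _]; exists 0 => _ [t [k [Dt ->]]].
by have /andP[f0 _] := fM t Dt; rewrite !addr_ge0// mulr_ge0.
Qed.

Let ext_le f t k s : has_modulus f -> D t -> ext f s <= cone f t k s.
Proof. by move=> fm Dt; apply: ge_inf; [exact: cones_lb|exists t, k]. Qed.

Let le_ext f s x : (forall t k, D t -> x <= cone f t k s) -> x <= ext f s.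
Proof.
by move=> h; apply: lb_le_inf => // _ [t [k [Dt ->]]]; exact: h.
Qed.

(** The extension is the lower envelope of the cones
    s |-> f t + 1 / (k + 1) + (M / del k) |t - s|.  Their slopes are such that a
    cone reaches M at distance del k, so on D they all stay above f.  At a new
    point one may always pass to a cone of slope at most M / del k by losing
    1 / (k + 1), which gives continuity.  The envelope is monotone in f and
    commutes with adding constants. *)
Lemma modulus_extension : exists E : (T -> R) -> T -> R,
  [/\ forall f, has_modulus f -> continuous (E f),
      forall f, has_modulus f -> forall s, D s -> E f s = f s &
      forall f g (e : R), has_modulus f -> has_modulus g ->
        (forall s, D s -> f s <= g s + e) -> forall s, E f s <= E g s + e].
Proof.
exists ext; split.
- move=> f fm.
  have osc s s' k : ext f s' <= ext f s + (k.+1%:R^-1 + M / del k * `|s - s'|).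
    rewrite -lerBlDr; apply: le_ext => t j Dt; rewrite lerBlDr.
    have tri : `|t - s'| <= `|t - s| + `|s - s'|.
      by rewrite (_ : t - s' = (t - s) + (s - s')) ?ler_normD// addrA subrK.
    have sk := slope0 k; have sj := slope0 j; have ik := inv0 k; have ij := inv0 j.
    have nt := normr_ge0 (t - s); have ns := normr_ge0 (s - s').
    have [le_slope|/ltW le_slope] := leP (M / del k) (M / del j).
      apply: (le_trans (ext_le k s' fm Dt)); rewrite /cone.
      move: (M / del k) (M / del j) (j.+1%:R^-1) (k.+1%:R^-1) sk sj ik ij le_slope.
      move=> a b u v a0 b0 u0 v0 ab.
      have := ler_wpM2l a0 tri; have := ler_wpM2r nt ab; rewrite mulrDr.
      by lra.
    apply: (le_trans (ext_le j s' fm Dt)); rewrite /cone.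
    move: (M / del k) (M / del j) (j.+1%:R^-1) (k.+1%:R^-1) sk sj ik ij le_slope.
    move=> a b u v a0 b0 u0 v0 ab.
    have := ler_wpM2l b0 tri; have := ler_wpM2r ns ab; rewrite mulrDr.
    by lra.
  move=> s; apply/cvgrPdist_lt.
  suff: forall e : R, 0 < e -> \forall s' \near s, `|ext f s - ext f s'| < e by [].
  move=> e e0; have [N _ NN] := near_infty_natSinv_lt (PosNum (divr_gt0 e0 (ltr0n _ 2))).
  have /= hN := NN N (leqnn N).
  have r0 : 0 < e / 2 / (M / del N + 1) by rewrite divr_gt0 ?divr_gt0// ltr_wpDl.
  near=> s'.
  have hs : `|s - s'| < e / 2 / (M / del N + 1).
    by near: s'; exact: (@cvgr_dist_lt _ _ _ (nbhs s) _ id s).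
  have small : N.+1%:R^-1 + M / del N * `|s - s'| < e.
    have lin (x a u : R) : 0 <= x -> u < e / 2 -> x * (a + 1) < e / 2 -> u + a * x < e.
      by lra.
    by apply: lin hN _ => //; rewrite -ltr_pdivlMr ?ltr_wpDl.
  rewrite ltr_norml ltrBlDl ltrNl opprB ltrBlDl; apply/andP; split.
    by apply: le_lt_trans (osc s s' N) _; rewrite ltrD2l.
  apply: le_lt_trans (osc s' s N) _; rewrite distrC in small.
  by rewrite ltrD2l.
- move=> f fm s Ds; apply/eqP; rewrite eq_le; apply/andP; split.
    apply/ler_addgt0Pr => e e0.
    have [N _ NN] := near_infty_natSinv_lt (PosNum e0).
    have /= hN := NN N (leqnn N).
    apply: (le_trans (ext_le N s fm Ds)).
    by rewrite /cone subrr normr0 mulr0 addr0 lerD2l ltW.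
  apply: le_ext => t k Dt; rewrite /cone; have [fM fmod] := fm.
  have [h|h] := ltP `|s - t| (del k).
    apply: (@le_trans _ _ (f t + k.+1%:R^-1)).
      by apply: fmod => //; rewrite -ball_normE.
    by rewrite lerDl mulr_ge0.
  have /andP[_ fsM] := fM s Ds; have /andP[ft0 _] := fM t Dt.
  apply: (le_trans fsM); apply: (@le_trans _ _ (M / del k * `|t - s|)).
    rewrite distrC -mulrA ler_peMr// mulrC ler_pdivlMr// mul1r.
    done.
  by rewrite lerDr addr_ge0.
- move=> f g e fm gm fg s; rewrite -lerBlDr; apply: le_ext => t k Dt.
  rewrite lerBlDr; apply: (le_trans (ext_le k s fm Dt)).
  have lin (a b u v w : R) : a <= b + w -> a + u + v <= b + u + v + w by lra.
  by apply: lin; exact: fg.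
Unshelve. all: by end_near. Qed.

End modulus_extension.

Lemma uniform_lower_bound (R : realType) (v : nat -> R) N :
  exists2 m, 0 < m & forall i, (i < N)%N -> 0 < v i -> m <= v i.
Proof.
elim: N => [|N [m m0 mP]]; first by exists 1.
have [vN|vN] := ltP 0 (v N).
  exists (Num.min m (v N)); first by rewrite lt_min m0.
  move=> i; rewrite ltnS leq_eqVlt => /predU1P[->|iN] vi; rewrite ge_min ?lexx ?orbT//.
  by rewrite mP.
exists m => // i; rewrite ltnS leq_eqVlt => /predU1P[->|iN]; last exact: mP.
by rewrite ltNge vN.
Qed.

Section uniform_of_L1.
Context {R : realType} {n : nat}.
Local Notation leb := (@lebesgue_rV R n).
Variables (D3 : nat -> 'rV[R]_n) (dD3 : dense_seq D3).
Variables (B : set 'rV[R]_n) (cB : compact B) (M : R) (del : nat -> R).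
Hypothesis del0 : forall k, 0 < del k.
Let mB := compact_borel cB.

(** S is the set of points of B all of whose listed neighbourhoods meet B in
    positive measure.  If p and q differ by more than e at a point s of D, they
    differ by at least 1 / (k + 1) on the trace of D on a ball of the finite net around
    s, and the measure of this trace is bounded below by a constant m. *)
Lemma uniform_of_L1 : exists S : set 'rV[R]_n,
  [/\ S `<=` B, measurable (S : set (borel 'rV[R]_n)), leb (B `\` S) = 0%E &
  forall e, 0 < e -> exists2 th, 0 < th & forall (D : set 'rV[R]_n) (p q : 'rV[R]_n -> R),
    D `<=` S -> measurable (D : set (borel 'rV[R]_n)) -> leb (B `\` D) = 0%E ->
    measurable_fun (B : set (borel 'rV[R]_n)) p ->
    measurable_fun (B : set (borel 'rV[R]_n)) q ->
    has_modulus D M del p -> has_modulus D M del q ->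
    (\int[leb]_(s in B) `|p s - q s|%:E <= th%:E)%E ->
    forall s, D s -> `|p s - q s| <= e].
Proof.
pose O (x : nat * nat) : set 'rV[R]_n := B `&` ball (D3 x.2) (del x.1 / 2).
have mO x : measurable (O x : set (borel 'rV[R]_n)).
  by apply: measurableI => //; apply: open_borel; exact: ball_open.
have Ofin x : (leb (O x) < +oo)%E.
  apply: le_lt_trans (lebesgue_rV_compact cB).
  by apply: le_measure; rewrite ?inE// => s [].
pose Z x : set 'rV[R]_n := if leb (O x) == 0%E then O x else set0.
have mZ x : measurable (Z x : set (borel 'rV[R]_n)) by rewrite /Z; case: ifP.
have Z0 x : leb (Z x) = 0%E by rewrite /Z; case: ifP => [/eqP|].
have mU : measurable (\bigcup_x Z x : set (borel 'rV[R]_n)).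
  by apply: countable_bigcupT_measurable => //; exact: countableP.
exists (B `\` \bigcup_x Z x); split.
- by move=> s [].
- exact: measurableD.
- rewrite setDD; apply/eqP; rewrite -measure_le0.
  have <- : leb (\bigcup_x Z x) = 0%E by exact: null_countable_bigcup.
  by apply: le_measure; rewrite ?inE//; exact: measurableI.
move=> e e0.
have [k _ kk] := near_infty_natSinv_lt (PosNum (divr_gt0 e0 (ltr0n _ 3))).
have {kk} /= hk := kk k (leqnn k).
have k0 : 0 < k.+1%:R^-1 :> R by rewrite invr_gt0.
have dk2 : 0 < del k / 2 by rewrite divr_gt0.
have [N hN] := compact_finite_net dD3 cB dk2.
have [m m0 mP] := uniform_lower_bound (fun i => fine (leb (O (k, i)))) N.
exists (k.+1%:R^-1 * m / 2); first by rewrite divr_gt0// mulr_gt0.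
move=> D p q DS mD BD0 mp mq [pM pmod] [qM qmod] hI s Ds.
have [Bs ZS] := DS s Ds.
have [i iN si] := hN s Bs.
have Oi0 : 0 < fine (leb (O (k, i))).
  rewrite fine_gt0// Ofin andbT lt0e measure_ge0 andbT.
  apply/negP => /eqP h; apply: ZS; exists (k, i) => //.
  by rewrite /Z h eqxx; split.
have mi := mP i iN Oi0.
rewrite leNgt; apply/negP => hgap.
have low s' : (O (k, i) `&` D) s' -> k.+1%:R^-1 <= `|p s' - q s'|.
  move=> [[Bs' s'i] Ds'].
  have ss' : ball s (del k) s'.
    by rewrite [del k]splitr; apply: ball_triangle s'i; exact: ball_sym.
  have s's := ball_sym ss'.
  have h1 := pmod k s s' Ds Ds' ss'; have h2 := pmod k s' s Ds' Ds s's.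
  have h3 := qmod k s s' Ds Ds' ss'; have h4 := qmod k s' s Ds' Ds s's.
  move: hgap hk h1 h2 h3 h4; move: (p s) (p s') (q s) (q s') (k.+1%:R^-1 : R).
  move=> a a' b b' u hgap hk h1 h2 h3 h4.
  have [ab|ab] := leP b a.
    have := ler_norm (a' - b'); move: hgap; rewrite ger0_norm ?subr_ge0//; lra.
  have := lerNnormlW (lexx `|a' - b'|); move: hgap; rewrite ltr0_norm ?subr_lt0//; lra.
have mOD : measurable (O (k, i) `&` D : set (borel 'rV[R]_n)) by exact: measurableI.
have mabs : measurable_fun (B : set (borel 'rV[R]_n)) (fun s => `|p s - q s|%:E).
  apply/measurable_EFinP; apply: measurableT_comp => //; exact: measurable_funB.
have ODB : O (k, i) `&` D `<=` B by move=> x [[]].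
have I1 : ((k.+1%:R^-1)%:E * leb (O (k, i) `&` D) <= \int[leb]_(s in B) `|p s - q s|%:E)%E.
  rewrite -integral_cst//.
  have h : (\int[leb]_(s in O (k, i) `&` D) `|p s - q s|%:E <=
      \int[leb]_(s in B) `|p s - q s|%:E)%E.
    by apply: ge0_subset_integral => // x _; rewrite lee_fin.
  apply: le_trans h; apply: ge0_le_integral => //.
  - by move=> x _; rewrite lee_fin ltW.
  - exact: measurable_funS mabs.
have OE : leb (O (k, i) `&` D) = leb (O (k, i)).
  have OD0 : leb (O (k, i) `\` D) = 0%E.
    apply/eqP; rewrite -measure_le0 -BD0; apply: le_measure; rewrite ?inE//.
    - exact: measurableD.
    - exact: measurableD.
    - by move=> x [[? _] ?]; split.
  rewrite [RHS](measureDI leb (mO (k, i)) mD) -[LHS]add0e.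
  by congr (_ + _)%E; exact: esym OD0.
have := le_trans I1 hI; rewrite OE -(@fineK _ (leb (O (k, i)))) ?ge0_fin_numE//.
rewrite -EFinM lee_fin => h.
have : k.+1%:R^-1 * m <= k.+1%:R^-1 * fine (leb (O (k, i))) by rewrite ler_pM2l.
have : 0 < k.+1%:R^-1 * m by rewrite mulr_gt0.
move: h; move: (k.+1%:R^-1 * m) (k.+1%:R^-1 * fine _) => a b; lra.
Qed.

End uniform_of_L1.

(** * Joint continuity of the functional *)
Section Linf_facts.
Context {R : realType} {n : nat}.
Local Notation leb := (@lebesgue_rV R n).
Variables (B : set 'rV[R]_n) (cB : compact B).
Hypothesis B0 : (0 < leb B)%E.
Let mB := compact_borel cB.

Lemma Linf_norm_ae (f : 'rV[R]_n -> R) (e : R) : (Linf_norm B f <= e%:E)%E ->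
  {ae leb, forall s, B s -> `|f s| <= e}.
Proof.
rewrite Linf_normE ifT; last first.
  by apply: (lt_le_trans B0); apply: le_measure; rewrite ?inE.
move/ess_supP; have aeF := ae_filter_ringOfSetsType leb.
apply: (@filterS _ _ aeF) => s h Bs.
by move: h; rewrite patchE mem_set// lee_fin.
Qed.

Lemma ae_bounded_null (p : 'rV[R]_n -> R) M :
  measurable_fun (B : set (borel 'rV[R]_n)) p ->
  {ae leb, forall s, B s -> p s <= M} -> leb [set s | B s /\ M < p s] = 0%E.
Proof.
move=> mp [N [mN N0 hN]].
have mS : measurable ([set s | B s /\ M < p s] : set (borel 'rV[R]_n)).
  rewrite (_ : mkset _ = B `\` (B `&` [set s | p s <= M])).
    by apply: measurableD => //; apply: measurable_fun_le => //; exact: measurable_cst.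
  apply/seteqP; split => s [Bs] /= h; split => //.
    by move=> [_]; rewrite leNgt h.
  by rewrite ltNge; apply/negP => h'; apply: h.
apply/eqP; rewrite -measure_le0 -N0; apply: le_measure; rewrite ?inE//.
move=> s [Bs ps]; apply: hN => /= h.
by move: ps; rewrite ltNge h.
Qed.

Lemma PacLinf_ae_bounded (p : PacLinf B) : exists2 M, 0 <= M &
  {ae leb, forall s, B s -> p s <= M}.
Proof.
have := PacLinf_lty p; case E : (Linf_norm B p) => [r| |]// _; last first.
  exists 0 => //; have := @Linf_norm_ae p 0; rewrite E => /(_ (leNye _)).
  have aeF := ae_filter_ringOfSetsType leb.
  by apply: (@filterS _ _ aeF) => s h /h; apply: le_trans; exact: ler_norm.
exists (Num.max 0 r); first by rewrite le_max lexx.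
have := @Linf_norm_ae p (Num.max 0 r); rewrite E lee_fin le_max lexx orbT => /(_ isT).
have aeF := ae_filter_ringOfSetsType leb.
by apply: (@filterS _ _ aeF) => s h /h; apply: le_trans; exact: ler_norm.
Qed.

Lemma clip_lipschitz (M a b : R) :
  `|Num.max 0 (Num.min M a) - Num.max 0 (Num.min M b)| <= `|a - b|.
Proof.
have h1 := ler_norm (a - b); have h2 := ler_norm (b - a); rewrite distrC in h2.
have [|] := leP M a; have [|] := leP M b => hb ha;
  have [|] := leP 0 M; have [|] := leP 0 a; have [|] := leP 0 b => hb0 ha0 hM0;
  rewrite ler_norml; apply/andP; split; lra.
Qed.

Lemma integral_dist_le (p q p' q' : 'rV[R]_n -> R) e :
  measurable_fun (B : set (borel 'rV[R]_n)) p' ->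
  measurable_fun (B : set (borel 'rV[R]_n)) q' -> 0 <= e ->
  (forall s, B s -> `|p' s - q' s| <= `|p s - q s|) ->
  {ae leb, forall s, B s -> `|p s - q s| <= e} ->
  (\int[leb]_(s in B) `|p' s - q' s|%:E <= e%:E * leb B)%E.
Proof.
move=> mp mq e0 h pqe; rewrite -(@integral_cst _ _ _ leb _ mB).
apply: ae_ge0_le_integral => //.
- apply/measurable_EFinP; apply: measurableT_comp => //; exact: measurable_funB.
- have aeF := ae_filter_ringOfSetsType leb.
  apply: (@filterS _ _ aeF) pqe => s hs Bs.
  by rewrite lee_fin; exact: le_trans (h s Bs) (hs Bs).
Qed.

End Linf_facts.

Lemma fine_dist_le (R : realType) (x y z : \bar R) (e : R) :
  x \is a fin_num -> y \is a fin_num -> z \is a fin_num ->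
  (x <= y + (e / 2)%:E -> y <= x + (e / 2)%:E ->
   y <= z + (e / 2)%:E -> z <= y + (e / 2)%:E -> (`|fine x - fine z| <= e)%R)%E.
Proof.
move: x y z => [x| |] [y| |] [z| |]// _ _ _; rewrite -!EFinD !lee_fin => h1 h2 h3 h4.
by rewrite /= ler_distlC; apply/andP; split; lra.
Qed.

Section functional_continuity.
Context {R : realType} {n : nat} {T : normedModType R}.
Local Notation leb := (@lebesgue_rV R n).
Local Notation lebX := (@lebesgue_rVR R n).
Local Notation X := ('rV[R]_n * R)%type.
Variables (D1 : nat -> X) (D2 : nat -> T).
Hypotheses (dD1 : dense_seq D1) (dD2 : dense_seq D2).
Variables (B : set 'rV[R]_n) (cB : compact B) (Y : set T) (kY : compact Y).
Hypothesis B0 : (0 < leb B)%E.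
Hypotheses (cY : closed Y).
Context (c : X -> T -> R).
Hypothesis c_ge0 : forall x y, cylinder B x -> Y y -> 0 <= c x y.
Hypothesis mc : measurable_fun [set: borel (X * T)%type] (cost_ext (cylinder B) Y c).
Hypothesis c_cont : forall (z : X * T) e, (cylinder B `*` Y) z -> 0 < e ->
  \forall w \near z, (cylinder B `*` Y) w -> `|c w.1 w.2 - c z.1 z.2| < e.
Local Notation F nu := (transport_functional c cB nu).

Let mB := compact_borel cB.
Let lebB_fin : leb B \is a fin_num.
Proof. by rewrite ge0_fin_numE// lebesgue_rV_compact. Qed.

Definition slab M : set X := B `*` [set r | 0 <= r <= M].

Lemma slab_compact M : compact (slab M).
Proof.
apply: compact_setX => //.
rewrite (_ : mkset _ = `[0, M]%classic); first exact: segment_compact.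
by apply/seteqP; split => r /=; rewrite in_itv.
Qed.

Lemma mu_pac_slab (p : Pac B) M : (forall s, B s -> 0 <= p s <= M) ->
  mu_pac cB p (slab M) = 1%E.
Proof.
move=> pM; rewrite -[LHS]/(lebX (slab M `&` subgraph B p)) setIC setIidl.
  exact: subgraph_measure1.
by move=> x [[Bx x0] /= xp]; split => //=; rewrite x0 (le_trans xp)//; case/andP: (pM _ Bx).
Qed.

Lemma functional_near (nu : prob_on R Y) M eps : 0 < eps ->
  \forall nu' \near nu, forall p : Pac B, (forall s, B s -> 0 <= p s <= M) ->
    (F nu' p <= F nu p + eps%:E)%E /\ (F nu p <= F nu' p + eps%:E)%E.
Proof.
move=> eps0; have [C C0 hC] := cost_bounded cB kY c_cont M.
have mS : measurable (slab M : set (borel X)).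
  apply: closed_borel; apply: compact_closed; first exact: norm_hausdorff.
  exact: slab_compact.
have SA : slab M `<=` cylinder B by move=> x [Bx /= /andP[]].
have cC : exists2 C, 0 <= C & forall x y, slab M x -> Y y -> c x y <= C.
  by exists C => // -[s r] y [/= Bs rM] Yy; exact: hC.
have cS w : 0 < w -> exists2 del, 0 < del & forall x y y', slab M x ->
    Y y -> Y y' -> ball y del y' -> c x y' <= c x y + w.
  move=> w0; have [del del0 hdel] := cost_unif_continuous cB kY c_cont M w0.
  exists del => // x y y' Sx Yy Yy' yy'.
  by apply: (hdel (x, y) (x, y')) => //; split => //=; exact: ballxx.
have := Tc_near dD1 dD2 (cylinder_closed cB) kY cY c_ge0 mc mS SA cC cS nu eps0.
apply: (@filterS _ (nbhs nu)) => nu' h p pM; apply: h.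
exact: mu_pac_slab.
Qed.

(** All costs on the slab lie between 0 and C, so resampling the difference of
    the subgraphs costs at most C times its measure. *)
Lemma functional_lipschitz M : exists2 C, 0 <= C &
  forall (nu : prob_on R Y) (p q : Pac B) (e : R),
    (forall s, B s -> 0 <= p s <= M) -> (forall s, B s -> 0 <= q s <= M) ->
    (\int[leb]_(s in B) `|p s - q s|%:E <= e%:E)%E ->
    (F nu q <= F nu p + (C * e)%:E)%E.
Proof.
have [C C0 hC] := cost_bounded cB kY c_cont M.
exists C => // nu p q e pM qM pqe.
have h : forall x x' y, (subgraph B p `\` subgraph B q) x ->
    (subgraph B q `\` subgraph B p) x' -> Y y -> c x' y + 0 <= c x y + C.
  move=> x [s r] y [[Ax _] _] [[[/= Bs r0] /= rq] _] Yy.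
  rewrite addr0; apply: (@le_trans _ _ C); last by rewrite lerDr c_ge0.
  by apply: hC => //; rewrite r0 (le_trans rq)//; case/andP: (qM _ Bs).
have := Tc_move dD1 dD2 cB cY c_ge0 mc nu (lexx 0) C0 h.
have L0 : (0 <= 0%:E * lebX (subgraph B p `\` subgraph B q))%E by exact: mule_ge0.
move=> h'; apply: (le_trans (leeDl _ L0)); apply: (le_trans h').
apply: leeD2l; rewrite EFinM; apply: lee_wpmul2l; first by rewrite lee_fin.
apply: le_trans pqe; rewrite subgraphD_measure; last by move=> s /qM/andP[].
have mp := density_measurable p. have mq := density_measurable q.
apply: ge0_le_integral => //.
- by move=> s _; rewrite lee_fin le_max lexx.
- apply/measurable_EFinP; apply: measurable_maxr; first exact: measurable_cst.
  exact: measurable_funB.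
- apply/measurable_EFinP; apply: measurableT_comp => //; exact: measurable_funB.
- by move=> s _; rewrite lee_fin ge_max normr_ge0 ler_norm.
Qed.

Lemma functional_fin_num (nu : prob_on R Y) (p : PacLinf B) : F nu p \is a fin_num.
Proof.
have [M M0 pM] := PacLinf_ae_bounded cB B0 p.
have [p' [_ p'M p'U]] := Pac_clip cB M0 (ae_bounded_null cB (density_measurable p) pM).
rewrite -(transport_functional_ext c nu p'U).
have [C C0 hC] := cost_bounded cB kY c_cont M.
apply: (@transport_functional_bounded _ _ _ _ _ dD1 dD2 _ cB _ cY _ c_ge0 mc nu p' M C) => //.
by move=> s /p'M/andP[].
Qed.

(** Near p in L^oo all densities are bounded by M + 1 almost everywhere, where
    M bounds p; after clipping, functional_near and functional_lipschitz
    apply on the slab of height M + 1. *)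
Lemma functional_continuous :
  continuous (fun z : PacLinf B * prob_on R Y => fine (F z.2 z.1)).
Proof.
move=> [p nu]; apply/cvgrPdist_le => /= e e0.
have [M M0 pM] := PacLinf_ae_bounded cB B0 p.
have M1 : 0 <= M + 1 by rewrite addr_ge0.
have [C C0 hC] := functional_lipschitz (M + 1).
have e20 : 0 < e / 2 by rewrite divr_gt0.
have K0 : 0 < C * fine (leb B) + 1 by rewrite ltr_wpDl// mulr_ge0// fine_ge0.
pose r := Num.min 1 (e / 2 / (C * fine (leb B) + 1)).
have r0 : 0 < r by rewrite lt_min ltr01 divr_gt0.
near=> q nu' => /=.
have /(@ltW _ _) qp : (Linf_norm B (p \- q)%R < r%:E)%E.
  near: q; exact: (@nbhsx_ballx _ _ p _ r0).
have nunu' : forall p : Pac B, (forall s, B s -> 0 <= p s <= M + 1) ->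
    (F nu' p <= F nu p + (e / 2)%:E)%E /\ (F nu p <= F nu' p + (e / 2)%:E)%E.
  near: nu'; exact: functional_near.
have aeF := ae_filter_ringOfSetsType leb.
have pqr := Linf_norm_ae cB B0 qp.
have pM1 : {ae leb, forall s, B s -> p s <= M + 1}.
  by apply: (@filterS _ _ aeF) pM => s h /h /le_trans; apply; rewrite lerDl.
have qM1 : {ae leb, forall s, B s -> q s <= M + 1}.
  apply: (@filterS2 _ _ aeF _ _ _ _ pM pqr) => s h1 h2 Bs.
  have := h2 Bs; rewrite distrC => /(le_trans (ler_norm _)); rewrite lerBlDl => /le_trans.
  by apply; rewrite lerD ?h1// ge_min lexx.
have [p' [p'E p'M p'U]] := Pac_clip cB M1 (ae_bounded_null cB (density_measurable p) pM1).
have [q' [q'E q'M q'U]] := Pac_clip cB M1 (ae_bounded_null cB (density_measurable q) qM1).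
have d1 : (\int[leb]_(s in B) `|p' s - q' s|%:E <= (r * fine (leb B))%:E)%E.
  rewrite EFinM fineK//; apply: (integral_dist_le cB (p := p) (q := q)) => //.
  - exact: density_measurable.
  - exact: density_measurable.
  - exact: ltW.
  - by move=> s _; rewrite p'E q'E; exact: clip_lipschitz.
have d2 : (\int[leb]_(s in B) `|q' s - p' s|%:E <= (r * fine (leb B))%:E)%E.
  by under eq_integral do rewrite distrC.
have Cr : C * (r * fine (leb B)) <= e / 2.
  rewrite mulrCA; apply: (@le_trans _ _ (r * (C * fine (leb B) + 1))).
    by rewrite ler_wpM2l ?lerDl// ltW.
  by rewrite -ler_pdivlMr// ge_min lexx orbT.
have h1 := hC nu' p' q' _ p'M q'M d1.
have h2 := hC nu' q' p' _ q'M p'M d2.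
have [h3 h4] := nunu' p' p'M.
rewrite !(transport_functional_ext c _ p'U) !(transport_functional_ext c _ q'U) in h1 h2 h3 h4.
have f1 := functional_fin_num nu p. have f2 := functional_fin_num nu' p.
have f3 := functional_fin_num nu' q.
have Cr' : ((C * (r * fine (leb B)))%:E <= (e / 2)%:E)%E by rewrite lee_fin.
apply: (fine_dist_le f1 f2 f3 h4 h3).
  exact: le_trans h2 (leeD2l _ Cr').
exact: le_trans h1 (leeD2l _ Cr').
Unshelve. all: by end_near. Qed.

End functional_continuity.

(** * Convergence of minimisers *)
Section minimiser_stability.
Context {R : realType} {n : nat} {T : normedModType R}.
Local Notation leb := (@lebesgue_rV R n).
Local Notation lebX := (@lebesgue_rVR R n).
Local Notation X := ('rV[R]_n * R)%type.
Variables (D1 : nat -> X) (D2 : nat -> T) (D3 : nat -> 'rV[R]_n).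
Hypotheses (dD1 : dense_seq D1) (dD2 : dense_seq D2) (dD3 : dense_seq D3).
Variables (B : set 'rV[R]_n) (cB : compact B) (Y : set T) (kY : compact Y).
Hypothesis B0 : (0 < leb B)%E.
Hypotheses (Y0 : Y !=set0) (cY : closed Y).
Context (c : X -> T -> R).
Hypothesis c_ge0 : forall x y, cylinder B x -> Y y -> 0 <= c x y.
Hypothesis mc : measurable_fun [set: borel (X * T)%type] (cost_ext (cylinder B) Y c).
Hypothesis c_cont : forall (z : X * T) e, (cylinder B `*` Y) z -> 0 < e ->
  \forall w \near z, (cylinder B `*` Y) w -> `|c w.1 w.2 - c z.1 z.2| < e.
Hypothesis c_incr : forall s y, B s -> Y y ->
  forall p p' : R, 0 <= p -> p < p' -> c (s, p) y < c (s, p') y.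
Hypothesis c_unbounded : forall s y, B s -> Y y ->
  forall M : R, exists2 p : R, 0 <= p & M < c (s, p) y.
Local Notation F nu := (transport_functional c cB nu).

Let mB := compact_borel cB.

Variables (nu_ : nat -> prob_on R Y) (nu : prob_on R Y).
Hypothesis nuC : nu_ @ \oo --> nu.
Variables (p_ : nat -> Pac B) (p : Pac B).
Hypotheses (minp_ : forall k, is_minimiser (F (nu_ k)) (p_ k))
  (minp : is_minimiser (F nu) p).

(** The representatives r_ k and r, which take their values in [0, M]
    everywhere on B, are passed on together with the continuous densities:
    the convergence of subgraphs and of plans is read off from them. *)
Lemma minimisers_converge : exists (M : R) (r_ : nat -> Pac B) (r : Pac B),
  [/\ 0 <= M,
      forall k, (forall s, B s -> 0 <= r_ k s <= M) /\
        forall U, measurable U -> mu_pac cB (r_ k) U = mu_pac cB (p_ k) U,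
      (forall s, B s -> 0 <= r s <= M) /\
        forall U, measurable U -> mu_pac cB r U = mu_pac cB p U,
      forall th, 0 < th -> \forall k \near \oo,
        (\int[leb]_(s in B) `|r_ k s - r s|%:E <= th%:E)%E &
      exists (q_ : nat -> 'rV[R]_n -> R) (q : 'rV[R]_n -> R),
        [/\ forall k, continuous_density (p_ k) (q_ k),
            continuous_density p q &
            {uniform B, q_ @ \oo --> q}]].
Proof.
have [M [del [M0 del0 hreg]]] :=
  minimiser_regular dD1 dD2 dD3 cB kY B0 Y0 cY c_ge0 mc c_cont c_incr c_unbounded.
have /choice[D_ hD_] k := hreg _ _ (minp_ k).
have [Dp [DpB mDp Dp0 DpM Dpmod]] := hreg _ _ minp.
have clip (u : Pac B) (D : set (borel 'rV[R]_n)) : D `<=` B -> measurable D ->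
    leb (B `\` D) = 0%E -> (forall s, D s -> 0 <= u s <= M) ->
    exists u' : Pac B, [/\ density u' = (fun s => Num.max 0 (Num.min M (u s))),
      forall s, B s -> 0 <= u' s <= M &
      forall U, measurable U -> mu_pac cB u' U = mu_pac cB u U].
  move=> DB mD D0 uM; apply: Pac_clip => //.
  apply: (ae_bounded_null cB (density_measurable u)).
  exists (B `\` D); split => //; first exact: measurableD.
  move=> s /= h; have Bs : B s by apply: contrapT => h'; apply: h.
  by split => // Ds; apply: h => _; case/andP: (uM s Ds).
have clamp_id x : 0 <= x <= M -> Num.max 0 (Num.min M x) = x.
  by move=> /andP[x0 xM]; rewrite (min_idPr xM) (max_idPr x0).
have [r [rE rM rU]] := clip p Dp DpB mDp Dp0 DpM.
have /choice[r_ hr_] k : exists u' : Pac B,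
    [/\ density u' = (fun s => Num.max 0 (Num.min M (p_ k s))),
      forall s, B s -> 0 <= u' s <= M &
      forall U, measurable U -> mu_pac cB u' U = mu_pac cB (p_ k) U].
  by have [? ? ? ? _] := hD_ k; exact: (clip _ (D_ k)).
have minr : is_minimiser (F nu) r.
  by move=> u; rewrite (transport_functional_ext c nu rU); exact: minp.
have minr_ k : is_minimiser (F (nu_ k)) (r_ k).
  have [_ _ h] := hr_ k.
  by move=> u; rewrite (transport_functional_ext c _ h); exact: minp_.
have L1 th : 0 < th -> \forall k \near \oo,
    (\int[leb]_(s in B) `|r_ k s - r s|%:E <= th%:E)%E.
  move=> th0.
  have [eps eps0 heps] := L1_stability dD1 dD2 cB kY B0 cY c_ge0 mc c_cont c_incr M0 th0.
  have near_nu := functional_near dD1 dD2 cB kY cY c_ge0 mc c_cont nu M eps0.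
  have : \forall k \near \oo, forall u : Pac B, (forall s, B s -> 0 <= u s <= M) ->
      (F (nu_ k) u <= F nu u + eps%:E)%E /\ (F nu u <= F (nu_ k) u + eps%:E)%E.
    exact: (nuC near_nu).
  apply: filterS => k hk; have [_ rkM _] := hr_ k.
  under eq_integral do rewrite distrC.
  exact: (heps nu (nu_ k) r (r_ k) rM rkM minr (minr_ k) (hk _ rkM).2 (hk _ rM).1).
exists M, r_, r; split => //.
  by move=> k; case: (hr_ k).
have [S [SB mS S0 hS]] := uniform_of_L1 dD3 cB M del0.
pose N (k : nat) : set (borel 'rV[R]_n) := B `\` D_ k.
have mN k : measurable (N k) by apply: measurableD => //; case: (hD_ k).
have mUN : measurable (\bigcup_k N k) by exact: bigcupT_measurable.
have UN0 : leb (\bigcup_k N k) = 0%E.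
  by apply: null_countable_bigcup => // k; case: (hD_ k).
(* A common set of full measure for the whole sequence and its limit. *)
pose D : set (borel 'rV[R]_n) := (S `&` Dp) `\` \bigcup_k N k.
have mD : measurable D by apply: measurableD => //; exact: measurableI.
have BD0 : leb (B `\` D) = 0%E.
  have h1 : leb ((B `\` Dp) `|` \bigcup_k N k) = 0%E.
    by rewrite measureU0//; exact: measurableD.
  have h2 : leb ((B `\` S) `|` ((B `\` Dp) `|` \bigcup_k N k)) = 0%E.
    rewrite measureU0//; first exact: measurableD.
    by apply: measurableU => //; exact: measurableD.
  apply/eqP; rewrite -measure_le0 -h2; apply: le_measure; rewrite ?inE.
  - exact: measurableD.
  - by do 2 (apply: measurableU => //; first exact: measurableD).
  - move=> s [Bs Ds]; have [Ss|Ss] := pselect (S s); last by left.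
    have [Dps|Dps] := pselect (Dp s); last by right; left.
    by right; right; apply: contrapT => h; apply: Ds; split.
have DS : D `<=` S by move=> s [[]].
have DDp : D `<=` Dp by move=> s [[]].
have DD_ k : D `<=` D_ k.
  move=> s [[Ss _] h]; apply: contrapT => h'; apply: h; exists k => //.
  by split => //; exact: SB.
have D0 : D !=set0.
  apply/set0P/negP => /eqP h; move: BD0; rewrite h setD0 => h'.
  by move: B0; rewrite h' ltxx.
have modr : has_modulus D M del r.
  split=> [s /DDp/DpB/rM//|k s s' /DDp Ds /DDp Ds' ss'].
  by rewrite rE !clamp_id; [exact: Dpmod|exact: DpM|exact: DpM].
have modr_ k : has_modulus D M del (r_ k).
  have [rkE rkM _] := hr_ k; have [DkB _ _ DkM Dkmod] := hD_ k.
  split=> [s /DD_/DkB/rkM//|j s s' /(DD_ k) Ds /(DD_ k) Ds' ss'].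
  by rewrite rkE !clamp_id; [exact: Dkmod|exact: DkM|exact: DkM].
have [E [Econt Eid Ele]] := modulus_extension M0 del0 D0.
have dens (u : Pac B) (u' : Pac B) : has_modulus D M del u' ->
    (forall s, D s -> u' s = u s) -> continuous_density u (E u').
  move=> mu' uu'; split; first by apply: continuous_subspaceT; exact: Econt.
  exists (B `\` D); split => //; first exact: measurableD.
  move=> s /= h; have Bs : B s by apply: contrapT => h'; apply: h.
  by split => // Ds; apply: h => _; rewrite Eid// uu'.
exists (fun k => E (r_ k)), (E r); split.
- move=> k; apply: dens => // s /(DD_ k) Ds.
  by have [-> _ _] := hr_ k; have [_ _ _ DkM _] := hD_ k; rewrite clamp_id// DkM.
- by apply: dens => // s /DDp Ds; rewrite rE clamp_id// DpM.
move=> U /uniform_nbhs[V [entV VU]].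
have [e e0 eV] : exists2 e : R, 0 < e & forall x y : R, `|x - y| <= e -> V (x, y).
  move: entV; rewrite -entourage_ballE => -[e /= e0 eV]; exists (e / 2).
    by rewrite divr_gt0.
  move=> x y xy; apply: eV; rewrite /= /ball/=; apply: (le_lt_trans xy).
  by rewrite ltr_pdivrMr// ltr_pMr// ltr1n.
have [th th0 hth] := hS e e0.
have := L1 th th0; apply: filterS => k hk; apply: VU => s _; apply: eV.
have close t : D t -> `|r_ k t - r t| <= e.
  by apply: (hth D) => //; exact: density_measurable.
rewrite ler_distlC lerBlDr; apply/andP; split.
  apply: Ele => // t /close; rewrite ler_distl => /andP[h _].
  by rewrite -lerBlDr.
by apply: Ele => // t /close; rewrite ler_distl => /andP[].
Qed.

End minimiser_stability.

(** * Convergence of optimal plans *)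
Section restriction.
Context d (T : measurableType d) (R : realType).
Variables (lam : {measure set T -> \bar R}).

(** Adding the restriction of lam to S' minus S to P gives the same measure as
    adding its restriction to S minus S' to Q.  The bound is applied to the
    nonnegative function f + 1 <= 2. *)
Lemma integral_restriction_le (S S' : set T) (P Q : probability T R) (x : R) (f : T -> R) :
  measurable S -> measurable S' ->
  (forall U, measurable U -> P U = lam (U `&` S)) ->
  (forall U, measurable U -> Q U = lam (U `&` S')) ->
  (lam (S `\` S') <= x%:E)%E ->
  measurable_fun setT f -> (forall t, `|f t| <= 1) ->
  \int[P]_t f t <= \int[Q]_t f t + 2 * x.
Proof.
move=> mS mS' PE QE Sx mf f1.
have mN : measurable (S `\` S') by exact: measurableD.
have mN' : measurable (S' `\` S) by exact: measurableD.
pose h t := (f t + 1)%:E.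
have h0 t : (0 <= h t)%E.
  by have := f1 t; rewrite ler_norml lee_fin => /andP[]; lra.
have h2 t : (h t <= 2%:E)%E.
  by have := f1 t; rewrite ler_norml lee_fin => /andP[]; lra.
have mh : measurable_fun setT h.
  by apply/measurable_EFinP; apply: measurable_funD => //; exact: measurable_cst.
have bf : bounded_mfun f by split => //; exists 1.
have expect1 (P' : probability T R) : (\int[P']_t h t = (\int[P']_t f t + 1)%:E)%E.
  rewrite /h bounded_mfunE; last by apply: bounded_mfunD => //; exact: bounded_mfun_cst.
  by rewrite expectD//; [rewrite expect_cst|exact: bounded_mfun_cst].
have split_ : (\int[P]_t h t <= \int[Q]_t h t + \int[mrestr lam mN]_t h t)%E.
  rewrite -ge0_integral_measure_add//.
  have -> : (\int[measure_add Q (mrestr lam mN)]_t h t =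
      \int[measure_add P (mrestr lam mN')]_t h t)%E.
    apply: eq_measure_integral => U mU _.
    transitivity (Q U + lam (U `&` (S `\` S')))%E; first exact: measure_addE.
    transitivity (P U + lam (U `&` (S' `\` S)))%E; last by apply/esym; exact: measure_addE.
    rewrite PE// QE//.
    have e V W : measurable V -> measurable W ->
        (lam (U `&` V) + lam (U `&` (W `\` V)) = lam (U `&` (V `|` W)))%E.
      move=> mV mW; rewrite -measureU.
      - by congr (lam _); rewrite -setIUr setDE setUIr setUv setIT.
      - exact: measurableI.
      - by apply: measurableI => //; exact: measurableD.
      - by apply/seteqP; split => // t [[_ Vt] [_ [_ /(_ Vt)]]].
    by rewrite !e// setUC.
  rewrite [leRHS]ge0_integral_measure_add//.
  by apply: leeDl; exact: integral_ge0.
have hN : (\int[mrestr lam mN]_t h t <= (2 * x)%:E)%E.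
  apply: (@le_trans _ _ (\int[mrestr lam mN]_t (cst 2%:E t))%E).
    by apply: ge0_le_integral => //; exact: measurable_cst.
  rewrite integral_cst// EFinM; apply: lee_wpmul2l; first by rewrite lee_fin.
  by rewrite -[X in (X <= _)%E]/(lam (setT `&` (S `\` S'))) setTI.
have := le_trans split_ (leeD2l _ hN).
by rewrite !expect1 -EFinD lee_fin; lra.
Qed.

End restriction.

Section coupling_limit.
Context {R : realType}.

Lemma Rintegral_law d d' (Z : measurableType d) (T : measurableType d')
    (rho : {measure set Z -> \bar R}) (m : {measure set T -> \bar R})
    (f : Z -> T) (h : T -> R) : measurable_fun setT f ->
  (forall U, measurable U -> rho (f @^-1` U) = m U) -> measurable_fun setT h ->
  \int[m]_x h x = \int[rho]_z h (f z).
Proof.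
move=> mf rhom /measurable_EFinP mh; rewrite /Rintegral; congr fine.
rewrite integralE [RHS]integralE; congr (_ - _)%E.
  rewrite (ge0_integral_law mf rhom)//; last exact: measurable_funepos.
  by apply: eq_integral => z _; rewrite unlock.
rewrite (ge0_integral_law mf rhom)//; last exact: measurable_funeneg.
by apply: eq_integral => z _; rewrite unlock.
Qed.

Lemma integral_cvg (T : normedModType R) (A : set T) (gam : nat -> prob_on R A)
    (g : prob_on R A) (f : borel T -> R) : closed A ->
  gam @ \oo --> g -> continuous (f : T -> R) -> (forall x, `|f x| <= 1) ->
  \int[gam k]_x f x @[k --> \oo] --> \int[g]_x f x.
Proof.
move=> cA gamC cf f1.
have Cf : {within A, continuous f} /\ exists M, forall x, A x -> `|f x| <= M.
  by split; [exact: continuous_subspaceT|exists 1].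
have := (prob_on_cvgP gam g).1 gamC (exist _ f Cf).
have mf := continuous_borelR cf.
have e (m : prob_on R A) : \int[m]_(x in A) sval (exist _ f Cf : Cb R A) x = \int[m]_x f x.
  exact: Rintegral_prob_on.
rewrite e; apply: cvg_trans; apply: near_eq_cvg; apply: nearW => k.
by rewrite e.
Qed.

Variables (T1 T2 : normedModType R).
Variables (A1 : set T1) (A2 : set T2).
Hypotheses (cA1 : closed A1) (cA2 : closed A2).

(** Stated for a continuous map f so that it covers both projections. *)
Lemma marginal_limit (T : normedModType R) (D : nat -> T) (A : set T)
    (m_ : nat -> prob_on R A) (m : prob_on R A) (f : T1 * T2 -> T)
    (gam : nat -> prob_on R (A1 `*` A2)) (g : prob_on R (A1 `*` A2)) :
  dense_seq D -> continuous f -> gam @ \oo --> g ->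
  (forall k (U : set (borel T)), measurable U -> gam k (f @^-1` U) = m_ k U) ->
  (forall h : borel T -> R, continuous (h : T -> R) -> (forall x, `|h x| <= 1) ->
    \int[m_ k]_x h x @[k --> \oo] --> \int[m]_x h x) ->
  forall U : set (borel T), measurable U -> g (f @^-1` U) = m U.
Proof.
move=> dD cf gamC gamf mC U mU.
have mf : measurable_fun [set: borel (T1 * T2)%type] (f : _ -> borel T).
  exact: continuous_borel.
pose P : probability (borel T) R := prob_of (m := Defs.image g mf) (probability_setT g).
rewrite -[LHS]/(P U); apply: (prob_eq_continuous dD) => // h ch h1.
have mh : measurable_fun setT h by exact: continuous_borelR.
rewrite (Rintegral_law (rho := g) (f := (f : borel _ -> borel T)))//.
have cA : closed (A1 `*` A2) by exact: closed_setX.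
have chf : continuous (h \o f : T1 * T2 -> R).
  by move=> z; apply: continuous_comp; [exact: cf|exact: ch].
have lim1 := integral_cvg cA gamC chf (fun z => h1 (f z)).
apply: (cvg_unique _ lim1); first exact: norm_hausdorff.
have e k : \int[gam k]_z (h \o f) z = \int[m_ k]_x h x.
  by rewrite (Rintegral_law (rho := gam k) (f := (f : borel _ -> borel T)))//; exact: gamf.
apply: cvg_trans (mC h ch h1); apply: near_eq_cvg; apply: nearW => k.
exact/esym/e.
Qed.

End coupling_limit.

Lemma eq_measure_Rintegral d (T : measurableType d) (R : realType)
    (m1 m2 : {measure set T -> \bar R}) (f : T -> R) :
  (forall U, measurable U -> m1 U = m2 U) -> \int[m1]_x f x = \int[m2]_x f x.
Proof.
by move=> m12; congr fine; apply: eq_measure_integral => U mU _; exact: m12.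
Qed.

Lemma dist_le_of (R : realType) (a b e : R) :
  a <= b + 2 * (e / 2) -> b <= a + 2 * (e / 2) -> `|b - a| <= e.
Proof. by move=> h1 h2; rewrite ler_distlC; apply/andP; split; lra. Qed.

Section cost_limit.
Context {R : realType} {T1 T2 : normedModType R}.
Variables (A1 : set T1) (A2 : set T2) (c : T1 -> T2 -> R).
Hypotheses (cA1 : closed A1) (cA2 : closed A2).
Hypothesis c_ge0 : forall x y, A1 x -> A2 y -> 0 <= c x y.
Hypothesis c_cont : {within A1 `*` A2, continuous (fun z => c z.1 z.2)}.

(** The cost is unbounded on A1 x A2, so it is truncated at C, which changes
    nothing on K. *)
Lemma transport_cost_cvg (K : set (borel (T1 * T2)%type)) (C : R)
    (gam : nat -> prob_on R (A1 `*` A2)) (g : prob_on R (A1 `*` A2)) :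
  measurable K -> (forall k, gam k K = 1%E) -> g K = 1%E -> 0 <= C ->
  (forall z, K z -> c z.1 z.2 <= C) -> gam @ \oo --> g ->
  exists (I : R) (I_ : nat -> R), [/\ transport_cost c g = I%:E,
    forall k, transport_cost c (gam k) = (I_ k)%:E & I_ @ \oo --> I].
Proof.
move=> mK gamK gK C0 cC gamC.
pose A := A1 `*` A2; have cA : closed A by exact: closed_setX.
have mA : measurable (A : set (borel (T1 * T2)%type)) by exact: closed_borel.
pose f (z : T1 * T2) := Num.min C (c z.1 z.2).
have cf : {within A, continuous f}.
  apply/within_continuousP => z e Az e0.
  have := (within_continuousP _ _).1 c_cont z e Az e0.
  apply: filterS => w hw Aw; apply: le_lt_trans (hw Aw); rewrite /f.
  move: (c w.1 w.2) (c z.1 z.2) => a b.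
  have h1 := ler_norm (a - b); have h2 := ler_norm (b - a); rewrite distrC in h2.
  have [|] := leP C a; have [|] := leP C b => ? ?; rewrite ler_norml; apply/andP; split; lra.
have f0 z : A z -> 0 <= f z by move=> [? ?]; rewrite le_min C0 c_ge0.
have fC z : f z <= C by rewrite ge_min lexx.
have Cf : {within A, continuous f} /\ exists M, forall x, A x -> `|f x| <= M.
  by split => //; exists C => z Az; rewrite ger0_norm ?f0.
have mf : measurable_fun (A : set (borel (T1 * T2)%type)) f.
  exact: within_continuous_measurable.
have mc : measurable_fun (A : set (borel (T1 * T2)%type)) (fun z => c z.1 z.2).
  exact: within_continuous_measurable.
have costE (m : prob_on R A) : m K = 1%E ->
    transport_cost c m = (\int[m]_(z in A) f z)%:E.
  move=> mK1; have mKC : m (~` K) = 0%E by rewrite probability_setC// mK1 subee.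
  rewrite /Rintegral fineK.
    apply: ae_eq_integral => //; [exact/measurable_EFinP|exact/measurable_EFinP|].
    exists (~` K); split; [exact: measurableC|exact: mKC|].
    move=> z /= h Kz; apply: h => _.
    by rewrite /f (min_idPr (cC z Kz)).
  rewrite ge0_fin_numE; last by apply: integral_ge0 => z Az; rewrite lee_fin f0.
  apply: (@le_lt_trans _ _ (\int[m]_(z in A) (cst C%:E z))%E).
    apply: ge0_le_integral => //.
    - exact/measurable_EFinP.
    - by move=> z _; rewrite lee_fin fC.
  rewrite integral_cst//; apply: (@le_lt_trans _ _ (C%:E * 1)%E); last by rewrite mule1 ltry.
  by apply: lee_wpmul2l; [rewrite lee_fin|exact: probability_le1].
exists (\int[g]_(z in A) f z), (fun k => \int[gam k]_(z in A) f z); split.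
- exact: costE.
- by move=> k; exact: costE.
- exact: ((prob_on_cvgP gam g).1 gamC (exist _ f Cf)).
Qed.

End cost_limit.

Section plans.
Context {R : realType} {n : nat} {T : normedModType R}.
Local Notation leb := (@lebesgue_rV R n).
Local Notation lebX := (@lebesgue_rVR R n).
Local Notation X := ('rV[R]_n * R)%type.
Variables (D1 : nat -> X) (D2 : nat -> T).
Hypotheses (dD1 : dense_seq D1) (dD2 : dense_seq D2).
Variables (B : set 'rV[R]_n) (cB : compact B) (Y : set T) (kY : compact Y).
Hypotheses (cY : closed Y).
Context (c : X -> T -> R).
Hypothesis c_ge0 : forall x y, cylinder B x -> Y y -> 0 <= c x y.
Hypothesis mc : measurable_fun [set: borel (X * T)%type] (cost_ext (cylinder B) Y c).
Hypothesis c_cont : forall (z : X * T) e, (cylinder B `*` Y) z -> 0 < e ->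
  \forall w \near z, (cylinder B `*` Y) w -> `|c w.1 w.2 - c z.1 z.2| < e.
Local Notation F nu := (transport_functional c cB nu).

Variables (nu_ : nat -> prob_on R Y) (nu : prob_on R Y).
Hypothesis nuC : nu_ @ \oo --> nu.
Variables (p_ : nat -> Pac B) (p : Pac B).
Hypotheses (minp_ : forall k, is_minimiser (F (nu_ k)) (p_ k))
  (minp : is_minimiser (F nu) p).
Variables (M : R) (r_ : nat -> Pac B) (r : Pac B).
Hypotheses (r_M : forall k s, B s -> 0 <= r_ k s <= M)
  (r_U : forall k U, measurable U -> mu_pac cB (r_ k) U = mu_pac cB (p_ k) U)
  (rM : forall s, B s -> 0 <= r s <= M)
  (rU : forall U, measurable U -> mu_pac cB r U = mu_pac cB p U).
Hypothesis rC : forall th, 0 < th -> \forall k \near \oo,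
  (\int[leb]_(s in B) `|r_ k s - r s|%:E <= th%:E)%E.

Let mS (q : Pac B) : measurable (subgraph B q : set (borel X)).
Proof. by apply: subgraph_borel => //; exact: density_measurable. Qed.

(** Each minimiser is tested in the other functional, and the functionals are
    uniformly close on densities bounded by M. *)
Lemma minimum_cvg (v : R) (v_ : nat -> R) : F nu p = v%:E ->
  (forall k, F (nu_ k) (p_ k) = (v_ k)%:E) -> v_ @ \oo --> v.
Proof.
move=> vE v_E; apply/cvgrPdist_le => /= e e0.
have near_nu := functional_near dD1 dD2 cB kY cY c_ge0 mc c_cont nu M e0.
have : \forall k \near \oo, forall u : Pac B, (forall s, B s -> 0 <= u s <= M) ->
    (F (nu_ k) u <= F nu u + e%:E)%E /\ (F nu u <= F (nu_ k) u + e%:E)%E.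
  exact: (nuC near_nu).
apply: filterS => k hk.
have h1 : ((v_ k)%:E <= v%:E + e%:E)%E.
  rewrite -v_E -vE -(transport_functional_ext c nu rU).
  exact: le_trans (minp_ k r) (hk r rM).1.
have h2 : (v%:E <= (v_ k)%:E + e%:E)%E.
  rewrite -v_E -vE -(transport_functional_ext c (nu_ k) (@r_U k)).
  exact: le_trans (minp (r_ k)) (hk (r_ k) (@r_M k)).2.
by move: h1 h2; rewrite -!EFinD !lee_fin ler_distlC lerBlDr => -> ->.
Qed.

Lemma mu_pac_integral_cvg (h : borel X -> R) : continuous (h : X -> R) ->
  (forall x, `|h x| <= 1) ->
  \int[mu_pac cB (p_ k)]_x h x @[k --> \oo] --> \int[mu_pac cB p]_x h x.
Proof.
move=> ch h1; apply/cvgrPdist_le => /= e e0.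
have e20 : 0 < e / 2 by rewrite divr_gt0.
have := rC e20; apply: filterS => k hk.
have mh := continuous_borelR ch.
have mur q (U : set (borel X)) : measurable U -> mu_pac cB q U = lebX (U `&` subgraph B q).
  by [].
have D : (lebX (subgraph B (r_ k) `\` subgraph B r) <= (e / 2)%:E)%E.
  apply: le_trans hk; rewrite subgraphD_measure; last by move=> s /rM/andP[].
  have mp := density_measurable (r_ k). have mq := density_measurable r.
  apply: ge0_le_integral => //.
  - exact: compact_borel.
  - by move=> s _; rewrite lee_fin le_max lexx.
  - apply/measurable_EFinP; apply: measurable_maxr; first exact: measurable_cst.
    exact: measurable_funB.
  - apply/measurable_EFinP; apply: measurableT_comp => //; exact: measurable_funB.
  - by move=> s _; rewrite lee_fin ge_max normr_ge0 ler_norm.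
have mu_eq (q q' : Pac B) : (forall U, measurable U -> mu_pac cB q U = mu_pac cB q' U) ->
    \int[mu_pac cB q]_x h x = \int[mu_pac cB q']_x h x.
  by move=> qq'; exact: eq_measure_Rintegral.
rewrite -(mu_eq _ _ rU) -(mu_eq _ _ (@r_U k)).
have i1 := integral_restriction_le (mS (r_ k)) (mS r) (mur (r_ k)) (mur r) D mh h1.
rewrite (subgraphD_sym cB) in D.
have i2 := integral_restriction_le (mS r) (mS (r_ k)) (mur r) (mur (r_ k)) D mh h1.
exact: dist_le_of i1 i2.
Qed.

(** The plans are carried by K, the product of the slab of height M and Y,
    because their first marginals are carried by the slab. *)
Lemma optimal_plans_converge (gamma_ : nat -> prob_on R (cylinder B `*` Y)) :
  (forall k, optimal_plan c (mu_pac cB (p_ k)) (nu_ k) (gamma_ k)) ->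
  exists2 gamma : prob_on R (cylinder B `*` Y),
    optimal_plan c (mu_pac cB p) nu gamma &
    exists2 k : nat -> nat, {homo k : m n / (m < n)%N} &
      (gamma_ \o k) @ \oo --> gamma.
Proof.
move=> opt.
pose K := slab B M `*` Y.
have cA1 : closed (cylinder B) by exact: cylinder_closed.
have cA : closed (cylinder B `*` Y) by exact: closed_setX.
have kK : compact K by apply: compact_setX => //; exact: slab_compact.
have cK : closed K by apply: compact_closed => //; exact: norm_hausdorff.
have mK : measurable (K : set (borel (X * T)%type)) by exact: closed_borel.
have KA : K `<=` cylinder B `*` Y by move=> z [[Bz /andP[z0 _]] Yz]; split.
have gamK k : gamma_ k K = 1%E.
  have [[g1 _] _] := opt k.
  have mSl : measurable (slab B M : set (borel X)).
    apply: closed_borel; apply: compact_closed; first exact: norm_hausdorff.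
    exact: slab_compact.
  have s1 : gamma_ k (fst @^-1` slab B M) = 1%E.
    by rewrite (g1 _ mSl) -(@r_U k _ mSl); exact: mu_pac_slab (@r_M k).
  have mA : measurable (cylinder B `*` Y : set (borel (X * T)%type)) by exact: closed_borel.
  have mSl' : measurable (fst @^-1` slab B M : set (borel (X * T)%type)).
    apply: closed_borel; apply: preimage_closed; first by move=> z _; exact: cvg_fst.
    by apply: compact_closed; [exact: norm_hausdorff|exact: slab_compact].
  have KE : K = (cylinder B `*` Y) `\` ((cylinder B `*` Y) `\` fst @^-1` slab B M).
    rewrite setDD; apply/seteqP; split => z.
      by move=> Kz; split; [exact: KA|case: Kz].
    by move=> [[_ Yz] Sz].
  have N0 : gamma_ k ((cylinder B `*` Y) `\` fst @^-1` slab B M) = 0%E.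
    apply/eqP; rewrite -measure_le0.
    have <- : gamma_ k (~` (fst @^-1` slab B M)) = 0%E by rewrite probability_setC// s1 subee.
    apply: le_measure; rewrite ?inE.
    - exact: measurableD.
    - exact: measurableC.
    - by move=> z [].
  apply/eqP; rewrite eq_le; apply/andP; split; first exact: probability_le1.
  rewrite -(prob_on1 (gamma_ k)).
  apply: (@le_trans _ _ (gamma_ k (K `|` ((cylinder B `*` Y) `\` fst @^-1` slab B M)))).
    apply: le_measure; rewrite ?inE//; first by apply: measurableU => //; exact: measurableD.
    move=> z Az; have [Sz|Sz] := pselect ((fst @^-1` slab B M) z); [left|by right].
    by split => //; case: Az.
  by rewrite measureU0//; exact: measurableD.
have [D12 dD12] := dense_seq_prod dD1 dD2.
have [k [g [kh gK kg]]] := weak_compactness dD12 cA kK KA gamK.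
have kinf : k @ \oo --> \oo.
  have le_k j : (j <= k j)%N.
    by elim: j => // j IH; exact: leq_ltn_trans IH (kh _ _ (ltnSn j)).
  move=> P [N _ NP]; exists N => // j /= Nj; apply: NP.
  exact: leq_trans Nj (le_k j).
exists g; last by exists k.
have [C C0 hC] := cost_bounded cB kY c_cont M.
have c_within : {within cylinder B `*` Y, continuous (fun z => c z.1 z.2)}.
  by apply/within_continuousP => z e Az e0; exact: c_cont.
have cKC z : K z -> c z.1 z.2 <= C.
  by case: z => -[s l] y [[/= Bs lM] Yy]; exact: hC.
have [I [I_ [IE I_E IC]]] := transport_cost_cvg cA1 cY c_ge0 c_within mK
  (fun j => gamK (k j)) gK C0 cKC kg.
have coup : couplings (mu_pac cB p) nu g.
  split.
  - apply: (marginal_limit cA1 cY dD1 (m_ := fun j => mu_pac cB (p_ (k j))) _ kg).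
    + by move=> z; exact: cvg_fst.
    + by move=> j U mU; have [[h _] _] := opt (k j); exact: h.
    + move=> h ch h1.
      exact: (@cvg_comp _ _ _ k (fun j => \int[mu_pac cB (p_ j)]_x h x) _ _ _
        kinf (mu_pac_integral_cvg ch h1)).
  - apply: (marginal_limit cA1 cY dD2 (m_ := fun j => nu_ (k j)) _ kg).
    + by move=> z; exact: cvg_snd.
    + by move=> j U mU; have [[_ h] _] := opt (k j); exact: h.
    + move=> h ch h1.
      exact: (@cvg_comp _ _ _ k (fun j => \int[nu_ j]_x h x) _ _ _
        kinf (integral_cvg cY nuC ch h1)).
split => //.
have pfin : F nu p \is a fin_num.
  rewrite -(transport_functional_ext c nu rU).
  apply: (@transport_functional_bounded _ _ _ _ _ dD1 dD2 _ cB _ cY _ c_ge0 mc nu r M C) => //.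
  by move=> s /rM/andP[].
have p_fin j : F (nu_ j) (p_ j) \is a fin_num.
  rewrite -(transport_functional_ext c (nu_ j) (@r_U j)).
  apply: (@transport_functional_bounded _ _ _ _ _ dD1 dD2 _ cB _ cY _ c_ge0 mc _ _ M C) => //.
  by move=> s /(@r_M j)/andP[].
have vC := minimum_cvg (esym (fineK pfin)) (fun j => esym (fineK (p_fin j))).
have vkC : fine (F (nu_ (k j)) (p_ (k j))) @[j --> \oo] --> fine (F nu p).
  exact: (@cvg_comp _ _ _ k (fun j => fine (F (nu_ j) (p_ j))) _ _ _ kinf vC).
rewrite IE -[RHS](fineK pfin); congr EFin.
apply: (cvg_unique _ IC); first exact: norm_hausdorff.
apply: cvg_trans vkC; apply: near_eq_cvg; apply: nearW => j.
by have [_ h] := opt (k j); rewrite /transport_functional -h I_E.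
Qed.

End plans.

(** * Continuity, Gamma-convergence and stability *)
Lemma locally_lipschitz_near (R : realType) (V W : normedModType R) (A : set V)
    (f : V -> W) :
  (forall z, A z -> exists2 U, nbhs z U & [lipschitz f w | w in U `&` A]) ->
  forall z e, A z -> 0 < e -> \forall w \near z, A w -> `|f w - f z| < e.
Proof.
move=> Af z e Az e0; have [U Uz lipf] := Af z Az.
near (+oo : set_system R) => M.
have M0 : 0 < M by near: M; apply: nbhs_pinfty_gt; exact: num_real.
have lipM : M.-lipschitz_on f (globally ((U `&` A) `*` (U `&` A))) by near: M.
near=> w => Aw.
have Uw : U w by near: w.
have := lipM (w, z); rewrite /= => /(_ _)/le_lt_trans -> //.
  by split; split => //; exact: nbhs_singleton.
rewrite mulrC -ltr_pdivlMr//; rewrite distrC.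
by near: w; apply: cvgr_dist_lt => //; rewrite divr_gt0.
Unshelve. all: by end_near. Qed.

Lemma ereal_cvg0 (R : realType) (u : nat -> \bar R) : (forall k, 0 <= u k)%E ->
  (forall th : R, 0 < th -> \forall k \near \oo, (u k <= th%:E)%E) ->
  u @ \oo --> 0%E.
Proof.
move=> u0 uth; apply/fine_cvgP; split.
  by apply: filterS (uth 1 ltr01) => k uk; rewrite ge0_fin_numE// (le_lt_trans uk)// ltry.
apply/cvgrPdist_le => e e0; apply: filterS (uth e e0) => k.
have := u0 k; rewrite /= sub0r normrN; case: (u k) => [x| |]//=.
by rewrite !lee_fin => x0 xe; rewrite ger0_norm.
Qed.

Lemma fine_cvg_limits (R : realType) (u : nat -> \bar R) (l : \bar R) : l \is a fin_num ->
  (forall k, u k \is a fin_num) -> fine (u k) @[k --> \oo] --> fine l ->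
  limn_einf u = l /\ limn_esup u = l.
Proof.
move=> lfin ufin ul.
have uE : u = (fun k => (fine (u k))%:E) by apply/funext => k; rewrite fineK.
have : u @ \oo --> l.
  by rewrite uE -(fineK lfin); apply: cvg_EFin => //; exact: nearW.
by move=> /cvg_limn_einf_sup[-> ->].
Qed.

Theorem theorem4p1 (R : realType) (d : nat) (hd : (2 <= d)%N)
    (B : set 'rV[R]_d.-1) (cB : compact B) (B0 : B° !=set0)
    (Y : set 'rV[R]_d) (cY : compact Y) (Y0 : Y !=set0)
    (c : 'rV[R]_d.-1 * R -> 'rV[R]_d -> R)
    (c_ge0 : forall x y, cylinder B x -> Y y -> 0 <= c x y)
    (cA : forall z, (cylinder B `*` Y) z -> exists2 U, nbhs z U &
      [lipschitz c w.1 w.2 | w in U `&` (cylinder B `*` Y)])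
    (cB_increasing : forall s y, B s -> Y y ->
      forall p p' : R, 0 <= p -> p < p' -> c (s, p) y < c (s, p') y)
    (cB_unbounded : forall s y, B s -> Y y ->
      forall M : R, exists2 p : R, 0 <= p & M < c (s, p) y)
    (cC : equicontinuous [set i : R * 'rV[R]_d | 0 <= i.1 /\ Y i.2]
      (fun i => (fun s => c (s, i.1) i.2) : subspace B -> R)) :
  let F (nu : prob_on R Y) (p : Pac B) := transport_functional c cB nu p in
  [/\ forall (p : PacLinf B) (nu : prob_on R Y), F nu p \is a fin_num,
      continuous (fun z : PacLinf B * prob_on R Y => fine (F z.2 z.1)) &
      forall (nu_ : nat -> prob_on R Y) (nu : prob_on R Y),
        nu_ @ \oo --> nu ->
      Gamma_cvg (fun n (p : PacLinf B) => F (nu_ n) p)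
        (fun p : PacLinf B => F nu p) /\
      forall (p_ : nat -> Pac B) (p : Pac B),
        (forall n, is_minimiser (F (nu_ n)) (p_ n)) ->
        is_minimiser (F nu) p ->
      [/\ exists (q_ : nat -> 'rV[R]_d.-1 -> R) (q : 'rV[R]_d.-1 -> R),
            [/\ forall n, continuous_density (p_ n) (q_ n),
                continuous_density p q &
                {uniform B, q_ @ \oo --> q}],
          'N[lebesgue_rVR d.-1]_1[EFin \o
            (\1_(subgraph B (p_ n)) \- \1_(subgraph B p) : _ -> R)%R]%E
            @[n --> \oo] --> 0%E &
          forall gamma_ : nat -> prob_on R (cylinder B `*` Y),
            (forall n, optimal_plan c (mu_pac cB (p_ n)) (nu_ n) (gamma_ n)) ->
          exists2 gamma : prob_on R (cylinder B `*` Y),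
            optimal_plan c (mu_pac cB p) nu gamma &
            exists2 k : nat -> nat, {homo k : m n / (m < n)%N} &
              (gamma_ \o k) @ \oo --> gamma]].
Proof.
move=> F.
have [D3 dD3] := @dense_seq_rV R d.-1.
have [D2 dD2] := @dense_seq_rV R d.
have [D0 dD0] := @dense_seq_R R.
have [D1 dD1] := dense_seq_prod dD3 dD0.
have clY : closed Y by apply: compact_closed => //; exact: norm_hausdorff.
have lB := lebesgue_rV_interior cB B0.
have c_cont := locally_lipschitz_near cA.
have clA : closed (cylinder B `*` Y) by apply: closed_setX => //; exact: cylinder_closed.
have mc : measurable_fun [set: borel ('rV[R]_d.-1 * R * 'rV[R]_d)%type]
    (cost_ext (cylinder B) Y c).
  apply/(measurable_restrictT _ (closed_borel clA)); apply/measurable_EFinP.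
  by apply: within_continuous_measurable => //; apply/within_continuousP.
have Ffin := functional_fin_num dD1 dD2 cB cY lB clY c_ge0 mc c_cont.
have Fcont := functional_continuous (cB := cB) dD1 dD2 cY lB clY c_ge0 mc c_cont.
split; [by move=> p nu; exact: Ffin|exact: Fcont|].
move=> nu_ nu nuC.
(* Continuous convergence, which contains both halves of Gamma-convergence. *)
have along (m : PacLinf B) (m_ : nat -> PacLinf B) : m_ @ \oo --> m ->
    limn_einf (fun n => F (nu_ n) (m_ n)) = F nu m /\
    limn_esup (fun n => F (nu_ n) (m_ n)) = F nu m.
  move=> mC; apply: fine_cvg_limits => //.
  have mnuC : (m_ k, nu_ k) @[k --> \oo] --> (m, nu).
    move=> P [[U V] /= [Um Vnu] UVP].
    apply: (@filterS2 _ \oo _ _ _ _ _ (mC _ Um) (nuC _ Vnu)) => k Uk Vk.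
    exact: (UVP (m_ k, nu_ k)).
  exact: (@cvg_comp _ _ _ (fun k => (m_ k, nu_ k))
    (fun z : PacLinf B * prob_on R Y => fine (F z.2 z.1)) _ _ _ mnuC (Fcont (m, nu))).
split.
  move=> m; split; first by move=> m_ /along[-> _].
  by exists (fun=> m); [exact: cvg_cst|have [_ ->] := along m (fun=> m) (@cvg_cst _ _ _ _ _)].
move=> p_ p minp_ minp.
have [M [r_ [r [M0 hr_ [rM rU] rC unif]]]] := minimisers_converge (cB := cB) dD1 dD2 dD3 cY lB Y0 clY
  c_ge0 mc c_cont cB_increasing cB_unbounded nuC minp_ minp.
have r_M k s : B s -> 0 <= r_ k s <= M by move=> Bs; exact: (hr_ k).1.
have r_U k (U : set (borel _)) : measurable U -> mu_pac cB (r_ k) U = mu_pac cB (p_ k) U.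
  exact: (hr_ k).2.
split => //; last first.
  exact: (optimal_plans_converge dD1 dD2 cY clY c_ge0 mc c_cont nuC minp_ minp
    r_M r_U rM rU rC).
have normE k : ('N[lebesgue_rVR d.-1]_1[EFin \o
    (\1_(subgraph B (p_ k)) \- \1_(subgraph B p) : _ -> R)%R] =
    \int[@lebesgue_rV R d.-1]_(s in B) `|r_ k s - r s|%:E)%E.
  rewrite Lnorm1 -(subgraph_symdiff _ _ (r_U k) rU) //.
  - by move=> s /(r_M k)/andP[].
  - by move=> s /rM/andP[].
rewrite (_ : (fun k => _) = fun k =>
  (\int[@lebesgue_rV R d.-1]_(s in B) `|r_ k s - r s|%:E)%E); last exact/funext.
by apply: ereal_cvg0 => [k|//]; exact: integral_ge0.
Qed.
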